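(* Let $r,c,p$ be integers with $r\ge c\ge 2$ and $p\ge 2$. Let $J_r(c,pc;n)$ denote the $\mathfrak{sl}_r$ invariant of the torus link $T(c,pc)$ with each of its $c$ components coloured by the partition $(n)$ (equivalently, by the irreducible $\mathfrak{sl}_r$-module of highest weight $n\Lambda_1$), and let $\overline{\chi}(W^0(p)_{Q_c})$ denote the normalized character of the $\mathfrak{sl}_c$ version of the $(1,p)$ singlet vertex operator algebra (both are given explicitly in the context). Then $$\lim_{n\to\infty} q^{\frac{p}{2}(-n^2c+nc^2)+\frac{nc(r-c)}{2}}\,J_r(c,pc;n)=\frac{1}{\prod_{1\le i\le c<j\le r}(1-q^{j-i})}\cdot\frac{(q)_\infty^{c-1}}{\prod_{1\le i<j\le c}(1-q^{j-i})}\;\overline{\chi}(W^0(p)_{Q_c}).$$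
   Context: Partitions. $\lambda\vdash m$ means that $\lambda=(\lambda_1\ge\lambda_2\ge\cdots)$ is a partition of $m$ and $\ell(\lambda)$ is its number of non-zero parts; $(n)^c$ is the partition $(n,\dots,n)$ with $c$ entries. The Kostka number $K_{\lambda,\mu}$ is the number of semistandard Young tableaux (rows weakly increasing, columns strictly increasing) of shape $\lambda$ in which $i$ occurs $\mu_i$ times for every $i\ge1$. Put $\kappa_\lambda=2\sum_{i=1}^{\ell(\lambda)}\sum_{j=1}^{\lambda_i}(j-i)$. Schur polynomials. For $\ell(\lambda)\le m$, $s_\lambda(x_1,\dots,x_m)$ is the Schur polynomial, and $$s_\lambda(q^{\frac{m-1}{2}},q^{\frac{m-3}{2}},\dots,q^{\frac{1-m}{2}})=\prod_{1\le i<j\le m}\frac{q^{\frac12(\lambda_i-\lambda_j+j-i)}-q^{-\frac12(\lambda_i-\lambda_j+j-i)}}{q^{\frac12(j-i)}-q^{-\frac12(j-i)}}.$$ Link invariant. The torus link $T(a,b)$ is the closure of the $a$-strand braid $(\sigma_1\cdots\sigma_{a-1})^b$; $T(c,pc)$ has $c$ components. $J_r(c,pc;n)$ is the (un-normalized) coloured HOMFLY invariant of $T(c,pc)$, all components coloured by $(n)$, specialized to $\mathfrak{sl}_r$ and with an overall monomial factor dropped. By the formula of Lin and Zheng it equals the following expression, which is to be taken as its definition: $$J_r(c,pc;n)=\sum_{\lambda\vdash nc,\ \ell(\lambda)\le r}K_{\lambda,(n)^c}\;q^{\frac p2\kappa_\lambda}\;s_\lambda(q^{\frac{r-1}{2}},q^{\frac{r-3}{2}},\dots,q^{\frac{1-r}{2}}).$$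 Lie algebra notation for $\mathfrak{sl}_c$. $Q_c$ is the root lattice, $P_c$ the weight lattice, $\Lambda_1,\dots,\Lambda_{c-1}$ the fundamental weights, $P_c^+$ the set of dominant integral weights, $\delta=\Lambda_1+\cdots+\Lambda_{c-1}$ the Weyl vector, and $(\cdot,\cdot)$ the invariant symmetric bilinear form with $(\Lambda_i,\Lambda_j)=\min(i,j)-\frac{ij}{c}$. For $\lambda\in P_c^+$, $L_c(\lambda)$ is the irreducible $\mathfrak{sl}_c$-module of highest weight $\lambda$ and $L_c(\lambda)_0$ is its zero weight space. For $\lambda=a_1\Lambda_1+\cdots+a_{c-1}\Lambda_{c-1}\in P_c^+$, $s_\lambda(q^{\frac{c-1}{2}},\dots,q^{\frac{1-c}{2}})$ means $s_{\widehat\lambda}(q^{\frac{c-1}{2}},\dots,q^{\frac{1-c}{2}})$ for any partition $\widehat\lambda$ with $\ell(\widehat\lambda)\le c$ and $\widehat\lambda_i-\widehat\lambda_{i+1}=a_i$ for $1\le i\le c-1$ (the value does not depend on the choice). Singlet character. With $(q)_\infty=\prod_{m\ge1}(1-q^m)$, the normalized character of the $(1,p)$ singlet VOA based on $\mathfrak{sl}_c$ (the usual character divided by a power of $q$) is, by definition, $$\overline{\chi}(W^0(p)_{Q_c})=\frac{\prod_{1\le i<j\le c}(1-q^{j-i})}{(q)_\infty^{c-1}}\sum_{\lambda\in Q_c\cap P_c^+}\dim(L_c(\lambda)_0)\;q^{\frac p2(\lambda,\lambda+2\delta)}\;s_\lambda(q^{\frac{c-1}{2}},q^{\frac{c-3}{2}},\dots,q^{\frac{1-c}{2}}).$$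 The limit is the coefficientwise limit of formal series in $q$ (each coefficient is eventually constant in $n$); factors $1/(1-q^k)$ are expanded in non-negative powers of $q$. *)

(* Defs.v *)
From HB Require Import structures.
From mathcomp Require Import all_boot all_order all_algebra.
From mathcomp Require Import mathcomp_extra boolp classical_sets functions.
From mathcomp Require Import cardinality fsbigop.
From mathcomp Require Import lra.
Set Implicit Arguments.
Unset Strict Implicit.
Unset Printing Implicit Defensive.
Import Order.TTheory GRing.Theory Num.Theory.
Local Open Scope classical_set_scope.
Local Open Scope ring_scope.

(* Formal series in q with rational exponents and rational coefficients.
   Finitely many exponents below any bound are allowed, so that products are
   finite coefficientwise; this covers Laurent series in q^(1/2), and
   inverting 1 - q^k amounts to expanding in non-negative powers of q. *)

Definition left_finite (f : rat -> rat) : Prop :=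
  forall e, finite_set [set d | d <= e /\ f d <> 0].

Record qser := QSer { qcoef : rat -> rat; qser_lf : left_finite qcoef }.

Lemma qserP (f g : qser) : (forall e, qcoef f e = qcoef g e) -> f = g.
Proof.
case: f g => [f hf] [g hg] /= /funext fg.
by case: _ / fg in hg *; congr QSer; apply: Prop_irrelevance.
Qed.

HB.instance Definition _ := gen_eqMixin qser.
HB.instance Definition _ := gen_choiceMixin qser.

Section QSerRing.

Implicit Types (f g h : rat -> rat) (x y z : qser).

Lemma lf_seq f (e : rat) : left_finite f ->
  exists2 A : seq rat, uniq A & forall d, d <= e -> f d <> 0 -> d \in A.
Proof.
move=> /(_ e) /finite_seqP [s hs]; exists (undup s); first exact: undup_uniq.
move=> d de fd; rewrite mem_undup.
have : [set d | d <= e /\ f d <> 0] d by [].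
by rewrite hs.
Qed.

Lemma lf_min f : left_finite f -> exists m : rat, forall d, d < m -> f d = 0.
Proof.
move=> lf; have [A _ hA] := lf_seq 0 lf.
exists (\big[Num.min/0]_(a <- A) a) => d dm; apply: contrapT => fd.
have d0 : d <= 0.
  apply: le_trans (ltW dm) _.
  by elim: (A) => [|a s IH]; rewrite ?big_nil // big_cons ge_min IH orbT.
have : \big[Num.min/0]_(a <- A) a <= d.
  have := hA d d0 fd.
  elim: (A) => [|a s IH] //; rewrite inE big_cons ge_min.
  by case/orP => [/eqP ->|/IH ->]; rewrite ?lexx ?orbT.
by rewrite leNgt dm.
Qed.

Lemma lf0 : left_finite (fun=> 0).
Proof. by move=> e; apply: sub_finite_set (finite_set0 _) => d []. Qed.

Lemma lfN f : left_finite f -> left_finite (fun e => - f e).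
Proof.
move=> lf e; apply: sub_finite_set (lf e) => d [de nz]; split => // fd.
by apply: nz; rewrite fd oppr0.
Qed.

Lemma lfD f g :
  left_finite f -> left_finite g -> left_finite (fun e => f e + g e).
Proof.
move=> lf lg e.
have : finite_set ([set d | d <= e /\ f d <> 0] `|` [set d | d <= e /\ g d <> 0]).
  by rewrite finite_setU.
apply: sub_finite_set => d /= [de nz].
case: (eqVneq (f d) 0) => [f0|/eqP fn]; last by left.
by right; split => // g0; apply: nz; rewrite f0 g0 addr0.
Qed.

Lemma lf_delta (e : rat) : left_finite (fun d => (d == e)%:R).
Proof.
move=> e'; apply: sub_finite_set (finite_set1 e) => d /= [_].
by case: (eqVneq d e).
Qed.

Definition qconv f g (e : rat) : rat := \sum_(d \in [set: rat]) f d * g (e - d).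

Lemma qconvE f g (mg e : rat) (A : seq rat) :
    (forall d, d < mg -> g d = 0) -> uniq A ->
    (forall d, d <= e - mg -> f d <> 0 -> d \in A) ->
  qconv f g e = \sum_(d <- A) f d * g (e - d).
Proof.
move=> hg uA hA; rewrite /qconv (fsbigE A) //.
  by apply: eq_bigl => d; rewrite in_setT.
move=> d _ dA; case: (lerP d (e - mg)) => [le|lt].
  have [->|/eqP fd] := eqVneq (f d) 0; first by rewrite mul0r.
  by move: dA; rewrite hA.
by rewrite hg ?mulr0 // ltrBlDl -ltrBlDr.
Qed.

Lemma qconv_supp f g (e : rat) : qconv f g e <> 0 ->
  exists2 d, f d <> 0 & g (e - d) <> 0.
Proof.
move=> nz; apply: contrapT => no; apply: nz; apply: fsbig1 => d _.
have [->|/eqP fd] := eqVneq (f d) 0; first by rewrite mul0r.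
have [->|/eqP gd] := eqVneq (g (e - d)) 0; first by rewrite mulr0.
by case: no; exists d.
Qed.

Lemma lfM f g : left_finite f -> left_finite g -> left_finite (qconv f g).
Proof.
move=> lf lg e.
have [mf hf] := lf_min lf; have [mg hg] := lf_min lg.
have [A _ hA] := lf_seq (e - mg) lf; have [B _ hB] := lf_seq (e - mf) lg.
apply: sub_finite_set (finite_seq [seq a + b | a <- A, b <- B]).
suff hS (x : rat) : x <= e -> qconv f g x <> 0 ->
    x \in [seq a + b | a <- A, b <- B] by move=> x [/hS].
move=> xe /qconv_supp [d fd gd].
have dmf : mf <= d by rewrite leNgt; apply/negP => /hf.
have dmg : mg <= x - d by rewrite leNgt; apply/negP => /hg.
apply/allpairsP; exists (d, x - d); rewrite /= [d + _]addrC subrK; split => //.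
  apply: hA => //; rewrite lerBrDr; apply: le_trans xe.
  by rewrite -lerBrDl.
by apply: hB => //; apply: lerB.
Qed.

Lemma qconvC f g : qconv f g = qconv g f.
Proof.
apply/funext => e; rewrite /qconv.
rewrite (reindex_fsbigT (fun d : rat => e - d)) /=.
  by apply: eq_fsbigr => d _; rewrite subKr mulrC.
by exists (fun d => e - d) => d; rewrite subKr.
Qed.

Lemma qconvDl f g h : left_finite f -> left_finite g -> left_finite h ->
  qconv (fun e => f e + g e) h = fun e => qconv f h e + qconv g h e.
Proof.
move=> lf lg lh; apply/funext => e; have [mh hh] := lf_min lh.
have [A _ hA] := lf_seq (e - mh) lf; have [B _ hB] := lf_seq (e - mh) lg.
pose C := undup (A ++ B).
have uC : uniq C := undup_uniq _.
have fC d : d <= e - mh -> f d <> 0 -> d \in C.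
  by move=> de fd; rewrite mem_undup mem_cat hA.
have gC d : d <= e - mh -> g d <> 0 -> d \in C.
  by move=> de gd; rewrite mem_undup mem_cat hB // orbT.
rewrite !(qconvE (A := C) hh) // -?big_split /=.
  by apply: eq_bigr => d _; rewrite mulrDl.
move=> d de; have [f0|/eqP fd _] := eqVneq (f d) 0; last exact: fC.
by rewrite f0 add0r; apply: gC.
Qed.

Lemma qconvA f g h : left_finite f -> left_finite g -> left_finite h ->
  qconv f (qconv g h) = qconv (qconv f g) h.
Proof.
move=> lf lg lh; apply/funext => e.
have [mf hf] := lf_min lf; have [mg hg] := lf_min lg.
have [mh hh] := lf_min lh.
have [A uA hA] := lf_seq (e - (mg + mh)) lf.
have [B _ hB] := lf_seq (e - (mf + mh)) lg.
pose C := undup [seq a + b | a <- A, b <- B].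
have uC : uniq C := undup_uniq _.
have inC a b : a \in A -> b \in B -> a + b \in C.
  by move=> aA bB; rewrite mem_undup; apply/allpairsP; exists (a, b).
have low1 d : f d <> 0 -> mf <= d by move=> fd; rewrite leNgt; apply/negP => /hf.
have low2 d : g d <> 0 -> mg <= d by move=> gd; rewrite leNgt; apply/negP => /hg.
have low3 d : h d <> 0 -> mh <= d by move=> gd; rewrite leNgt; apply/negP => /hh.
have hgh d : d < mg + mh -> qconv g h d = 0.
  move=> dlt; apply: contrapT => /qconv_supp [b /low2 gb /low3 hb]; lra.
rewrite (qconvE hgh uA) //.
rewrite (qconvE (A := C) hh) //; last first.
  move=> s se /qconv_supp [a fa ga].
  have ma := low1 _ fa; have mb := low2 _ ga.
  have -> : s = a + (s - a) by lra.
  by apply: inC; [apply: hA => //; lra | apply: hB => //; lra].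
transitivity (\sum_(a <- A) \sum_(s <- C) f a * (g (s - a) * h (e - s))).
  apply: eq_big_seq => a aA; rewrite -big_distrr /=.
  have [->|/eqP fa] := eqVneq (f a) 0; first by rewrite !mul0r.
  have ma := low1 _ fa.
  congr (_ * _); rewrite (qconvE (A := [seq s - a | s <- C]) hh).
  - by rewrite big_map; apply: eq_bigr => s _; congr (_ * h _); lra.
  - by rewrite map_inj_uniq // => u v /addIr.
  - move=> b be gb; apply/mapP; exists (a + b); last by rewrite addrC addKr.
    by apply: inC => //; apply: hB => //; lra.
rewrite exchange_big /=; apply: eq_bigr => s _.
have [->|/eqP hs] := eqVneq (h (e - s)) 0.
  by rewrite mulr0 big1 // => a _; rewrite !mulr0.
have ms := low3 _ hs.
rewrite (qconvE hg uA) ?big_distrl /=.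
  by apply: eq_bigr => a _; rewrite mulrA.
by move=> d dx; apply: hA; lra.
Qed.

Lemma qconv1 f : left_finite f -> qconv (fun d => (d == 0)%:R) f = f.
Proof.
move=> lf; apply/funext => e; have [m hm] := lf_min lf.
rewrite (qconvE (A := [:: 0]) hm) //.
  by rewrite big_seq1 eqxx mul1r subr0.
by move=> d _ /eqP; rewrite inE pnatr_eq0 eqb0 negbK.
Qed.

Definition qzero := QSer lf0.
Definition qopp x := QSer (lfN (qser_lf x)).
Definition qadd x y := QSer (lfD (qser_lf x) (qser_lf y)).
Definition qmul x y := QSer (lfM (qser_lf x) (qser_lf y)).

(* The monomial q^e. *)
Definition qpow (e : rat) := QSer (lf_delta e).

Fact qaddA : associative qadd.
Proof. by move=> x y z; apply: qserP => e /=; rewrite addrA. Qed.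
Fact qaddC : commutative qadd.
Proof. by move=> x y; apply: qserP => e /=; rewrite addrC. Qed.
Fact qadd0 : left_id qzero qadd.
Proof. by move=> x; apply: qserP => e /=; rewrite add0r. Qed.
Fact qaddN : left_inverse qzero qopp qadd.
Proof. by move=> x; apply: qserP => e /=; rewrite addNr. Qed.
HB.instance Definition _ := GRing.isZmodule.Build qser qaddA qaddC qadd0 qaddN.

Fact qmulA : associative qmul.
Proof.
by move=> x y z; apply: qserP => e /=; rewrite qconvA //; exact: qser_lf.
Qed.
Fact qmulC : commutative qmul.
Proof. by move=> x y; apply: qserP => e /=; rewrite qconvC. Qed.
Fact qmul1 : left_id (qpow 0) qmul.
Proof. by move=> x; apply: qserP => e /=; rewrite qconv1 //; exact: qser_lf. Qed.
Fact qmulDl : left_distributive qmul qadd.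
Proof.
by move=> x y z; apply: qserP => e /=; rewrite qconvDl //; exact: qser_lf.
Qed.
Fact qpow0_neq0 : qpow 0 != 0.
Proof. by apply/eqP => /(congr1 (fun x => qcoef x 0)) /eqP; rewrite /= ?eqxx oner_eq0. Qed.
HB.instance Definition _ :=
  GRing.Zmodule_isComNzRing.Build qser qmulA qmulC qmul1 qmulDl qpow0_neq0.

Definition qunit : {pred qser} := fun x => `[< exists y, y * x = 1 >].
Definition qinv x : qser :=
  if pselect (exists y, y * x = 1) is left h then projT1 (cid h) else x.

Fact qmulVx : {in qunit, left_inverse 1 qinv *%R}.
Proof. by move=> x /asboolP h; rewrite /qinv; case: pselect => // h'; case: cid. Qed.
Fact qunitPl x y : y * x = 1 -> qunit x.
Proof. by move=> h; apply/asboolP; exists y. Qed.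
Fact qinv_out : {in [predC qunit], qinv =1 id}.
Proof. by move=> x /asboolPn h; rewrite /qinv; case: pselect. Qed.
HB.instance Definition _ :=
  GRing.ComNzRing_hasMulInverse.Build qser qmulVx qunitPl qinv_out.

End QSerRing.

Notation q := (qpow 1).

(* Coefficientwise limit: every coefficient is eventually constant. *)
Definition qcvg (u : nat -> qser) (l : qser) : Prop :=
  forall e : rat, exists N : nat,
    forall n : nat, (N <= n)%N -> qcoef (u n) e = qcoef l e.

(* The limit when it exists (it is then unique), 0 otherwise. *)
Definition qlim (u : nat -> qser) : qser := xget 0 [set l | qcvg u l].

(* Coefficientwise sum of a possibly infinite family; meaningful when each
   exponent occurs in finitely many terms and the sum is left-finite. *)
Definition qsum (I : choiceType) (D : set I) (F : I -> qser) : qser :=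
  let f e := \sum_(i \in D) qcoef (F i) e in
  if pselect (left_finite f) is left h then QSer h else 0.

(* (q)_oo *)
Definition qinfty : qser :=
  qlim (fun N => \prod_(1 <= m < N.+1) (1 - q ^+ m)).

(* Partitions are non-increasing sequences, trailing zeros allowed; the row
   and column indices of cells and the entries of tableaux start from 0. *)

Definition cell (la : seq nat) := {i : 'I_(size la) & 'I_(nth 0%N la i)}.
Definition crow (la : seq nat) (x : cell la) : nat := tag x.
Definition ccol (la : seq nat) (x : cell la) : nat := tagged x.

Definition ssyt (la : seq nat) (m : nat) (T : {ffun cell la -> 'I_m}) : bool :=
  [forall x : cell la, forall y : cell la,
    ((crow x == crow y) && (ccol x <= ccol y)%N ==> (T x <= T y)%N) &&
    ((ccol x == ccol y) && (crow x < crow y)%N ==> (T x < T y)%N)].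

Definition kostka (la mu : seq nat) : nat :=
  #|[set T : {ffun cell la -> 'I_(size mu)} | ssyt T &
      [forall i, #|[set x | T x == i]| == nth 0%N mu i]]%SET|.

Definition schur (R : comNzRingType) (la : seq nat) (m : nat) (x : 'I_m -> R) : R :=
  \sum_(T : {ffun cell la -> 'I_m} | ssyt T) \prod_(y : cell la) x (T y).

(* s_la(q^((m-1)/2), q^((m-3)/2), ..., q^((1-m)/2)) *)
Definition schur_principal (la : seq nat) (m : nat) : qser :=
  schur la (fun i : 'I_m => qpow ((m%:R - 1 - 2 * i%:R) / 2)).

Definition kappa (la : seq nat) : int :=
  2 * \sum_(i < size la) \sum_(j < nth 0%N la i) (j%:Z - i%:Z).

(* Partitions of n * c with at most r nonzero parts are represented by
   r-tuples padded with zeros. *)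
Definition is_partition (la : seq nat) (m : nat) : bool :=
  sorted geq la && (sumn la == m).

Definition torus_link_inv (r c p n : nat) : qser :=
  \sum_(t : r.-tuple 'I_(n * c).+1 | is_partition (map val t) (n * c))
    let la : seq nat := map val t in
    (kostka la (nseq c n))%:R * qpow (p%:R / 2 * (kappa la)%:~R)
      * schur_principal la r.

(* Weights of sl_c are given by their integer coordinates on the fundamental
   weights; the index i : 'I_c.-1 stands for i + 1. *)

Definition weight (c : nat) := 'rV[int]_c.-1.

(* Row i gives the simple root alpha_(i+1). *)
Definition cartan (c : nat) : 'M[int]_c.-1 :=
  \matrix_(i, j) if i == j then 2
    else if (i.+1 == j :> nat) || (j.+1 == i :> nat) then -1 else 0.

Definition in_root_lattice (c : nat) (la : weight c) : Prop :=
  exists b : 'rV[int]_c.-1, la = b *m cartan c.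

Definition dominant (c : nat) (la : weight c) : Prop :=
  forall i, 0 <= la 0 i.

Definition weyl_vector (c : nat) : weight c := const_mx 1.

Definition weight_form (c : nat) (la mu : weight c) : rat :=
  \sum_(i < c.-1) \sum_(j < c.-1) (la 0 i)%:~R * (mu 0 j)%:~R *
    ((minn i.+1 j.+1)%:R - i.+1%:R * j.+1%:R / c%:R).

(* The partition with c-th entry 0 whose successive differences are the
   coordinates of la. *)
Definition weight_partition (c : nat) (la : weight c) : seq nat :=
  mkseq (fun i => \sum_(k < c.-1 | (i <= k)%N) `|la 0%R k|%N)%N c.

(* Finite-dimensional sl_c(K)-modules; the values of sl_act outside traceless
   matrices are irrelevant. *)
Record sl_module (K : fieldType) (c : nat) := SlModule {
  sl_space : vectType K;
  sl_act : 'M[K]_c -> 'End(sl_space);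
  sl_act_linear : forall (a : K) (X Y : 'M[K]_c), \tr X = 0 -> \tr Y = 0 ->
    sl_act (a *: X + Y) = a *: sl_act X + sl_act Y;
  sl_act_bracket : forall X Y : 'M[K]_c, \tr X = 0 -> \tr Y = 0 ->
    sl_act (X *m Y - Y *m X) =
      (sl_act X \o sl_act Y)%VF - (sl_act Y \o sl_act X)%VF
}.

Section Modules.

Variables (K : fieldType) (c : nat).

Definition sl_submodule (V : sl_module K c) (U : {vspace sl_space V}) : Prop :=
  forall X : 'M[K]_c, \tr X = 0 -> (sl_act V X @: U <= U)%VS.

Definition sl_irreducible (V : sl_module K c) : Prop :=
  (fullv : {vspace sl_space V}) <> 0%VS /\
  forall U : {vspace sl_space V}, sl_submodule U -> U = 0%VS \/ U = fullv.

Definition coroot (i : 'I_c.-1) : 'M[K]_c :=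
  diag_mx (\row_(j < c) ((j == i :> nat)%:R - (j == i.+1 :> nat)%:R)).

Definition has_highest_weight (V : sl_module K c) (la : weight c) : Prop :=
  exists v : sl_space V,
    [/\ v <> 0,
        forall i j : 'I_c, (i < j)%N -> sl_act V (delta_mx i j) v = 0
      & forall i : 'I_c.-1, sl_act V (coroot i) v = (la 0 i)%:~R *: v].

Definition is_irr_module (V : sl_module K c) (la : weight c) : Prop :=
  sl_irreducible V /\ has_highest_weight V la.

Definition zero_weight_space (V : sl_module K c) : {vspace sl_space V} :=
  (\bigcap_(i < c.-1) lker (sl_act V (coroot i)))%VS.

(* The normalized singlet character, for a family L of irreducible modules
   L la of highest weight la. *)
Definition singlet_char (p : nat) (L : weight c -> sl_module K c) : qser :=
  (\prod_(1 <= i < c.+1) \prod_(i.+1 <= j < c.+1) (1 - q ^+ (j - i)))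
    / qinfty ^+ c.-1
  * qsum [set la : weight c | in_root_lattice la /\ dominant la]
      (fun la => (\dim (zero_weight_space (L la)))%:R
         * qpow (p%:R / 2 * weight_form la (la + 2 *: weyl_vector c))
         * schur_principal (weight_partition la) c).

End Modules.

(* Main.v *)
Require Import Defs.
From HB Require Import structures.
From mathcomp Require Import boolp classical_sets functions cardinality fsbigop.
From mathcomp Require Import all_boot all_order all_algebra.
From mathcomp Require Import archimedean perm zify ring lra.
From mathcomp Require mpoly.
Set Implicit Arguments.
Unset Strict Implicit.
Unset Printing Implicit Defensive.
Import Order.TTheory GRing.Theory Num.Theory.
Local Open Scope ring_scope.

(* Only partitions with at most c rows have a nonzero Kostka number, and those of n c are
   la = (n)^c + mu with mu a dominant weight of sl_c in the root lattice.  By the product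
   formula for principal specializations, the normalized summand of la is the summand of mu
   in the singlet character times the product over i <= c < j of
   (1 - q^(n + mu_i + j - i)) / (1 - q^(j - i)), because K_(la, (n)^c) = dim L(mu)_0.  The
   lowest exponent of the mu-summand is at least |mu|^2, so the limit may be taken termwise,
   and there the numerators tend to 1.

   The product formula is the Vandermonde case of the bialternant formula, which follows by
   induction on the number of variables from the branching rule (remove the boxes holding the
   largest entry).

   For the equality of K_(la, nu) with the multiplicity of nu in L(la), let chi be the formal
   character of L(la).  Traces of e_a f_a on weight spaces turn the scalar action of the
   Casimir element into a differential equation for chi (Freudenthal), which says that
   a_delta chi is an eigenvector of the Laplacian sum_i (x_i d/dx_i)^2 with eigenvalue
   |la + delta|^2; so is a_delta s_la = a_(la + delta).  Since |nu + delta| < |la + delta| for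
   every other weight nu of chi or s_la, the highest monomial of chi - s_la cannot exist. *)

(** * Semistandard tableaux and the branching rule *)

(** As sl_c does not see full columns, the zero weight space of L(mu) turns into the weight space of
    (n)^c once the identity matrix is made to act by n c; weights are then exponent vectors of
    polynomials in c variables. The modules are only known to be irreducible with a highest weight
    vector, so their weights are controlled through words in lowering operators and sl_2-strings.

    Why multiplication by a_delta simplifies Freudenthal's relation: let theta_i = x_i d/dx_i and
    let t_ij be the weightwise trace of e_ij e_ji. Cyclicity gives x_j t_ij = x_i t_ji, and the
    commutator gives t_ij - t_ji = theta_i chi - theta_j chi. Hence (x_i - x_j) t_ij = x_i (theta_i
    chi - theta_j chi): the denominators are those of the logarithmic derivatives of a_delta, and
    the t_ij cancel against the cross term of the Laplacian of a_delta chi.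

    The mu-summand starts at the exponent (p/2) (mu, mu + 2 delta) - (mu, delta) = (p/2) |mu|^2 + (p
    - 1) (mu, delta); this is where p >= 2 gives the bound |mu|^2. *)

Lemma cell_inj (la : seq nat) (x y : cell la) :
  crow x = crow y -> ccol x = ccol y -> x = y.
Proof.
case: x y => [i j] [i' j']; rewrite /crow /ccol /= => /val_inj e.
by case: _ / e in j' * => /val_inj ->.
Qed.

Lemma nth_gt0_size (la : seq nat) (i j : nat) : (j < nth 0 la i)%N -> (i < size la)%N.
Proof. by move=> h; rewrite ltnNge; apply/negP => h'; rewrite nth_default in h. Qed.

Definition cell_at (la : seq nat) (i j : nat) (hj : (j < nth 0 la i)%N) : cell la :=
  Tagged (fun i : 'I_(size la) => 'I_(nth 0%N la i))
    (Ordinal (hj : (j < nth 0 la (Ordinal (nth_gt0_size hj)))%N)).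

Lemma ex_cell (la : seq nat) (i j : nat) : (j < nth 0 la i)%N ->
  exists x : cell la, crow x = i /\ ccol x = j.
Proof. by move=> hj; exists (cell_at hj). Qed.

Lemma ccol_lt (la : seq nat) (x : cell la) : (ccol x < nth 0 la (crow x))%N.
Proof. by case: x => i j; rewrite /ccol /crow /=. Qed.

Lemma crow_lt (la : seq nat) (x : cell la) : (crow x < size la)%N.
Proof. by case: x => i j; rewrite /crow /=. Qed.

Lemma card_cell (la : seq nat) : #|{: cell la}| = sumn la.
Proof.
rewrite card_tagged.
rewrite -[in RHS](mkseq_nth 0%N la) /mkseq -val_enum_ord -map_comp.
by congr sumn; apply: eq_map => i /=; rewrite card_ord.
Qed.

(** Shapes with [m] rows are encoded as finite functions with values below [N], so that sums over
    them are sums over a finite type. *)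
Definition ffun_seq m N (f : {ffun 'I_m -> 'I_N}) : seq nat :=
  [seq (f i : nat) | i <- enum 'I_m].

Lemma size_ffun_seq m N (f : {ffun 'I_m -> 'I_N}) : size (ffun_seq f) = m.
Proof. by rewrite size_map size_enum_ord. Qed.

Lemma nth_ffun_seq m N (f : {ffun 'I_m -> 'I_N}) (i : 'I_m) :
  nth 0%N (ffun_seq f) i = f i.
Proof. by rewrite (nth_map i) ?nth_ord_enum // size_enum_ord. Qed.

Lemma nth_sorted_geq (la : seq nat) i j : sorted geq la -> (i <= j)%N ->
  (nth 0 la j <= nth 0 la i)%N.
Proof.
move=> s ij; have [hj|hj] := ltnP j (size la); last by rewrite nth_default.
have tr : transitive geq by move=> a b c /= h1 h2; apply: leq_trans h2 h1.
exact: (sorted_leq_nth tr (fun a => leqnn a) 0%N s i j (leq_ltn_trans ij hj) hj ij).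
Qed.

Section Branching.
Variables (la : seq nat) (m N : nat).
Hypotheses (hs : size la = m.+1) (so : sorted geq la).
Hypothesis hN : (nth 0 la 0 < N)%N.

(** The skew shape [la / f] is then a horizontal strip, the region that copies of the largest entry
    can fill. *)
Definition interlaces (f : {ffun 'I_m -> 'I_N}) : bool :=
  [forall i : 'I_m, (nth 0 la i.+1 <= f i <= nth 0 la i)%N].

(** [f] is the shape left when the boxes of [T] holding the largest entry are removed. *)
Definition compat (T : {ffun cell la -> 'I_m.+1}) (f : {ffun 'I_m -> 'I_N}) :=
  [forall y : cell la, (T y < m)%N == (ccol y < nth 0 (ffun_seq f) (crow y))%N].

Lemma ssytP n (nu : seq nat) (T : {ffun cell nu -> 'I_n}) :
  reflect ((forall x y, crow x = crow y -> (ccol x <= ccol y)%N -> (T x <= T y)%N) /\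
           (forall x y, ccol x = ccol y -> (crow x < crow y)%N -> (T x < T y)%N))
    (ssyt T).
Proof.
apply: (iffP forallP) => [h|[h1 h2] x].
  split=> x y e l; have /forallP /(_ y) /andP [/implyP a /implyP b] := h x.
    by apply: a; rewrite e eqxx.
  by apply: b; rewrite e eqxx.
apply/forallP => y; apply/andP; split; apply/implyP => /andP [/eqP e l]; auto.
Qed.

Lemma ssyt_row_le n (nu : seq nat) (T : {ffun cell nu -> 'I_n}) (x : cell nu) :
  sorted geq nu -> ssyt T -> (crow x <= T x)%N.
Proof.
move=> sn /ssytP [_ hc]; move e : (crow x) => i; elim: i x e => // i IH x e.
have /ex_cell [y [ry cy]] : (ccol x < nth 0 nu i)%N.
  by apply: leq_trans (ccol_lt x) _; rewrite e; apply: nth_sorted_geq.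
by apply: leq_ltn_trans (IH y ry) _; apply: hc; rewrite ?ry ?cy ?e.
Qed.

Lemma ex_compat T : ssyt T -> exists f, interlaces f && compat T f.
Proof.
move=> sT; have /ssytP [hr hc] := sT.
pose a (i j : nat) := [exists y : cell la, [&& crow y == i, ccol y == j & (T y < m)%N]].
have aP (y : cell la) : a (crow y) (ccol y) = (T y < m)%N.
  apply/existsP/idP => [[z /and3P [/eqP e1 /eqP e2]]|h].
    by rewrite (cell_inj e1 e2).
  by exists y; rewrite !eqxx.
(* [g i] is the length of the initial run of entries below [m] in row [i]; [find] returns the full
   row length when no entry equals [m]. *)
pose g i := find (fun j => ~~ a i j) (iota 0 (nth 0 la i)).
have gle i : (g i <= nth 0 la i)%N.
  by have := find_size (fun j => ~~ a i j) (iota 0 (nth 0%N la i)); rewrite size_iota.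
have gP (y : cell la) : (T y < m)%N = (ccol y < g (crow y))%N.
  apply/idP/idP => [|h]; last first.
    have := before_find 0%N h; rewrite nth_iota ?add0n ?aP //; last exact: ccol_lt.
    by move/negbT; rewrite negbK.
  rewrite -aP ltnNge; apply: contraL => h.
  have gl : (g (crow y) < nth 0 la (crow y))%N := leq_ltn_trans h (ccol_lt y).
  have : has (fun j => ~~ a (crow y) j) (iota 0 (nth 0 la (crow y))).
    by rewrite has_find size_iota.
  move=> /(nth_find 0%N); rewrite -/(g (crow y)) nth_iota // add0n.
  have [z [rz cz]] := ex_cell gl.
  have az := aP z; rewrite rz cz in az; rewrite az aP; apply: contra => hy.
  by apply: leq_ltn_trans hy; apply: hr; rewrite ?rz ?cz.
have gN i : (g i < N)%N.
  by apply: leq_ltn_trans (gle i) _; apply: leq_ltn_trans hN; apply: nth_sorted_geq.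
exists [ffun i : 'I_m => Ordinal (gN i)]; apply/andP; split.
  apply/forallP => i; rewrite ffunE /= gle andbT.
  (* If [g i] were smaller than the next row, the cell in row [i] and column [g i] would hold the
     largest entry and still have a cell below it. *)
  rewrite leqNgt; apply/negP => h.
  have [z [rz cz]] := ex_cell h.
  have h' : (g i < nth 0 la i)%N.
    by apply: leq_trans h _; apply: nth_sorted_geq.
  have [y [ry cy]] := ex_cell h'.
  have : (T y < T z)%N by apply: hc; rewrite ?ry ?rz ?cy ?cz.
  have := gP y; rewrite ry cy ltnn => /negbT; rewrite -leqNgt => h1 h2.
  by have := leq_ltn_trans h1 h2; rewrite ltnNge -ltnS ltn_ord.
apply/forallP => y.
have := crow_lt y; rewrite [X in (_ < X)%N]hs ltnS leq_eqVlt => /orP [/eqP e|l].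
  (* The last row, of index [m], lies outside [f]: by column strictness its entries are all equal to
     [m]. *)
  rewrite e nth_default ?size_ffun_seq // ltn0.
  have := ssyt_row_le y so sT; rewrite e => h.
  by rewrite ltnNge h.
rewrite gP.
by rewrite (nth_ffun_seq _ (Ordinal l)) ffunE.
Qed.

Lemma compat_uniq T f g : interlaces f -> compat T f -> interlaces g -> compat T g -> f = g.
Proof.
move=> /forallP fi /forallP fc /forallP gi /forallP gc.
suff H (f1 g1 : {ffun 'I_m -> 'I_N}) :
    (forall i : 'I_m, (nth 0 la i.+1 <= f1 i <= nth 0 la i)%N) ->
    (forall y : cell la, (T y < m)%N == (ccol y < nth 0 (ffun_seq f1) (crow y))%N) ->
    (forall y : cell la, (T y < m)%N == (ccol y < nth 0 (ffun_seq g1) (crow y))%N) ->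
    forall i, (f1 i <= g1 i)%N.
  by apply/ffunP => i; apply/val_inj/eqP; rewrite eqn_leq !H.
move=> {fi fc gi gc} fi fc gc i; rewrite leqNgt; apply/negP => h.
have /andP [_ h2] := fi i.
have [y [ry cy]] := ex_cell (leq_trans h h2).
have /eqP := gc y; rewrite (eqP (fc y)) ry cy !nth_ffun_seq h.
by rewrite ltnn.
Qed.

Section Extend.
Variable f : {ffun 'I_m -> 'I_N}.
Hypothesis fi : interlaces f.
Let nu := ffun_seq f.

Lemma nu_le i : (nth 0 nu i <= nth 0 la i)%N.
Proof.
have [h|h] := ltnP i m; last by rewrite nth_default // size_ffun_seq.
by rewrite (nth_ffun_seq _ (Ordinal h)); have /forallP /(_ (Ordinal h)) /andP [] := fi.
Qed.

Lemma le_nu i : (i < m)%N -> (nth 0 la i.+1 <= nth 0 nu i)%N.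
Proof.
move=> h; rewrite (nth_ffun_seq _ (Ordinal h)).
by have /forallP /(_ (Ordinal h)) /andP [] := fi.
Qed.

Lemma sorted_nu : sorted geq nu.
Proof.
apply/(sortedP 0%N) => i; rewrite size_ffun_seq => h /=.
exact: leq_trans (nu_le _) (le_nu (ltnW h)).
Qed.

Definition cell_emb (y : cell nu) : cell la :=
  cell_at (leq_trans (ccol_lt y) (nu_le (crow y))).

Lemma cell_emb_inj : injective cell_emb.
Proof.
by move=> y z e; apply: cell_inj; [apply: (congr1 (@crow la) e)|apply: (congr1 (@ccol la) e)].
Qed.

Definition ssyt_ext (T : {ffun cell nu -> 'I_m}) : {ffun cell la -> 'I_m.+1} :=
  [ffun x => if [pick y | cell_emb y == x] is Some y
             then widen_ord (leqnSn m) (T y) else ord_max].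

Lemma ssyt_ext_emb T y : ssyt_ext T (cell_emb y) = widen_ord (leqnSn m) (T y).
Proof.
rewrite ffunE; case: pickP => [z /eqP /cell_emb_inj -> //|/(_ y)].
by rewrite eqxx.
Qed.

Lemma emb_ex (x : cell la) : (ccol x < nth 0 nu (crow x))%N ->
  exists y, x = cell_emb y.
Proof. by move=> /ex_cell [y [h1 h2]]; exists y; apply: cell_inj. Qed.

Lemma ssyt_ext_max T x : (nth 0 nu (crow x) <= ccol x)%N -> ssyt_ext T x = ord_max.
Proof.
move=> h; rewrite ffunE; case: pickP => // z /eqP e; move: h.
by rewrite -e leqNgt (ccol_lt z).
Qed.

Lemma compat_ext T : compat (ssyt_ext T) f.
Proof.
apply/forallP => x; apply/eqP; rewrite -/nu.
have [h|h] := ltnP (ccol x) (nth 0%N nu (crow x)).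
  by have [y ->] := emb_ex h; rewrite ssyt_ext_emb /= ltn_ord.
by rewrite ssyt_ext_max // ltnn.
Qed.

(** Column strictness is where interlacing enters: a cell of [la] with another cell below it lies in
    [nu], so no column contains the largest entry twice. *)
Lemma ssyt_extP T : ssyt T -> ssyt (ssyt_ext T).
Proof.
move=> /ssytP [hr hc]; apply/ssytP; split=> x y.
  move=> er ec; have [hy|hy] := ltnP (ccol y) (nth 0 nu (crow y)); last first.
    by rewrite (ssyt_ext_max _ hy) -ltnS ltn_ord.
  have hx : (ccol x < nth 0 nu (crow x))%N by rewrite er; apply: leq_ltn_trans hy.
  have [x' ex] := emb_ex hx; have [y' ey] := emb_ex hy.
  by move: er ec; rewrite ex ey !ssyt_ext_emb /=; apply: hr.
move=> ec er.
have rm : (crow x < m)%N by apply: leq_trans er _; rewrite -ltnS -[X in (_ < X)%N]hs crow_lt.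
have hx : (ccol x < nth 0 nu (crow x))%N.
  apply: leq_trans (le_nu rm); rewrite ec; apply: leq_trans (ccol_lt y) _.
  exact: nth_sorted_geq.
have [x' ex] := emb_ex hx.
have [hy|hy] := ltnP (ccol y) (nth 0 nu (crow y)); last first.
  by rewrite (ssyt_ext_max _ hy) ex ssyt_ext_emb /=.
have [y' ey] := emb_ex hy.
by move: er ec; rewrite ex ey !ssyt_ext_emb /= => er ec; apply: hc.
Qed.

Lemma ssyt_ext_inj : injective ssyt_ext.
Proof.
move=> T T' e; apply/ffunP => y; apply/val_inj.
by have /ffunP /(_ (cell_emb y)) := e; rewrite !ssyt_ext_emb => /(congr1 val).
Qed.

Lemma ssyt_ext_surj (T : {ffun cell la -> 'I_m.+1}) : ssyt T -> compat T f ->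
  exists2 T', ssyt T' & T = ssyt_ext T'.
Proof.
move=> /ssytP [hr hc] /forallP hf.
have hT y : (T (cell_emb y) < m)%N by rewrite (eqP (hf _)); apply: (ccol_lt y).
exists [ffun y => Ordinal (hT y)].
  apply/ssytP; split=> x y e l; rewrite !ffunE /=.
    exact: (hr (cell_emb x) (cell_emb y)).
  exact: (hc (cell_emb x) (cell_emb y)).
apply/ffunP => x; have [hx|hx] := ltnP (ccol x) (nth 0 nu (crow x)).
  by have [y ->] := emb_ex hx; rewrite ssyt_ext_emb ffunE; apply: val_inj.
rewrite ssyt_ext_max //; apply/val_inj/eqP => /=.
rewrite eqn_leq -ltnS ltn_ord leqNgt (eqP (hf x)) -leqNgt; exact: hx.
Qed.

Lemma prod_ext (R : comNzRingType) (x : 'I_m.+1 -> R) T :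
  \prod_y x (ssyt_ext T y) =
    x ord_max ^+ (sumn la - sumn nu) * \prod_y x (widen_ord (leqnSn m) (T y)).
Proof.
rewrite (bigID (mem [set cell_emb y | y in setT])) /= mulrC; congr (_ * _).
  rewrite (eq_bigr (fun=> x ord_max)) => [|y hy]; last first.
    congr x; apply: ssyt_ext_max; rewrite leqNgt; apply: contra hy => /emb_ex [z ->].
    exact: imset_f.
  rewrite prodr_const; congr (_ ^+ _).
  rewrite -!card_cell -[X in _ = (_ - X)%N]cardsT -(card_imset _ cell_emb_inj).
  by rewrite -(cardC (mem [set cell_emb y | y in setT])) addKn.
rewrite big_imset /=; last by move=> ? ? _ _; apply: cell_emb_inj.
by apply: eq_big => [y|y _]; rewrite ?inE // ssyt_ext_emb.
Qed.
End Extend.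

(** Every tableau has exactly one compatible shape, so a sum over shapes can be inserted and
    exchanged; [ssyt_ext] then parametrizes the tableaux of each shape. *)
Lemma schur_branch (R : comNzRingType) (x : 'I_m.+1 -> R) :
  schur la x = \sum_(f : {ffun 'I_m -> 'I_N} | interlaces f)
    x ord_max ^+ (sumn la - sumn (ffun_seq f)) *
      schur (ffun_seq f) (fun i => x (widen_ord (leqnSn m) i)).
Proof.
transitivity (\sum_(T : {ffun cell la -> 'I_m.+1} | ssyt T)
   \sum_(f : {ffun 'I_m -> 'I_N} | interlaces f && compat T f) \prod_y x (T y)).
  apply: eq_bigr => T sT; have [f hf] := ex_compat sT.
  rewrite (big_pred1 f) // => g; apply/idP/eqP => [|-> //] /andP [g1 g2].
  by have /andP [f1 f2] := hf; apply: (compat_uniq g1 g2 f1 f2).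
rewrite (exchange_big_dep interlaces) /=; last by move=> T f _ /andP [].
apply: eq_bigr => f fi; rewrite big_distrr /=.
rewrite -(eq_bigr _ (fun T _ => prod_ext fi x T)).
transitivity (\sum_(T in [set ssyt_ext fi T | T in [set T | ssyt T]]) \prod_y x (T y)).
  apply: eq_bigl => T.
  apply/idP/imsetP => [/and3P [h _ /(ssyt_ext_surj fi h) [T' h' ->]]|[T' + ->]].
    by exists T'; rewrite ?inE.
  by rewrite inE => /(ssyt_extP fi) ->; rewrite fi compat_ext.
rewrite big_imset /=; last by move=> ? ? _ _; apply: ssyt_ext_inj.
by apply: eq_bigl => T; rewrite inE.
Qed.
End Branching.

(** * The bialternant formula *)

Definition alternant (R : comNzRingType) m (l : nat -> nat) (x : 'I_m -> R) : R :=
  \det (\matrix_(i, j) x i ^+ l j).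

(** The vector la + delta with delta = (m-1, ..., 0); [shifted m [::]] is delta. *)
Definition shifted m (la : seq nat) (j : nat) : nat := (nth 0 la j + (m.-1 - j))%N.

Lemma geom_telescope (R : comNzRingType) (x y : R) (a b e : nat) : (a <= b)%N ->
  (x - y) * \sum_(a <= v < b.+1) x ^+ (v + e) * y ^+ (b - v) =
  x ^+ (b.+1 + e) - y ^+ (b.+1 - a) * x ^+ (a + e).
Proof.
move=> ab; rewrite big_distrr /=.
(* The right side is the difference of the end values of x^(v+e) y^(b+1-v), once a factor y^0 is
   supplied at v = b+1. *)
rewrite [X in _ = _ - X]mulrC -[in X in _ = X - _](mulr1 (x ^+ _)) -[1](expr0 y) -(subnn b.+1).
rewrite -(telescope_sumr (fun v => x ^+ (v + e) * y ^+ (b.+1 - v))); last exact: leqW.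
apply: eq_big_nat => v /andP [_ vb].
by rewrite addSn subSS subSn -1?ltnS // !exprS; ring.
Qed.

Section AltBranch.
Variables (R : comNzRingType) (la : seq nat) (m N : nat) (x : 'I_m.+1 -> R).
Hypotheses (hs : size la = m.+1) (so : sorted geq la) (hN : (nth 0 la 0 < N)%N).
Let y := x ord_max.
Let x' (i : 'I_m) := x (widen_ord (leqnSn m) i).

(** Column [j] is a sum over one interlacing interval, so expanding the determinant multilinearly
    gives a sum over all interlacing shapes. *)
Let C : 'M[R]_m := \matrix_(i, j)
  \sum_(v < N | (nth 0 la j.+1 <= v <= nth 0 la j)%N)
     x' i ^+ (v + (m.-1 - j)) * y ^+ (nth 0 la j - v).

Lemma ord_interval_sum (a b : nat) (F : nat -> R) : (b < N)%N ->
  \sum_(v < N | (a <= v <= b)%N) F v = \sum_(a <= v < b.+1) F v.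
Proof.
move=> bN; rewrite big_geq_mkord (big_ord_widen_cond N (fun v => true && (a <= v))%N F) // => i.
Qed.

Lemma alternant_reduce :
  alternant (shifted m.+1 la) x = \prod_(i < m) (x' i - y) * (y ^+ nth 0 la m * \det C).
Proof.
pose A : 'M[R]_m.+1 := \matrix_(i, j) x i ^+ shifted m.+1 la j.
(* Multiplication by the unitriangular [U] subtracts [c j] times column j+1 from column j; [c j] is
   chosen to kill the last row, where the variable is [y], except in the last column. *)
pose c (j : 'I_m.+1) := y ^+ (shifted m.+1 la j - shifted m.+1 la j.+1).
pose U : 'M[R]_m.+1 := \matrix_(k, j) ((k == j)%:R - (k == j.+1 :> nat)%:R * c j).
have dU : \det U = 1.
  rewrite det_trig; last first.
    apply/is_trig_mxP => k j kj; rewrite mxE.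
    by rewrite -val_eqE /= !ltn_eqF ?mul0r ?subr0 // ltnW.
  by apply: big1 => k _; rewrite mxE eqxx ltn_eqF // mul0r subr0.
have AU i j : (A *m U) i j =
    if (j < m)%N then x i ^+ shifted m.+1 la j - c j * x i ^+ shifted m.+1 la j.+1
    else x i ^+ shifted m.+1 la j.
  rewrite mxE; under eq_bigr => k _ do rewrite !mxE mulrBr.
  rewrite sumrB (bigD1 j) //= eqxx mulr1 big1 ?addr0; last first.
    by move=> k /negbTE ->; rewrite mulr0.
  case: ltnP => jm; last first.
    rewrite big1 ?subr0 // => k _; rewrite ltn_eqF ?mul0r ?mulr0 //.
    exact: leq_trans (ltn_ord k) (jm : (m < j.+1)%N).
  have hj : (j.+1 < m.+1)%N by [].
  rewrite (bigD1 (Ordinal hj)) //= eqxx mul1r big1 ?addr0 => [|k /negbTE].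
    by rewrite mulrC.
  by rewrite -val_eqE /= => ->; rewrite mul0r mulr0.
have shle (j : nat) : (j < m)%N -> (shifted m.+1 la j.+1 < shifted m.+1 la j)%N.
  move=> jm; rewrite /shifted /=; have := nth_sorted_geq so (leqnSn j); lia.
rewrite /alternant -/A -[\det A]mulr1 -[X in _ * X]dU -det_mulmx.
rewrite (expand_det_row _ ord_max) (bigD1 ord_max) //= big1 ?addr0; last first.
  move=> j jm; have {}jm : (j < m)%N.
    by have := ltn_ord j; rewrite ltnS leq_eqVlt => /orP [/eqP e|//]; case/eqP: jm; apply: val_inj.
  rewrite AU jm /c -/y -exprD subnK ?subrr ?mul0r // ltnW //; exact: shle.
rewrite AU ltnn /shifted subnn addn0 -/y [RHS]mulrCA; congr (_ * _).
rewrite /cofactor -signr_odd addnn odd_double expr0 mul1r.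
pose D : 'rV[R]_m := \row_i (x' i - y).
have -> : row' ord_max (col' ord_max (A *m U)) = diag_mx D *m C.
  apply/matrixP => /= i j; rewrite mul_diag_mx [RHS]mxE [D _ _]mxE [C _ _]mxE.
  rewrite [LHS]mxE [LHS]mxE AU lift_max ltn_ord.
  have -> : x (lift ord_max i) = x' i.
    by rewrite /x'; congr x; apply: val_inj; apply: lift_max.
  rewrite (ord_interval_sum _ (fun v : nat => x' i ^+ (v + (m.-1 - j)) * y ^+ (nth 0%N la j - v))).
    rewrite geom_telescope; last exact: nth_sorted_geq.
    rewrite /c /shifted lift_max /=; have h2 : (j < m)%N := ltn_ord j.
    have := nth_sorted_geq so (leqnSn j); move: (nth 0%N la j) (nth 0%N la j.+1) => a b h1.
    congr (_ ^+ _ - _ ^+ _ * _ ^+ _); lia.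
  by apply: leq_ltn_trans hN; apply: nth_sorted_geq.
by rewrite det_mulmx det_diag; congr (_ * _); apply: eq_bigr => i _; rewrite mxE.
Qed.

(** Up to the factors x_i - y this is the recursion of [schur_branch], which is what lets the two be
    compared by induction. *)
Lemma alternant_branch :
  alternant (shifted m.+1 la) x = \prod_(i < m) (x' i - y) *
    \sum_(f : {ffun 'I_m -> 'I_N} | interlaces la f)
      y ^+ (sumn la - sumn (ffun_seq f)) * alternant (shifted m (ffun_seq f)) x'.
Proof.
rewrite alternant_reduce; congr (_ * _).
rewrite -det_tr /determinant.
transitivity (y ^+ nth 0 la m * \sum_(s : 'S_m) \sum_(f : {ffun 'I_m -> 'I_N} | interlaces la f)
   (-1) ^+ s * \prod_(j < m) (x' (s j) ^+ (f j + (m.-1 - j)) * y ^+ (nth 0 la j - f j))).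
  congr (_ * _); apply: eq_bigr => s _; rewrite -big_distrr; congr (_ * _).
  under eq_bigr => i _ do rewrite !mxE.
  rewrite (bigA_distr_big_dep (fun (i : 'I_m) (v : 'I_N) => (nth 0 la i.+1 <= v <= nth 0 la i)%N)
    (fun (i : 'I_m) (v : 'I_N) => x' (s i) ^+ (v + (m.-1 - i)) * y ^+ (nth 0%N la i - v))).
  by apply: eq_bigl => f; apply/familyP/forallP => h i; apply: h.
rewrite exchange_big big_distrr; apply: eq_bigr => f /forallP fi /=.
rewrite /alternant -det_tr /determinant !big_distrr; apply: eq_bigr => s _ /=.
rewrite big_split /= mulrCA [RHS]mulrCA; congr (_ * _).
rewrite mulrCA mulrC; congr (_ * _); last first.
  by apply: eq_bigr => j _; rewrite !mxE /shifted nth_ffun_seq.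
rewrite -expr_sum -exprD; congr (_ ^+ _).
have -> : sumn (ffun_seq f) = (\sum_(i < m) f i)%N.
  by rewrite sumnE big_map big_enum.
have -> : sumn la = (\sum_(i < m.+1) nth 0 la i)%N.
  by rewrite sumnE (big_nth 0%N) big_mkord hs.
rewrite big_ord_recr /= addnC -addnBAC; last first.
  by apply: leq_sum => i _; have /andP [] := fi i.
by congr (_ + _)%N; rewrite sumnB // => i _; have /andP [] := fi i.
Qed.
End AltBranch.

Lemma shifted_nseq0 m k : shifted m (nseq k 0%N) =1 shifted m [::].
Proof. by move=> j; rewrite /shifted nth_nseq nth_nil if_same. Qed.

Lemma eq_alternant (R : comNzRingType) m (l l' : nat -> nat) (x x' : 'I_m -> R) :
  l =1 l' -> x =1 x' -> alternant l x = alternant l' x'.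
Proof. by move=> e e'; congr (\det _); apply/matrixP => i j; rewrite !mxE e e'. Qed.

Lemma alternant_delta_rec (R : comNzRingType) m (x : 'I_m.+1 -> R) :
  alternant (shifted m.+1 [::]) x =
  \prod_(i < m) (x (widen_ord (leqnSn m) i) - x ord_max) *
    alternant (shifted m [::]) (fun i => x (widen_ord (leqnSn m) i)).
Proof.
have so0 k : sorted geq (nseq k 0%N).
  by apply/(sortedP 0%N) => i _; rewrite !nth_nseq !if_same.
rewrite -(eq_alternant (shifted_nseq0 m.+1 m.+1) (frefl x)).
(* With the bound [N] equal to 1 the zero function is the only shape. *)
rewrite (@alternant_branch _ (nseq m.+1 0%N) m 1 x) ?size_nseq //.
rewrite (big_pred1 [ffun=> ord0]); last first.
  move=> f; apply/forallP/eqP => [_|-> i].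
    by apply/ffunP => i; rewrite ffunE; apply: val_inj; case: (f i) => -[].
  by rewrite ffunE !nth_nseq !if_same.
have -> : ffun_seq ([ffun=> ord0] : {ffun 'I_m -> 'I_1}) = nseq m 0%N.
  apply: (@eq_from_nth _ 0%N); first by rewrite size_ffun_seq size_nseq.
  move=> i; rewrite size_ffun_seq => h; rewrite (nth_ffun_seq _ (Ordinal h)) ffunE.
  by rewrite nth_nseq h.
rewrite !sumn_nseq !mul0n subn0 expr0 mul1r; congr (_ * _).
exact: eq_alternant (shifted_nseq0 m m) (frefl _).
Qed.

Lemma alternant_delta (R : comNzRingType) m (x : 'I_m -> R) :
  alternant (shifted m [::]) x = \prod_(p : 'I_m * 'I_m | (p.1 < p.2)%N) (x p.1 - x p.2).
Proof.
rewrite -(pair_big_dep predT (fun i j : 'I_m => (i < j)%N) (fun i j => x i - x j)) /=.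
rewrite (exchange_big_dep predT) //=.
elim: m x => [|m IH] x; first by rewrite /alternant det_mx00 big_ord0.
rewrite alternant_delta_rec IH mulrC big_ord_recr /=; congr (_ * _).
  apply: eq_bigr => j _; rewrite big_mkcond [RHS]big_mkcond big_ord_recr /=.
  by rewrite ltnNge ltnW //= mulr1.
rewrite [RHS]big_mkcond big_ord_recr /= ltnn mulr1.
by apply: eq_bigr => i _; rewrite ltn_ord.
Qed.

(** Division-free, since it is applied to polynomials as well as to [qser]. *)
Lemma schur_alternant (R : comNzRingType) m (la : seq nat) (x : 'I_m -> R) :
  size la = m -> sorted geq la ->
  alternant (shifted m la) x = alternant (shifted m [::]) x * schur la x.
Proof.
elim: m x la => [|m IH] x la hs so.
  rewrite /alternant !det_mx00 mul1r; case: la hs so => // _ _.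
  rewrite /schur (big_pred1 [ffun y : cell [::] => match y with existT i _ => i end]).
    by rewrite big1 // => -[[]].
  move=> T; apply/idP/eqP => _; first by apply/ffunP => -[[]].
  by apply/ssytP; split=> -[[]].
rewrite alternant_delta_rec -mulrA.
rewrite (alternant_branch x hs so (ltnSn _)) (schur_branch hs so (ltnSn _)).
congr (_ * _).
rewrite big_distrr /=; apply: eq_bigr => f fi; rewrite mulrCA; congr (_ * _).
by apply: IH; [exact: size_ffun_seq | apply: sorted_nu fi].
Qed.

(** * Dominance of weights *)

Lemma card_ord_lt_le m n : (n <= m)%N -> #|[pred i : 'I_m | (i < n)%N]| = n.
Proof.
by move=> h; rewrite -sum1_card -(big_ord_widen m (fun=> 1%N) h) sum1_card card_ord.
Qed.

Lemma card_ord_lt c (i : 'I_c) : #|[pred j : 'I_c | (j < i)%N]| = i.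
Proof. exact: card_ord_lt_le (ltnW (ltn_ord i)). Qed.

Lemma card_ord_gt c (i : 'I_c) : #|[pred j : 'I_c | (i < j)%N]| = (c.-1 - i)%N.
Proof.
have := cardC [pred j : 'I_c | (j < i)%N]; rewrite card_ord_lt card_ord.
rewrite (cardD1 i) !inE ltnn /=.
rewrite (eq_card (B := [pred j : 'I_c | (i < j)%N])) => [|j].
  have e X Y (z : nat) : (z + (1 + X))%N = Y -> X = (Y.-1 - z)%N by lia.
  exact: e.
by rewrite !inE -leqNgt eq_sym ltn_neqAle.
Qed.

Section Weights.
Variable c : nat.
Notation wt := {ffun 'I_c -> int}.
Implicit Types (la nu : wt) (y : 'I_c -> int).

Definition wpair nu y : int := \sum_i nu i * y i.

Definition wroot (i j : 'I_c) : wt := [ffun k => (k == i)%:Z - (k == j)%:Z].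

Definition strictly_decr y := forall i j : 'I_c, (i < j)%N -> y j < y i.

(* [la - nu] lies in the cone of positive roots, expressed through its pairings with the
   dominant and the strictly dominant functionals. *)
Definition dominated la nu :=
  (forall y, (forall i j : 'I_c, (i < j)%N -> y j <= y i) -> 0 <= wpair (la - nu) y) /\
  (nu = la \/ forall y, strictly_decr y -> 0 < wpair (la - nu) y).

Definition wswap (i j : 'I_c) nu : wt := [ffun k => nu (tperm i j k)].

(** The integral staircase (c-1, ..., 0); it differs from the half sum of the positive roots by a
    multiple of (1, ..., 1). *)
Definition wrho (i : 'I_c) : int := (c.-1 - i)%N%:Z.

Definition wnorm nu : int := \sum_i (nu i + wrho i) ^+ 2.

Lemma wpairD nu nu' y : wpair (nu + nu') y = wpair nu y + wpair nu' y.
Proof. by rewrite /wpair -big_split; apply: eq_bigr => i _; rewrite ffunE mulrDl. Qed.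

Lemma wpairN nu y : wpair (- nu) y = - wpair nu y.
Proof. by rewrite /wpair -sumrN; apply: eq_bigr => i _; rewrite ffunE mulNr. Qed.

Lemma wpairB nu nu' y : wpair (nu - nu') y = wpair nu y - wpair nu' y.
Proof. by rewrite wpairD wpairN. Qed.

Lemma wpair_delta (i : 'I_c) y : \sum_k (k == i)%:Z * y k = y i.
Proof.
rewrite (bigD1 i) //= eqxx mul1r big1 ?addr0 // => k /negbTE ->.
by rewrite mul0r.
Qed.

Lemma wpair_wroot i j y : wpair (wroot i j) y = y i - y j.
Proof.
rewrite -(wpair_delta i) -(wpair_delta j) -sumrB.
by apply: eq_bigr => k _; rewrite ffunE mulrBl.
Qed.

Lemma dominated_refl la : dominated la la.
Proof.
by split; [move=> y _; rewrite subrr /wpair big1 // => i _; rewrite ffunE mul0r|left].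
Qed.

Lemma wrho_decr : strictly_decr wrho.
Proof. by move=> a b ab; rewrite /wrho; have := ltn_ord b; lia. Qed.

(** Lowering adds a positive root to [la - nu]. Its pairing with [wrho] becomes positive, so no
    lowered vector has weight [la] again; the multiplicity one of [la] rests on this. *)
Lemma dominated_lower la nu (i j : 'I_c) : (j < i)%N -> dominated la nu ->
  dominated la (nu + wroot i j) /\ nu + wroot i j <> la.
Proof.
move=> ji [h1 h2].
have e y : wpair (la - (nu + wroot i j)) y = wpair (la - nu) y + (y j - y i).
  by rewrite opprD addrA (wpairB (la - nu)) wpair_wroot opprB.
have s y : strictly_decr y -> 0 < wpair (la - (nu + wroot i j)) y.
  move=> sy; rewrite e; apply: ltr_wpDl; last by rewrite subr_gt0 sy.
  by apply: h1 => a b ab; apply/ltW/sy.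
split; first split.
- by move=> y hy; rewrite e addr_ge0 ?h1 // subr_ge0 hy.
- by right.
move=> e'; have := s _ wrho_decr.
by rewrite e' subrr /wpair big1 // => k _; rewrite ffunE mul0r.
Qed.

Lemma wnormE nu : wnorm nu = \sum_i nu i ^+ 2 + 2 * wpair nu wrho + \sum_i wrho i ^+ 2.
Proof.
rewrite /wnorm /wpair big_distrr -!big_split /=.
by apply: eq_bigr => i _; ring.
Qed.

Lemma wswap_height (i j : 'I_c) nu : i != j ->
  wpair (wswap i j nu) wrho - wpair nu wrho = (nu j - nu i) * (wrho i - wrho j).
Proof.
move=> ij; have -> : wpair (wswap i j nu) wrho - wpair nu wrho =
    wpair (wswap i j nu - nu) wrho by rewrite wpairB.
have -> : (wswap i j nu - nu) = [ffun k => (nu j - nu i) * wroot i j k].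
  apply/ffunP => k; rewrite !ffunE.
  case: tpermP => [->|->|/eqP/negbTE -> /eqP/negbTE ->]; rewrite ?subrr ?mulr0 //.
    by rewrite eqxx (negbTE ij) subr0 mulr1.
  by rewrite eqxx eq_sym (negbTE ij) sub0r mulrN mulr1 opprB.
rewrite -(wpair_wroot i j) /wpair big_distrr /=.
by apply: eq_bigr => k _; rewrite ffunE mulrA.
Qed.

Lemma wnorm_swap (i j : 'I_c) nu : i != j ->
  wnorm (wswap i j nu) = wnorm nu + 2 * ((nu j - nu i) * (wrho i - wrho j)).
Proof.
move=> ij; rewrite -(wswap_height nu ij) !wnormE.
suff -> : \sum_k wswap i j nu k ^+ 2 = \sum_k nu k ^+ 2 by ring.
rewrite [RHS](reindex_inj (@perm_inj _ (tperm i j))) /=.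
by apply: eq_bigr => k _; rewrite ffunE.
Qed.

(* Sorting a weight increases the norm of its shift by the Weyl vector, and among
   the dominant weights below [la] the norm is maximal only at [la]. *)
Lemma wnorm_max la (S : wt -> Prop) :
  (forall i j : 'I_c, (i < j)%N -> la j <= la i) ->
  (forall nu, S nu -> dominated la nu) ->
  (forall nu (i j : 'I_c), S nu -> (i < j)%N -> nu i < nu j -> S (wswap i j nu)) ->
  forall nu, S nu -> nu <> la -> wnorm nu < wnorm la.
Proof.
move=> dla Sd Ss.
have hb nu : S nu -> wpair nu wrho <= wpair la wrho.
  move=> /Sd [h _]; rewrite -subr_ge0 -wpairB; apply: h => a b ab.
  exact/ltW/wrho_decr.
(* Induction on the height of [la - nu]: undoing an inversion of [nu] raises its height, which is
   bounded by that of [la]. *)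
suff H n nu : S nu -> wpair la wrho - wpair nu wrho < n%:Z -> nu <> la ->
    wnorm nu < wnorm la.
  move=> nu Snu; apply: (H (`|wpair la wrho - wpair nu wrho|.+1)%N) => //.
  have := hb _ Snu; lia.
elim: n nu => [|n IH] nu Snu; first by have := hb _ Snu; lia.
move=> hn nla.
have [/existsP [i /existsP [j /andP [ij hij]]]|] :=
    boolP [exists i : 'I_c, exists j : 'I_c, (i < j)%N && (nu i < nu j)].
  have nij : i != j by rewrite neq_ltn ij.
  have pos : 0 < (nu j - nu i) * (wrho i - wrho j).
    by rewrite mulr_gt0 // subr_gt0 // wrho_decr.
  have hs := wswap_height nu nij; have hg := wnorm_swap nu nij.
  suff : wnorm (wswap i j nu) <= wnorm la by lia.
  have [->//|/eqP ne] := eqVneq (wswap i j nu) la.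
  by apply/ltW/IH => //; [apply: Ss | lia].
move=> hno; have dnu (i j : 'I_c) : (i < j)%N -> nu j <= nu i.
  move=> ij; rewrite leNgt; apply: contra hno => h.
  by apply/existsP; exists i; apply/existsP; exists j; rewrite ij.
have [_ [//|h]] := Sd _ Snu.
(* No inversion is left, so [nu] is dominant, and the difference of the norms is the pairing of
   [la - nu] with the strictly decreasing la + nu + 2 rho. *)
rewrite -subr_gt0.
have -> : wnorm la - wnorm nu = wpair (la - nu) (fun i => la i + nu i + 2 * wrho i).
  rewrite /wnorm -sumrB; apply: eq_bigr => i _; rewrite !ffunE; ring.
apply: h => i j ij; have := dla _ _ ij; have := dnu _ _ ij; have := wrho_decr ij; lia.
Qed.

End Weights.

(** * Bases of weight vectors *)

(** The list is sifted from its end, so the last vector [x] always survives; it will be the highest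
    weight vector. The first components carry the weights along. *)
Lemma span_basis (K : fieldType) (V : vectType K) (A : eqType) (s : seq (A * V)) (x : A * V) :
  x.2 != 0 -> exists B : seq (A * V), [/\ {subset B <= s},
    free [seq y.2 | y <- rcons B x] &
    <<[seq y.2 | y <- rcons B x]>>%VS = <<[seq y.2 | y <- rcons s x]>>%VS].
Proof.
move=> x0; elim: s => [|y s [B [Bs fB sB]]]; first by exists [::]; split; rewrite //= seq1_free.
have [h|h] := boolP (y.2 \in <<[seq y.2 | y <- rcons B x]>>%VS).
  exists B; split=> //; first by move=> z /Bs; rewrite inE orbC => ->.
  rewrite /= span_cons -sB; apply/esym/addv_idPr; exact: h.
exists (y :: B); split.
- by move=> z; rewrite !inE => /orP [->|/Bs ->] //; rewrite orbT.
- by rewrite /= free_cons h.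
- by rewrite /= !span_cons sB.
Qed.

Section GlModule.
Variables (K : numFieldType) (c : nat) (V : vectType K) (E : 'I_c -> 'I_c -> 'End(V)).
Notation wt := {ffun 'I_c -> int}.
Hypothesis comm : forall i j k l u,
  E i j (E k l u) - E k l (E i j u) = (j == k)%:R *: E i l u - (i == l)%:R *: E k j u.
Hypothesis irr : forall U : {vspace V}, (forall i j u, u \in U -> E i j u \in U) ->
  U = 0%VS \/ U = fullv.

Definition weight_vec (nu : wt) (u : V) := forall i, E i i u = (nu i)%:~R *: u.

Lemma weight_vec_shift nu u i j : weight_vec nu u -> weight_vec (nu + wroot i j) (E i j u).
Proof.
move=> h k; have := comm k k i j u; rewrite h linearZ /= => /eqP.
rewrite subr_eq => /eqP ->; rewrite !ffunE !rmorphD rmorphN /= !scalerDl scaleNr.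
rewrite addrC; congr (_ + (_ - _)); rewrite -?natz ?pmulrn.
  by case: eqP => [->|] //; rewrite !scale0r.
by case: eqP => [->|] //; rewrite !scale0r.
Qed.

Variables (la : wt) (v : V).
Hypothesis v0 : v != 0.
Hypothesis v_wt : weight_vec la v.
Hypothesis v_raise : forall i j : 'I_c, (i < j)%N -> E i j v = 0.

Definition low := [seq p : 'I_c * 'I_c <- enum {: 'I_c * 'I_c} | (p.2 < p.1)%N].

(** Images of [v] under at most [n] lowering operators. The weight is stored next to each vector
    because a word that vanishes does not determine it. *)
Fixpoint words n : seq (wt * V) :=
  if n is k.+1 then
    [seq (x.1 + wroot p.1 p.2, E p.1 p.2 x.2) | p <- low, x <- words k] ++ words k
  else [:: (la, v)].

Definition wspan n := <<[seq x.2 | x <- words n]>>%VS.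

Lemma mem_words_low n x (i j : 'I_c) : x \in words n -> (j < i)%N ->
  (x.1 + wroot i j, E i j x.2) \in words n.+1.
Proof.
move=> xw ji; rewrite /= mem_cat; apply/orP; left.
by apply/allpairsP; exists ((i, j), x); rewrite mem_filter mem_enum /= ji.
Qed.

Lemma wspan_mono n : (wspan n <= wspan n.+1)%VS.
Proof.
apply/span_subvP => u /mapP [x xw ->]; apply: memv_span; apply: map_f.
by rewrite /= mem_cat xw orbT.
Qed.

Lemma wspan_lower n (i j : 'I_c) u : (j < i)%N -> u \in wspan n -> E i j u \in wspan n.+1.
Proof.
move=> ji uw; have : E i j u \in (E i j @: wspan n)%VS by apply: memv_img.
apply: subvP; rewrite limg_span; apply/span_subvP => _ /mapP [_ /mapP [x xw ->] ->].
by apply: memv_span; apply: (map_f snd (mem_words_low xw ji)).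
Qed.

(** Moving the operator past the outermost lowering one leaves matrix units applied to a word of
    level [n]; these stay in level [n] or, when lowering, reach level n+1. *)
Lemma wspan_raise n (i j : 'I_c) u : (i <= j)%N -> u \in wspan n -> E i j u \in wspan n.
Proof.
elim: n i j u => [|n IH] i j u ij uw.
  move: uw; rewrite /wspan /= span_seq1 => /vlineP [a ->]; rewrite linearZ /= rpredZ //.
  move: ij; rewrite leq_eqVlt => /orP [/eqP/ord_inj ->|/v_raise ->]; rewrite ?mem0v //.
  by rewrite v_wt rpredZ // memv_line.
have : E i j u \in (E i j @: wspan n.+1)%VS by apply: memv_img.
apply: subvP; rewrite limg_span; apply/span_subvP => _ /mapP [_ /mapP [x xw ->] ->].
have mono := subvP (wspan_mono n).
move: xw; rewrite /= mem_cat => /orP [/allpairsP [[[a b] y] /= [ab yw ->]]|xw]; last first.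
  by apply/mono/IH => //; apply: memv_span; apply: map_f.
move: ab; rewrite mem_filter /= => /andP [ba _].
have yW : y.2 \in wspan n by apply: memv_span; apply: map_f.
have H a' b' : E a' b' y.2 \in wspan n.+1.
  have [h|h] := leqP a' b'; first exact/mono/IH.
  exact: wspan_lower.
have /eqP := comm i j a b y.2; rewrite subr_eq => /eqP ->.
rewrite rpredD ?rpredB ?rpredZ ?H //.
by apply: wspan_lower => //; apply: IH.
Qed.

(** The increasing chain stabilizes by dimension, and the stable term is a nonzero submodule. *)
Lemma wspan_full : exists n, wspan n = fullv.
Proof.
have [n hn] : exists n, (wspan n.+1 <= wspan n)%VS.
  have [/existsP [n hn]|] := boolP [exists n : 'I_(\dim {:V}).+1, (wspan n.+1 <= wspan n)%VS].
    by exists n.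
  rewrite negb_exists => /forallP h.
  suff H n : (n <= (\dim {:V}).+1)%N -> (n <= \dim (wspan n))%N.
    by have := leq_trans (H _ (leqnn _)) (dimvS (subvf _)); rewrite ltnn.
  elim: n => // n IH hn; apply: leq_ltn_trans (IH (ltnW hn)) _.
  rewrite ltn_neqAle dimvS ?wspan_mono // andbT; apply: contra (h (Ordinal hn)) => /= e.
  have := wspan_mono n; rewrite -(geq_leqif (dimv_leqif_sup (wspan_mono n))).
  by move=> _; rewrite (eqP e).
exists n; have vW k : v \in wspan k.
  elim: k => [|k IH]; first by rewrite /wspan /= memv_span // mem_head.
  by apply: (subvP (wspan_mono k)).
have [i j u uw|h|//] := irr (U := wspan n).
  have [ij|ji] := leqP i j; first exact: wspan_raise.
  by apply: (subvP hn); apply: wspan_lower.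
by have := vW n; rewrite h memv0 (negbTE v0).
Qed.

Lemma words_prop n x : x \in words n ->
  [/\ weight_vec x.1 x.2, dominated la x.1 & x = (la, v) \/ x.1 <> la].
Proof.
elim: n x => [|n IH] x.
  by rewrite /= inE => /eqP ->; split=> //; [apply: dominated_refl | left].
rewrite /= mem_cat => /orP [/allpairsP [[[a b] y] /= [ab /IH [h1 h2 _] ->]]|/IH //].
move: ab; rewrite mem_filter /= => /andP [ba _].
have [d1 d2] := dominated_lower ba h2.
by split=> //; [apply: weight_vec_shift | right].
Qed.

Lemma words_rcons n : exists s, words n = rcons s (la, v) /\ {subset s <= words n}.
Proof.
elim: n => [|n [s [e h]]]; first by exists [::].
rewrite /=; set r := [seq _ | _ <- _, _ <- _]; exists (r ++ s); rewrite e rcons_cat; split=> //.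
move=> x; rewrite -rcons_cat mem_rcons inE => ->; by rewrite orbT.
Qed.

Lemma weight_basis : exists d (b : d.-tuple V) (w : 'I_d -> wt),
  [/\ basis_of fullv b, forall k, weight_vec (w k) b`_k,
      forall k, dominated la (w k) & #|[set k | w k == la]| = 1%N].
Proof.
have [n hn] := wspan_full; have [s [es ss]] := words_rcons n.
have [B [Bs fB sB]] := span_basis s (x := (la, v)) v0.
set C := rcons B (la, v) in fB sB.
have CW x : x \in C -> x \in words n.
  rewrite mem_rcons inE => /orP [/eqP ->|/Bs /ss //].
  by rewrite es mem_rcons mem_head.
have sz : size [seq y.2 | y <- C] == size C by rewrite size_map.
exists (size C), (Tuple sz), (fun k => (nth (la, v) C k).1).
have nthC (k : 'I_(size C)) : nth (la, v) C k \in words n by apply/CW/mem_nth.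
have nthE (k : 'I_(size C)) : (Tuple sz)`_k = (nth (la, v) C k).2.
  by rewrite /= (nth_map (la, v)).
split.
- by apply/andP; split; rewrite /= ?fB // sB -es -/(wspan n) hn.
- by move=> k; rewrite nthE; have [] := words_prop (nthC k).
- by move=> k; have [] := words_prop (nthC k).
have hl : (size B < size C)%N by rewrite size_rcons.
rewrite (_ : [set k | _] = [set Ordinal hl]) ?cards1 //; apply/setP => k; rewrite !inE.
apply/eqP/eqP => [e|->]; last by rewrite /= nth_rcons ltnn eqxx.
(* A word of weight [la] is the pair [(la, v)], and a free family contains [v] only once. *)
have [_ _ [e'|//]] := words_prop (nthC k).
apply/ord_inj/eqP; rewrite -(nth_uniq 0 _ _ (free_uniq fB)) ?size_map //=.
by rewrite !(nth_map (la, v)) // e' nth_rcons ltnn eqxx.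
Qed.

End GlModule.

(** * Weight multiplicities are Kostka numbers *)

Module WeightMultiplicity.
Import mpoly.

(** * Euler operators and the Laplacian on multiples of the Vandermonde product *)

Section Euler.
Variables (F : numFieldType) (c : nat).
Local Notation P := {mpoly F[c]}.
Implicit Types (p f g : P) (m : 'X_{1..c}).

Definition euler (i : 'I_c) p : P := 'X_i * p^`M(i).

Lemma euler_linear i : linear (euler i).
Proof. by move=> a p p'; rewrite /euler linearP mulrDr -scalerAr. Qed.
HB.instance Definition _ i :=
  GRing.isLinear.Build F P P _ (euler i) (euler_linear i).

Lemma eulerM i p p' : euler i (p * p') = euler i p * p' + p * euler i p'.
Proof. rewrite /euler mderivM; ring. Qed.

Lemma eulerX i m : euler i 'X_[m] = (m i)%:R *: 'X_[m].
Proof.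
rewrite /euler mderivX -scalerAr -mpolyXD.
have [->|h] := eqVneq (m i) 0%N; first by rewrite !scale0r.
congr (_ *: 'X_[_]); rewrite addmC submK //; apply/mnm_lepP => k.
by rewrite mnm1E; case: eqP => // <-; rewrite lt0n.
Qed.

Lemma mcoeff_euler i p m : (euler i p)@_m = (m i)%:R * p@_m.
Proof.
rewrite {1}[p]mpolyE linear_sum /= raddf_sum /= [X in _ = _ * X@_m]mpolyE raddf_sum /=.
rewrite big_distrr /=; apply: eq_bigr => k _; rewrite linearZ /= eulerX !mcoeffZ mcoeffX.
by have [->|_] := eqVneq k m; rewrite ?mulr0 ?mulr1 1?mulrC.
Qed.

Definition lap p : P := \sum_i euler i (euler i p).

Lemma mcoeff_lap p m : (lap p)@_m = (\sum_i (m i)%:R ^+ 2) * p@_m.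
Proof.
rewrite /lap raddf_sum big_distrl /=; apply: eq_bigr => i _.
by rewrite !mcoeff_euler mulrA expr2.
Qed.

Lemma lapM p p' :
  lap (p * p') = lap p * p' + p * lap p' + 2 * \sum_i euler i p * euler i p'.
Proof.
rewrite /lap big_distrl !big_distrr /= -!big_split /=; apply: eq_bigr => i _.
by rewrite eulerM raddfD /= !eulerM; ring.
Qed.

Lemma euler_prod (I : eqType) (r : seq I) (G : I -> P) i : uniq r ->
  euler i (\prod_(k <- r) G k) =
    \sum_(k <- r) euler i (G k) * \prod_(l <- r | l != k) G l.
Proof.
elim: r => [_|k r IH /= /andP [kr ur]].
  by rewrite !big_nil -mpolyX0 eulerX mnm0E scale0r.
rewrite !big_cons eulerM IH // eqxx /= big_distrr /=; congr (_ * _ + _).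
  by rewrite big_seq_cond [RHS]big_seq_cond; apply: eq_bigl => l; 
     case lr : (l \in r) => //=; apply/esym/eqP => e; rewrite -e lr in kr.
rewrite big_seq [RHS]big_seq; apply: eq_bigr => l lr; rewrite big_cons.
have -> : k != l by apply: contraNneq kr => ->.
by rewrite mulrCA.
Qed.

Definition vdm : P := alternant (shifted c [::]) (fun i => 'X_i).

Definition pairs := [seq p : 'I_c * 'I_c <- enum {: 'I_c * 'I_c} | (p.1 < p.2)%N].

Lemma pairs_uniq : uniq pairs.
Proof. exact/filter_uniq/enum_uniq. Qed.

Lemma vdmE : vdm = \prod_(p <- pairs) ('X_(p.1) - 'X_(p.2)).
Proof. by rewrite /vdm alternant_delta big_filter big_enum_cond /=. Qed.

Lemma euler_var (i j : 'I_c) : euler i 'X_j = (i == j)%:R *: 'X_j.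
Proof. by rewrite eulerX mnm1E eq_sym. Qed.

(** To be used with [f] the formal character and [t i j] the weightwise trace of
    [E i j \o E j i]. *)
Variables (f : P) (t : 'I_c -> 'I_c -> P) (N ca : F).
Hypothesis t_shift : forall i j, 'X_j * t i j = 'X_i * t j i.
Hypothesis t_comm : forall i j, t i j - t j i = euler i f - euler j f.
Hypothesis f_hom : \sum_i euler i f = N *: f.
Hypothesis casimir : lap f + \sum_i \sum_(j | i != j) t i j = ca *: f.

Let cof (p : 'I_c * 'I_c) : P := \prod_(l <- pairs | l != p) ('X_(l.1) - 'X_(l.2)).

Lemma vdm_cof (k : 'I_c * 'I_c) : k \in pairs -> vdm = ('X_(k.1) - 'X_(k.2)) * cof k.
Proof.
move=> kp; rewrite vdmE (bigD1_seq k) //=.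
by apply: filter_uniq; apply: enum_uniq.
Qed.

Lemma big_pairs_sym (G : 'I_c -> 'I_c -> P) :
  \sum_(p <- pairs) (G p.1 p.2 + G p.2 p.1) = \sum_i \sum_(j | i != j) G i j.
Proof.
rewrite big_split /= big_filter big_enum_cond big_filter big_enum_cond /=.
rewrite -(pair_big_dep predT (fun i j : 'I_c => (i < j)%N) G) /=.
rewrite -(pair_big_dep predT (fun i j : 'I_c => (i < j)%N) (fun i j => G j i)) /=.
rewrite [X in _ + X](exchange_big_dep predT) //= -big_split /=; apply: eq_bigr => i _.
rewrite [RHS](bigID (fun j : 'I_c => (i < j)%N)) /=; congr (_ + _); apply: eq_bigl => j.
  by rewrite neq_ltn; case: ltngtP.
by rewrite neq_ltn -leqNgt; case: ltngtP.
Qed.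

(** The logarithmic derivative of [vdm] contributes (x_i theta_i f - x_j theta_j f) / (x_i - x_j)
    for each pair. By [t_shift] and [t_comm], twice this is theta_i f + theta_j f + t_ij + t_ji;
    homogeneity sums the first two terms to (c - 1) N f. *)
Lemma grad_vdm :
  2 * \sum_i euler i vdm * euler i f =
    vdm * ((c%:R - 1) * N *: f + \sum_i \sum_(j | i != j) t i j).
Proof.
have -> : \sum_i euler i vdm * euler i f =
    \sum_(p <- pairs) cof p * ('X_(p.1) * euler p.1 f - 'X_(p.2) * euler p.2 f).
  have delta a : \sum_i ((i == a)%:R *: 'X_a) * euler i f = 'X_a * euler a f.
    rewrite (bigD1 a) //= eqxx scale1r big1 ?addr0 // => i /negbTE ->.
    by rewrite scale0r mul0r.
  under eq_bigr => i _ do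
    rewrite vdmE (euler_prod _ _ pairs_uniq) big_distrl /=.
  rewrite exchange_big; apply: eq_bigr => p _ /=; rewrite -/(cof p).
  rewrite -!delta -sumrB big_distrr /=; apply: eq_bigr => i _.
  by rewrite raddfB /= !euler_var; ring.
transitivity (\sum_(p <- pairs) vdm *
   ((euler p.1 f + euler p.2 f) + (t p.1 p.2 + t p.2 p.1))).
  rewrite big_distrr /= big_seq [RHS]big_seq; apply: eq_bigr => -[i j] /= pp.
  rewrite (vdm_cof pp) /=; have := t_shift i j; have := t_comm i j.
  move: (euler i f) (euler j f) (t i j) (t j i) => a b u v h1 h2.
  have -> : a = b + (u - v) by rewrite h1; ring.
  transitivity (cof (i, j) * (('X_i - 'X_j) * (2 * b + u - v) + ('X_i + 'X_j) * (u - v))).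
    by ring.
  have -> : ('X_i + 'X_j) * (u - v) = ('X_i - 'X_j) * (u + v) + 2 * ('X_j * u - 'X_i * v) by ring.
  by rewrite h2; ring.
rewrite -big_distrr /= big_split /=; congr (_ * (_ + _)); last exact: big_pairs_sym.
rewrite (big_pairs_sym (fun i _ => euler i f)) -scalerA -f_hom scaler_sumr.
apply: eq_bigr => i _; rewrite sumr_const.
have -> : #|[pred j | i != j]| = c.-1.
  by rewrite (eq_card (B := predC1 i)) ?cardC1 ?card_ord // => j; rewrite !inE eq_sym.
have c0 : (0 < c)%N by case: (i) => k; apply: leq_ltn_trans.
have -> : c%:R = c.-1%:R + 1 :> F by rewrite natr1 prednK.
by rewrite addrK scaler_nat.
Qed.

Lemma alternantE (l : nat -> nat) :
  alternant l (fun i => 'X_i) =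
    \sum_(s : 'S_c) (-1) ^+ s *: 'X_[[multinom l (s i) | i < c]] :> P.
Proof.
apply: eq_bigr => s _; rewrite mpolyXE_id -signr_odd.
have -> : (-1 : P) ^+ odd s = ((-1 : F) ^+ s)%:MP by rewrite rmorphXn rmorphN1 signr_odd.
rewrite mul_mpolyC; congr (_ *: _); apply: eq_bigr => i _.
by rewrite !mxE mnmE.
Qed.

(** The exponent vectors in an alternant are permutations of one another and share their sum of
    squares. *)
Lemma lap_alternant (l : nat -> nat) :
  lap (alternant l (fun i => 'X_i)) =
    (\sum_(i < c) (l i)%:R ^+ 2) *: (alternant l (fun i => 'X_i) : P).
Proof.
apply/mpolyP => m; rewrite mcoeff_lap mcoeffZ alternantE raddf_sum /= !big_distrr /=.
apply: eq_bigr => s _; rewrite mcoeffZ mcoeffX.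
have [<-|_] := eqVneq; last by rewrite !mulr0.
congr (_ * _); rewrite [RHS](reindex_inj (@perm_inj _ s)) /=.
by apply: eq_bigr => i _; rewrite mnmE.
Qed.

(** The traces in the Casimir relation cancel those in the cross term. *)
Lemma lap_vdmM :
  lap (vdm * f) = (ca + (c%:R - 1) * N + \sum_(i < c) (shifted c [::] i)%:R ^+ 2) *: (vdm * f).
Proof.
rewrite lapM lap_alternant grad_vdm -/vdm.
have -> : lap f = ca *: f - \sum_i \sum_(j | i != j) t i j by rewrite -casimir addrK.
rewrite mulrBr mulrDr -!scalerAl -!scalerAr !scalerDl; ring.
Qed.
End Euler.

(** * Highest monomials, and uniqueness of the eigenvector *)

Section TopTerm.
Variables (F : numFieldType) (c : nat).
Local Notation P := {mpoly F[c]}.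
Implicit Types (f g : P) (m : 'X_{1..c}).

Definition wt_of m : {ffun 'I_c -> int} := [ffun i => (m i)%:Z].
Definition height m := wpair (wt_of m) (@wrho c).
Definition delta_mnm : 'X_{1..c} := [multinom shifted c [::] i | i < c].

Lemma wt_of_inj : injective wt_of.
Proof.
by move=> m k /ffunP e; apply/mnmP => i; have := e i; rewrite !ffunE => -[].
Qed.

Lemma heightD m k : height (m + k)%MM = height m + height k.
Proof.
rewrite /height -wpairD; congr wpair.
by apply/ffunP => i; rewrite !ffunE mnmDE PoszD.
Qed.

Lemma vdm_height m : (vdm F c)@_m != 0 ->
  height m <= height delta_mnm /\ (height m = height delta_mnm -> m = delta_mnm).
Proof.
rewrite /vdm alternantE raddf_sum /= => h.
have [s /eqP ms] : exists s : 'S_c, m == [multinom shifted c [::] (s i) | i < c].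
  apply/existsP; apply: contraNT h; rewrite negb_exists => /forallP h.
  apply/eqP; apply: big1 => s _; rewrite mcoeffZ mcoeffX eq_sym.
  by rewrite (negbTE (h s)) mulr0.
(* The rearrangement inequality in exact form: permuting the entries of [wrho] keeps the sum of
   their squares. *)
have e : 2 * (height delta_mnm - height m) = \sum_i (wrho (s i) - wrho i) ^+ 2.
  have e1 : height delta_mnm = \sum_(i < c) wrho i ^+ 2.
    rewrite /height /wpair; apply: eq_bigr => i _; rewrite ffunE mnmE expr2.
    by rewrite /shifted nth_nil add0n.
  have e2 : height m = \sum_i wrho (s i) * wrho i.
    by rewrite /height /wpair; apply: eq_bigr => i _; rewrite ffunE ms mnmE /shifted nth_nil add0n.
  rewrite -[2]/(1 + 1) mulrDl mul1r {1}e1 (reindex_inj (@perm_inj _ s)) /= e1 e2.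
  rewrite -!sumrB -big_split /=; apply: eq_bigr => i _; ring.
have sq i : 0 <= (wrho (s i) - wrho i) ^+ 2 by apply: sqr_ge0.
have sg : 0 <= \sum_i (wrho (s i) - wrho i) ^+ 2 by apply: sumr_ge0.
split; first by lia.
move=> h0; move: e; rewrite h0 subrr mulr0 => /esym /eqP.
rewrite psumr_eq0 // => /allP h1; rewrite ms; apply/mnmP => i; rewrite !mnmE.
have := h1 i; rewrite mem_index_enum => /(_ isT) /=; rewrite sqrf_eq0 subr_eq0 => /eqP [].
by rewrite /shifted !nth_nil !add0n.
Qed.

Lemma shifted_nil_inj (i j : 'I_c) : shifted c [::] i = shifted c [::] j -> i = j.
Proof.
rewrite /shifted !nth_nil !add0n => e; apply: ord_inj.
by have := ltn_ord i; have := ltn_ord j; lia.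
Qed.

Lemma vdm_delta : (vdm F c)@_delta_mnm = 1.
Proof.
rewrite /vdm alternantE raddf_sum (bigD1 (1%g : 'S_c)) //= big1 ?addr0.
  rewrite odd_perm1 expr0 scale1r mcoeffX.
  suff -> : [multinom shifted c [::] ((1%g : 'S_c) i) | i < c] = delta_mnm by rewrite eqxx.
  by apply/mnmP => i; rewrite !mnmE perm1.
move=> s s1; rewrite mcoeffZ mcoeffX; case: eqP => [/mnmP e|]; last by rewrite mulr0.
case/eqP: s1; apply/permP => i; rewrite perm1; apply: shifted_nil_inj.
by have := e i; rewrite !mnmE.
Qed.

Lemma vdm_neq0 : vdm F c != 0.
Proof.
apply/eqP => h; have := vdm_delta; rewrite h mcoeff0 => /esym/eqP.
by rewrite oner_eq0.
Qed.

Lemma mcoeff_mul f g m : (f * g)@_m =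
  \sum_(k <- msupp f) \sum_(l <- msupp g) f@_k * g@_l * ((k + l)%MM == m)%:R.
Proof.
rewrite {1}[f]mpolyE {1}[g]mpolyE big_distrl raddf_sum; apply: eq_bigr => k _ /=.
rewrite big_distrr raddf_sum; apply: eq_bigr => l _ /=.
by rewrite -scalerAl -scalerAr scalerA -mpolyXD mcoeffZ mcoeffX.
Qed.

(** delta is the only monomial of [vdm] of maximal height, so delta + m can only arise as delta
    times [m]. *)
Lemma top_coeff f m : (forall k, f@_k != 0 -> height k <= height m) ->
  (vdm F c * f)@_(delta_mnm + m)%MM = f@_m.
Proof.
move=> hm; have ds : delta_mnm \in msupp (vdm F c).
  by rewrite mcoeff_msupp vdm_delta oner_neq0.
have key k l : k \in msupp (vdm F c) -> l \in msupp f ->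
    (k + l)%MM = (delta_mnm + m)%MM -> k = delta_mnm.
  rewrite !mcoeff_msupp => /vdm_height [h1 h2] /hm h3 /(congr1 height).
  by rewrite !heightD => h4; apply: h2; lia.
rewrite mcoeff_mul (bigD1_seq _ ds) ?msupp_uniq //=.
rewrite [X in _ + X]big_seq_cond [X in _ + X]big1 ?addr0; last first.
  move=> k /andP [ks kd]; rewrite big_seq big1 // => l ls.
  by case: eqP => [/(key _ _ ks ls)/eqP|]; rewrite ?(negbTE kd) ?mulr0.
have e l : (delta_mnm + l == delta_mnm + m)%MM = (l == m) by rewrite (inj_eq (@addmI _ _)).
under eq_bigr => l _ do rewrite vdm_delta mul1r e.
have [ms|ms] := boolP (m \in msupp f).
  rewrite (bigD1_seq _ ms) ?msupp_uniq //= eqxx mulr1 big1 ?addr0 // => l /negbTE ->.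
  by rewrite mulr0.
rewrite (memN_msupp_eq0 ms) big_seq big1 // => l ls.
by case: eqP => [e'|]; [rewrite -e' ls in ms|rewrite mulr0].
Qed.

(* A highest monomial [m] of [f - g] would make [delta + m] a monomial of
   [vdm * (f - g)], and the Laplacian then forces [m = lam]. *)
Lemma lap_unique f g (lam : 'X_{1..c}) (M := (wnorm (wt_of lam))%:~R : F) :
  lap (vdm F c * f) = M *: (vdm F c * f) ->
  lap (vdm F c * g) = M *: (vdm F c * g) ->
  (forall m, f@_m != 0 -> m <> lam -> wnorm (wt_of m) < wnorm (wt_of lam)) ->
  (forall m, g@_m != 0 -> m <> lam -> wnorm (wt_of m) < wnorm (wt_of lam)) ->
  f@_lam = g@_lam -> f = g.
Proof.
move=> lf lg sf sg fg; apply/eqP; rewrite -subr_eq0; apply/negPn/negP => h0.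
set h := f - g in h0.
have lh : lap (vdm F c * h) = M *: (vdm F c * h).
  rewrite mulrBr scalerBr -lf -lg /lap -sumrB.
  by apply: eq_bigr => i _; rewrite !raddfB.
have [m ms mmax] : exists2 m, m \in msupp h & forall k, h@_k != 0 -> height k <= height m.
  have : exists m, m \in msupp h.
    case: (msupp h) (msupp_eq0 h) => [|m s _]; first by rewrite (negbTE h0).
    by exists m; rewrite mem_head.
  case=> m0 h0'; have n0 : exists k : nat, (fun k => has (fun m => `|height m|%N == k) (msupp h)) k.
    by exists `|height m0|%N; apply/hasP; exists m0.
  have hge k : 0 <= height k.
    by rewrite /height /wpair; apply: sumr_ge0 => i _; rewrite ffunE mulr_ge0.
  have [B hB] : exists B, forall k, has (fun m => `|height m|%N == k) (msupp h) -> (k <= B)%N.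
    exists (\sum_(k <- msupp h) `|height k|)%N => k /hasP [m mh /eqP <-].
    by rewrite (bigD1_seq m) ?msupp_uniq //= leq_addr.
  case: (ex_maxnP n0 hB) => i /hasP [m ms /eqP hm] hi; exists m => // k.
  rewrite -mcoeff_msupp => ks; have /hi : has (fun m => `|height m|%N == `|height k|%N) (msupp h).
    by apply/hasP; exists k.
  by have := hge k; have := hge m; lia.
have hmn : h@_m != 0 by rewrite -mcoeff_msupp.
have hml : m <> lam by move=> e; move: hmn; rewrite e mcoeffB fg subrr eqxx.
have nm : wnorm (wt_of m) < wnorm (wt_of lam).
  have [f0|f0] := eqVneq (f@_m) 0; last exact: sf.
  apply: sg => //; move: hmn; rewrite mcoeffB f0 sub0r oppr_eq0 //.
move/mpolyP: lh => /(_ (delta_mnm + m)%MM).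
rewrite mcoeff_lap mcoeffZ top_coeff // => /(mulIf hmn).
have -> : \sum_i ((delta_mnm + m)%MM i)%:R ^+ 2 = (wnorm (wt_of m))%:~R :> F.
  rewrite rmorph_sum; apply: eq_bigr => i _.
  by rewrite rmorphXn /= ffunE mnmDE mnmE /shifted nth_nil add0n addnC.
by move=> /(intr_inj) e; rewrite e ltxx in nm.
Qed.
End TopTerm.

(** * Weights and symmetry of Schur polynomials *)

Section SchurFacts.
Variables (F : numFieldType) (c : nat) (la : seq nat).
Hypotheses (hs : size la = c) (so : sorted geq la).
Local Notation P := {mpoly F[c]}.
Local Notation tab := {ffun cell la -> 'I_c}.
Let s : P := schur la (fun i => 'X_i).

Definition lam_mnm : 'X_{1..c} := [multinom nth 0%N la i | i < c].
Definition content (T : tab) : 'X_{1..c} := (\sum_y U_(T y))%MM.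

Lemma contentE T i : content T i = #|[set y | T y == i]|.
Proof.
rewrite mnm_sumE -sum1dep_card [RHS]big_mkcond /=; apply: eq_bigr => y _.
by rewrite mnm1E; case: eqP.
Qed.

Lemma schur_permE (sg : 'S_c) m : (schur la (fun i => 'X_(sg i)) : P)@_m =
  #|[set T : tab | ssyt T & (\sum_y U_(sg (T y)))%MM == m]|%:R.
Proof.
rewrite raddf_sum /= -sum1dep_card natr_sum big_mkcondr /=.
by apply: eq_bigr => T _; rewrite mprodXE mcoeffX; case: eqP.
Qed.

Lemma mcoeff_schur m : s@_m = #|[set T : tab | ssyt T & content T == m]|%:R.
Proof.
have := schur_permE 1 m; under eq_finset => T do under eq_bigr => y _ do rewrite perm1.
move=> <-; congr (_@_m); rewrite /s /schur; apply: eq_bigr => T _.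
by apply: eq_bigr => y _; rewrite perm1.
Qed.

(** Row [i] is filled with [i]. This is the cellwise smallest tableau, and its content is the
    highest weight. *)
Definition super_tab : tab :=
  [ffun x => Ordinal (leq_trans (crow_lt x) (eq_leq hs))].

Lemma super_ssyt : ssyt super_tab.
Proof. by apply/ssytP; split=> x y; rewrite !ffunE /=; [move=> ->|]. Qed.

Lemma content_super : content super_tab = lam_mnm.
Proof.
apply/mnmP => i; rewrite contentE mnmE -sum1dep_card.
have hi : (i < size la)%N by rewrite hs.
transitivity (\sum_(j < size la | j == Ordinal hi) \sum_(k < nth 0 la j) 1)%N.
  rewrite sig_big_dep /=; apply: eq_bigl => x; rewrite ffunE andbT.
  by rewrite -!val_eqE.
by rewrite big_pred1_eq sum_nat_const card_ord muln1.
Qed.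

Lemma wpair_content T (y : 'I_c -> int) : wpair (wt_of (content T)) y = \sum_x y (T x).
Proof.
transitivity (\sum_i \sum_x (i == T x)%:Z * y i).
  apply: eq_bigr => i _; rewrite ffunE mnm_sumE -natz natr_sum big_distrl /=.
  by apply: eq_bigr => x _; rewrite mnm1E eq_sym natz.
by rewrite exchange_big; apply: eq_bigr => x _; rewrite wpair_delta.
Qed.

Lemma super_le (T : tab) x : ssyt T -> (super_tab x <= T x)%N.
Proof. by move=> sT; rewrite ffunE; apply: ssyt_row_le. Qed.

(** The entries of [T] are cellwise at least those of [super_tab], so a decreasing functional loses
    on every cell. *)
Lemma content_dominated (T : tab) : ssyt T -> dominated (wt_of lam_mnm) (wt_of (content T)).
Proof.
move=> sT; rewrite -content_super.
have le y : (forall i j : 'I_c, (i < j)%N -> y j <= y i) ->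
    forall x, y (T x) <= y (super_tab x).
  move=> hy x; have := super_le x sT; rewrite leq_eqVlt => /orP [/eqP/val_inj -> //|].
  exact: hy.
split=> [y hy|].
  by rewrite wpairB !wpair_content -sumrB sumr_ge0 // => x _; rewrite subr_ge0 le.
have [->|ne] := eqVneq T super_tab; [by left|right => y hy].
rewrite wpairB !wpair_content -sumrB lt_def sumr_ge0 ?andbT => [|x _]; last first.
  by rewrite subr_ge0 le // => i j ij; apply/ltW/hy.
rewrite psumr_neq0 => [|x _]; last by rewrite subr_ge0 le // => i j ij; apply/ltW/hy.
have [x hx] : exists x, T x != super_tab x.
  apply/existsP; apply: contraNT ne; rewrite negb_exists => /forallP h.
  by apply/eqP/ffunP => x; apply/eqP; rewrite -[_ == _]negbK h.
apply/hasP; exists x; rewrite ?mem_index_enum //= subr_gt0; apply: hy.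
by rewrite ltn_neqAle super_le // andbT eq_sym.
Qed.

Lemma schur_lam : s@_lam_mnm = 1.
Proof.
rewrite mcoeff_schur; suff -> : [set T : tab | ssyt T & content T == lam_mnm] = [set super_tab].
  by rewrite cards1.
apply/setP => T; rewrite !inE; apply/andP/eqP => [[sT /eqP cT]|->]; last first.
  by rewrite super_ssyt content_super.
have /eqP : \sum_x ((T x)%:Z - (super_tab x)%:Z) = 0.
  have := wpair_content T (fun i => i%:Z); rewrite cT -content_super wpair_content => h.
  by rewrite sumrB -h subrr.
rewrite psumr_eq0 => [/allP h|x _]; last by rewrite subr_ge0 lez_nat super_le.
apply/ffunP => x; have := h x; rewrite mem_index_enum subr_eq0 => /(_ isT) /eqP [].
exact: val_inj.
Qed.

Lemma alternant_perm (R : comNzRingType) (l : nat -> nat) (x : 'I_c -> R) (sg : 'S_c) :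
  alternant l (fun i => x (sg i)) = (-1) ^+ sg * alternant l x.
Proof.
rewrite /alternant; have -> : \matrix_(i, j) x (sg i) ^+ l j =
    row_perm sg (\matrix_(i < c, j < c) x i ^+ l j) by apply/matrixP => i j; rewrite !mxE.
by rewrite row_permE det_mulmx det_perm.
Qed.

(** Read off from the bialternant formula: both alternants change by the same sign, and [vdm]
    cancels in the polynomial ring. *)
Lemma schur_sym (sg : 'S_c) : schur la (fun i => 'X_(sg i)) = s.
Proof.
have := schur_alternant (fun i => 'X_(sg i) : P) hs so.
rewrite !(alternant_perm _ (fun i => 'X_i)) (schur_alternant (fun i => 'X_i : P) hs so).
rewrite -mulrA => /(mulfI _) h; apply/esym.
apply: (mulfI (vdm_neq0 F c)); apply: h.
by rewrite signr_eq0.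
Qed.

Lemma schur_wnorm m : s@_m != 0 -> m <> lam_mnm ->
  wnorm (wt_of m) < wnorm (wt_of lam_mnm).
Proof.
move=> sm ne.
apply: (@wnorm_max c (wt_of lam_mnm) (fun nu => exists2 T, ssyt T & nu = wt_of (content T))).
- by move=> i j ij; rewrite !ffunE !mnmE lez_nat; apply: nth_sorted_geq => //; apply: ltnW.
- by move=> nu [T sT ->]; apply: content_dominated.
- move=> nu i j [T sT ->] ij _; set sg := tperm i j.
  have := schur_permE sg (\sum_y U_(sg (T y)))%MM; rewrite schur_sym mcoeff_schur.
  move/eqP; rewrite eqr_nat => /eqP e.
  have : (0 < #|[set T' : tab | ssyt T' & content T' == (\sum_y U_(sg (T y)))%MM]|)%N.
    by rewrite e; apply/card_gt0P; exists T; rewrite inE sT eqxx.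
  move=> /card_gt0P [T']; rewrite inE => /andP [sT' /eqP cT']; exists T' => //.
  apply/ffunP => k; rewrite !ffunE cT' !mnm_sumE; congr (_%:Z).
  apply: eq_bigr => y _; rewrite !mnm1E; congr nat_of_bool.
  exact: (esym (can2_eq (tpermK i j) (tpermK i j) _ _)).
- move: sm; rewrite mcoeff_schur pnatr_eq0 -lt0n => /card_gt0P [T].
  by rewrite inE => /andP [sT /eqP <-]; exists T.
- by move=> /wt_of_inj.
Qed.

Lemma lap_vdm_schur :
  lap (vdm F c * s) = (wnorm (wt_of lam_mnm))%:~R *: (vdm F c * s).
Proof.
rewrite /vdm /s -schur_alternant // lap_alternant; congr (_ *: _).
rewrite rmorph_sum; apply: eq_bigr => i _.
by rewrite rmorphXn /= ffunE mnmE.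
Qed.

End SchurFacts.

Lemma mcoeff_schur_kostka (F : numFieldType) (la mu : seq nat) :
  (schur la (fun i => 'X_i) : {mpoly F[size mu]})@_[multinom nth 0%N mu i | i < size mu] =
    (kostka la mu)%:R.
Proof.
rewrite mcoeff_schur; congr (_%:R); apply: eq_card => T; rewrite !inE; congr (_ && _).
apply/eqP/forallP => [e i|h]; first by rewrite -contentE e mnmE.
by apply/mnmP => i; rewrite contentE mnmE; apply/eqP.
Qed.

(** * Weyl symmetry of the weights and the formal character of a gl_c-module *)

Section WeightBasis.
Variables (K : numFieldType) (c : nat) (V : vectType K) (E : 'I_c -> 'I_c -> 'End(V)).
Notation wt := {ffun 'I_c -> int}.
Hypothesis comm : forall i j k l u,
  E i j (E k l u) - E k l (E i j u) = (j == k)%:R *: E i l u - (i == l)%:R *: E k j u.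
Variables (d : nat) (b : d.-tuple V) (w : 'I_d -> wt).
Hypothesis bB : basis_of fullv b.
Hypothesis bw : forall k, weight_vec E (w k) b`_k.

Lemma basis_sum u : u = \sum_k coord b k u *: b`_k.
Proof. exact: coord_basis bB (memvf u). Qed.

Lemma coord_b (k l : 'I_d) : coord b k b`_l = (k == l)%:R.
Proof. by rewrite coord_free ?(basis_free bB) // eq_sym. Qed.

Lemma coord_diag i k u : coord b k (E i i u) = (w k i)%:~R * coord b k u.
Proof.
rewrite {1}[u]basis_sum !linear_sum /= (bigD1 k) //= big1 ?addr0 => [|l /negbTE lk].
  by rewrite linearZ /= bw !linearZ /= coord_b eqxx mulr1 mulrC.
by rewrite linearZ /= bw !linearZ /= coord_b eq_sym lk !mulr0.
Qed.

Lemma weight_coord nu u k : weight_vec E nu u -> coord b k u != 0 -> w k = nu.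
Proof.
move=> h uk; apply/ffunP => i; have := coord_diag i k u; rewrite h linearZ /=.
by move=> /(mulIf uk) /intr_inj.
Qed.

Lemma weight_ex nu u : weight_vec E nu u -> u != 0 -> exists k, w k = nu.
Proof.
move=> h u0; have [/existsP [k hk]|] := boolP [exists k, coord b k u != 0].
  by exists k; apply: weight_coord hk.
rewrite negb_exists => /forallP h0; case/eqP: u0.
by rewrite [u]basis_sum big1 // => k _; have := h0 k; rewrite negbK => /eqP ->; rewrite scale0r.
Qed.

Lemma iter_weight nu u i j n : weight_vec E nu u ->
  weight_vec E (nu + wroot i j *+ n) (iter n (E i j) u).
Proof.
move=> h; elim: n => [|n IH]; first by rewrite mulr0n addr0.
by rewrite mulrSr addrA; apply: weight_vec_shift.
Qed.

Lemma wroot_mulrn i j n k : (wroot i j *+ n : wt) k = wroot i j k * n%:Z.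
Proof.
by elim: n => [|n IH]; rewrite ?mulr0n ?ffunE ?mulr0 // mulrSr !ffunE IH; rewrite !ffunE; lia.
Qed.

Lemma wswapE (nu : wt) (i j : 'I_c) : i != j ->
  wswap i j nu = [ffun k => nu k - (nu i - nu j) * wroot i j k].
Proof.
move=> ij; apply/ffunP => k; rewrite !ffunE.
case: tpermP => [->|->|/eqP/negbTE -> /eqP/negbTE ->]; last by rewrite subrr mulr0 subr0.
  by rewrite eqxx (negbTE ij); lia.
by rewrite eqxx eq_sym (negbTE ij); lia.
Qed.

(* sl_2-theory for [E i j] and [E j i]: raise [u] to a vector killed by [E i j], whose
   images under the first powers of [E j i] do not vanish. *)
Lemma weight_reflect (nu : wt) u (i j : 'I_c) : i != j -> nu j <= nu i ->
  weight_vec E nu u -> u != 0 -> exists k, w k = wswap i j nu.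
Proof.
move=> ij nuij hu u0.
have r_i : wroot i j i = 1 by rewrite ffunE eqxx (negbTE ij).
have r_j : wroot i j j = -1 by rewrite ffunE eqxx eq_sym (negbTE ij).
have ex_n : exists n, iter n (E i j) u == 0.
  (* [B] bounds coordinate [i] of all weights, and each application of [E i j] raises that
     coordinate by one. *)
  pose B : int := \sum_k `|w k i|; pose n := absz (B - nu i + 1); exists n; apply: contraT => h.
  have [k hk] := weight_ex (iter_weight i j n hu) h.
  have wB : w k i <= B.
    apply: le_trans (ler_norm _) _; rewrite /B (bigD1 k) //= lerDl.
    by apply: sumr_ge0.
  have hn : B - nu i + 1 <= n%:Z by rewrite /n; lia.
  by move: wB hn; rewrite hk ffunE wroot_mulrn r_i; move: (nu i) (n) => x y; lia.
have [[|n] /eqP h0 hmin] := ex_minnP ex_n; first by rewrite /= in h0; rewrite h0 eqxx in u0.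
set u' := iter n (E i j) u.
have u'0 : u' != 0 by apply/negP => /hmin; rewrite ltnn.
have hu' := iter_weight i j n hu; rewrite -/u' in hu'.
have eu' : E i j u' = 0 by [].
(* The sl_2-weight of the vector [u'], which [E i j] kills; the usual formula e f^(m+1) u' = (m+1)
   (a - m) f^m u' follows. *)
pose a : int := nu i - nu j + 2 * n%:Z.
have ef m : E i j (iter m.+1 (E j i) u') = ((m.+1)%:Z * (a - m%:Z))%:~R *: iter m (E j i) u'.
  have h m' : E i i (iter m' (E j i) u') - E j j (iter m' (E j i) u') =
      (a - 2 * m'%:Z)%:~R *: iter m' (E j i) u'.
    have hm := iter_weight j i m' hu'.
    rewrite !hm -scalerBl -rmorphB /=; congr (_%:~R *: _).
    rewrite !(ffunE, wroot_mulrn) !eqxx (negbTE ij) eq_sym (negbTE ij) /a.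
    move: (nu i) (nu j) => x y; lia.
  elim: m => [|m IH].
    have /eqP := comm i j j i u'; rewrite !eqxx !scale1r eu' linear0 subr0 => /eqP /= ->.
    by rewrite (h 0%N) /=; congr (_%:~R *: _); lia.
  have /eqP := comm i j j i (iter m.+1 (E j i) u'); rewrite !eqxx !scale1r h subr_eq => /eqP.
  rewrite [iter m.+2 _ _]iterS => ->; rewrite IH linearZ /= -scalerDl -rmorphD /=.
  congr (_%:~R *: _); lia.
have nz m : (m%:Z <= a) -> iter m (E j i) u' != 0.
  elim: m => // m IH hm; apply/negP => /eqP h; have := ef m; rewrite h linear0 => /esym/eqP.
  rewrite scaler_eq0 (negbTE (IH _)) ?orbF ?intr_eq0 ?mulf_eq0; lia.
(* [n] steps down undo the raising, and nu_i - nu_j more perform the reflection; the total is at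
   most [a] because nu_j <= nu_i. *)
pose m := (n + `|nu i - nu j|)%N.
have hm : m%:Z <= a by rewrite /m /a; lia.
have [k hk] := weight_ex (iter_weight j i m hu') (nz m hm).
exists k; rewrite hk wswapE //; apply/ffunP => x; rewrite !(ffunE, wroot_mulrn) /m.
move: nuij; clear; move: (nu x) (nu i) (nu j) => X Y Z h.
by case: (x == i); case: (x == j); lia.
Qed.

Lemma weight_swap k (i j : 'I_c) : exists k', w k' = wswap i j (w k).
Proof.
have [->|ij] := eqVneq i j.
  by exists k; apply/ffunP => x; rewrite ffunE tperm1 perm1.
have b0 : b`_k != 0.
  by apply: (free_not0 (basis_free bB)); rewrite mem_nth // size_tuple.
have [h|h] := leP (w k j) (w k i); first exact: weight_reflect (bw k) b0.
have ji : j != i by rewrite eq_sym.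
have [k' hk'] := weight_reflect ji (ltW h) (bw k) b0.
by exists k'; rewrite hk'; apply/ffunP => x; rewrite !ffunE tpermC.
Qed.

Variable la : wt.
Hypothesis wd : forall k, dominated la (w k).
Hypothesis la_ge0 : forall i : 'I_c, 0 <= la i.

(** A swap moves coordinate [i] to the last place. Minus the last coordinate is a weakly decreasing
    functional, so dominance bounds that coordinate below by the last one of [la]. *)
Lemma weight_ge0 k (i : 'I_c) : 0 <= w k i.
Proof.
have c0 : (c.-1 < c)%N by rewrite ltn_predL (leq_ltn_trans (leq0n i)).
pose l := Ordinal c0; have [k' hk'] := weight_swap k i l.
have -> : w k i = w k' l by rewrite hk' ffunE tpermR.
have [h _] := wd k'; apply: le_trans (la_ge0 l) _.
have := h (fun t => - (t == l)%:Z); rewrite wpairB.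
have e nu : wpair nu (fun t => - (t == l)%:Z) = - nu l.
  rewrite /wpair (bigD1 l) //= eqxx big1 ?addr0 ?mulrN ?mulr1 // => t /negbTE ->.
  by rewrite oppr0 mulr0.
rewrite !e opprK addrC subr_ge0; apply=> s t st.
have -> : (s == l) = false.
  by apply/negbTE/eqP => sl; have := ltn_ord t; rewrite sl /= in st; lia.
by case: (t == l).
Qed.

Lemma weight_sum k : \sum_i w k i = \sum_i la i.
Proof.
have [h _] := wd k.
have e (nu : wt) x : wpair nu (fun=> x) = (\sum_i nu i) * x by rewrite big_distrl.
have h1 := h (fun=> 1) (fun _ _ _ => lexx _).
have h2 := h (fun=> -1) (fun _ _ _ => lexx _).
by move: h1 h2; rewrite !wpairB !e; lia.
Qed.

Definition mon k : 'X_{1..c} := [multinom `|w k i|%N | i < c].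

Lemma wt_of_mon k : wt_of (mon k) = w k.
Proof. by apply/ffunP => i; rewrite ffunE mnmE gez0_abs ?weight_ge0. Qed.

Definition formal_char : {mpoly K[c]} := \sum_k 'X_[mon k].

(* The generating function of the traces of [E i j \o E j i] on the weight spaces. *)
Definition trace_char i j : {mpoly K[c]} :=
  \sum_(k < d) \sum_(l < d) (coord b k (E i j b`_l) * coord b l (E j i b`_k)) *: 'X_[mon k].

Lemma coord_comp (k l : 'I_d) i j i' j' : coord b k (E i j (E i' j' b`_l)) =
  \sum_(m < d) coord b k (E i j b`_m) * coord b m (E i' j' b`_l).
Proof.
rewrite {1}[E i' j' _]basis_sum !linear_sum; apply: eq_bigr => m _ /=.
by rewrite !linearZ /= mulrC.
Qed.

Lemma trace_charE i j : trace_char i j = \sum_(k < d) coord b k (E i j (E j i b`_k)) *: 'X_[mon k].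
Proof. by apply: eq_bigr => k _; rewrite coord_comp scaler_suml. Qed.

(** Cyclicity of the trace, refined by weights: [E i j] shifts a weight by e_i - e_j, and the two
    variables record this shift. *)
Lemma trace_shift i j : 'X_j * trace_char i j = 'X_i * trace_char j i.
Proof.
rewrite /trace_char !big_distrr /= [RHS](eq_bigr _ (fun _ _ => big_distrr _ _ _)) /=.
rewrite [LHS](eq_bigr _ (fun _ _ => big_distrr _ _ _)) /= exchange_big /=.
apply: eq_bigr => l _; apply: eq_bigr => k _.
rewrite -!scalerAr [coord b l _ * _]mulrC.
have [->|h] := eqVneq (coord b k (E i j b`_l)) 0; first by rewrite mul0r !scale0r.
have hw := weight_coord (weight_vec_shift comm i j (bw l)) h.
rewrite -!mpolyXD; congr (_ *: 'X_[_]); apply: wt_of_inj; apply/ffunP => x.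
have := congr1 (fun f : wt => f x) hw; rewrite -!wt_of_mon !ffunE !mnmDE !mnm1E.
by rewrite ![_ == x]eq_sym; move: (mon k x) (mon l x) (x == i) (x == j) => A B [] []; lia.
Qed.

Lemma trace_comm i j : trace_char i j - trace_char j i =
  euler i formal_char - euler j formal_char.
Proof.
rewrite !trace_charE /formal_char (linear_sum (euler i)) (linear_sum (euler j)).
rewrite -!sumrB; apply: eq_bigr => k _ /=.
rewrite !eulerX -!scalerBl -linearB comm !eqxx !scale1r linearB /= !coord_diag coord_b eqxx !mulr1.
by rewrite -!wt_of_mon !ffunE.
Qed.

Lemma trace_diag i : trace_char i i = euler i (euler i formal_char).
Proof.
rewrite trace_charE /formal_char !linear_sum; apply: eq_bigr => k _ /=.
rewrite !coord_diag coord_b eqxx mulr1 eulerX linearZ /= eulerX scalerA.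
by rewrite -wt_of_mon ffunE.
Qed.

Lemma formal_char_hom : \sum_i euler i formal_char = (\sum_i la i)%:~R *: formal_char.
Proof.
rewrite /formal_char scaler_sumr.
under eq_bigr => i _ do rewrite linear_sum.
rewrite exchange_big; apply: eq_bigr => k _ /=.
under eq_bigr => i _ do rewrite eulerX.
rewrite -scaler_suml; congr (_ *: _); rewrite -(weight_sum k) rmorph_sum.
by apply: eq_bigr => i _; rewrite -wt_of_mon ffunE.
Qed.

Lemma formal_char_casimir ca :
  (forall u, \sum_i \sum_j E i j (E j i u) = ca *: u) ->
  lap formal_char + \sum_i \sum_(j | i != j) trace_char i j = ca *: formal_char.
Proof.
move=> h; rewrite /lap -big_split /= /formal_char scaler_sumr.
transitivity (\sum_i \sum_j trace_char i j).
  apply: eq_bigr => i _; rewrite [RHS](bigD1 i) //= trace_diag; congr (_ + _).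
  by apply: eq_bigl => j; rewrite eq_sym.
under eq_bigr => i _ do under eq_bigr => j _ do rewrite trace_charE.
under eq_bigr => i _ do rewrite exchange_big.
rewrite exchange_big; apply: eq_bigr => k _ /=.
under eq_bigr => i _ do rewrite -scaler_suml.
rewrite -scaler_suml; congr (_ *: _).
have := congr1 (coord b k) (h b`_k); rewrite linearZ /= coord_b eqxx mulr1 => <-.
by rewrite linear_sum; apply: eq_bigr => i _; rewrite linear_sum.
Qed.

Lemma mcoeff_formal_char m : formal_char@_m = #|[set k | w k == wt_of m]|%:R.
Proof.
rewrite raddf_sum -sum1dep_card natr_sum [RHS]big_mkcond /=; apply: eq_bigr => k _.
rewrite mcoeffX -wt_of_mon (inj_eq (@wt_of_inj c)).
by case: eqP.
Qed.

End WeightBasis.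

Lemma sum_delta (R : pzRingType) (W : lmodType R) (I : finType) (k : I) (F : I -> W) :
  \sum_j (j == k)%:R *: F j = F k.
Proof.
rewrite (bigD1 k) //= eqxx scale1r big1 ?addr0 // => j /negbTE ->.
by rewrite scale0r.
Qed.

(** * The Casimir element *)

Section Casimir.
Variables (K : numFieldType) (c : nat) (V : vectType K) (E : 'I_c -> 'I_c -> 'End(V)).
Notation wt := {ffun 'I_c -> int}.
Hypothesis comm : forall i j k l u,
  E i j (E k l u) - E k l (E i j u) = (j == k)%:R *: E i l u - (i == l)%:R *: E k j u.
Hypothesis irr : forall U : {vspace V}, (forall i j u, u \in U -> E i j u \in U) ->
  U = 0%VS \/ U = fullv.
Variables (la : wt) (v : V).
Hypothesis v0 : v != 0.
Hypothesis v_wt : weight_vec E la v.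
Hypothesis v_raise : forall i j : 'I_c, (i < j)%N -> E i j v = 0.

(** The Kronecker deltas of the commutators collapse one sum each, and the four sums left cancel in
    pairs. *)
Lemma casimir_comm k l u :
  \sum_i \sum_j E i j (E j i (E k l u)) = E k l (\sum_i \sum_j E i j (E j i u)).
Proof.
apply/eqP; rewrite -subr_eq0 linear_sum -sumrB; apply/eqP.
transitivity (\sum_i \sum_j
  (((j == k)%:R *: E i l (E j i u) - (i == l)%:R *: E k j (E j i u)) +
   ((i == k)%:R *: E i j (E j l u) - (j == l)%:R *: E i j (E k i u)))).
  apply: eq_bigr => i _; rewrite linear_sum -sumrB; apply: eq_bigr => j _ /=.
  have h1 := comm i j k l (E j i u).
  have h2 := congr1 (E i j) (comm j i k l u).
  rewrite -h1; move: h2; rewrite !linearB /= !linearZ /= => <-.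
  by rewrite [RHS]addrC addrA subrK.
under eq_bigr => i _ do rewrite big_split /= !sumrB !sum_delta -!scaler_sumr.
rewrite big_split /= !sumrB !sum_delta.
by rewrite addrA subrK subrr.
Qed.

(** This is |la|^2 + 2 (la, rho) for rho the half sum of the positive roots. *)
Definition casimir_val : int := \sum_i (la i ^+ 2 + \sum_(j < c | (i < j)%N) (la i - la j)).

Lemma casimir_highest : \sum_i \sum_j E i j (E j i v) = casimir_val%:~R *: v.
Proof.
rewrite rmorph_sum scaler_suml; apply: eq_bigr => i _ /=.
rewrite (bigD1 i) //= v_wt linearZ /= v_wt scalerA -expr2 rmorphD rmorphXn /= scalerDl.
congr (_ + _); rewrite rmorph_sum scaler_suml /= (bigID (fun j : 'I_c => (i < j)%N)) /=.
rewrite [X in _ + X]big1 ?addr0 => [|j /andP [ji]]; last first.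
  by rewrite -leqNgt leq_eqVlt val_eqE (negbTE ji) => /v_raise ->; rewrite linear0.
apply: eq_big => [j|j /andP [_ ij]]; first by rewrite neq_ltn; case: ltngtP.
have := comm i j j i v; rewrite !eqxx !scale1r (v_raise ij) linear0 subr0 => ->.
by rewrite !v_wt -scalerBl rmorphB.
Qed.

(** The kernel of the difference is a submodule containing [v], hence everything. *)
Lemma casimir_scalar u : \sum_i \sum_j E i j (E j i u) = casimir_val%:~R *: u.
Proof.
pose phi := \sum_i \sum_j (E i j \o E j i)%VF - casimir_val%:~R *: \1%VF.
have phiE x : phi x = \sum_i \sum_j E i j (E j i x) - casimir_val%:~R *: x.
  rewrite add_lfunE opp_lfunE scale_lfunE id_lfunE sum_lfunE; congr (_ - _).
  by apply: eq_bigr => i _; rewrite sum_lfunE; apply: eq_bigr => j _; rewrite comp_lfunE.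
have [k l x|h|h] := irr (U := lker phi).
- rewrite !memv_ker !phiE casimir_comm => /eqP /(congr1 (E k l)).
  by rewrite linearB linear0 linearZ => ->.
- have : v \in lker phi by rewrite memv_ker phiE casimir_highest subrr.
  by rewrite h memv0 (negbTE v0).
by have := memvf u; rewrite -h memv_ker phiE subr_eq0 => /eqP.
Qed.

End Casimir.

(** The left side is the eigenvalue found in [lap_vdmM]; its middle term accounts for the passage
    from the half sum of the positive roots to the staircase [wrho]. *)
Lemma casimir_wnorm c (la : {ffun 'I_c -> int}) :
  casimir_val la + (c%:Z - 1) * \sum_i la i + \sum_(i < c) (shifted c [::] i)%:Z ^+ 2 = wnorm la.
Proof.
rewrite wnormE /casimir_val big_split /= -!addrA; congr (_ + _).
have -> : \sum_(i < c) (shifted c [::] i)%:Z ^+ 2 = \sum_(i < c) wrho i ^+ 2.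
  by apply: eq_bigr => i _; rewrite /shifted nth_nil add0n.
rewrite addrA; congr (_ + _).
under eq_bigr => i _ do rewrite sumrB sumr_const card_ord_gt.
rewrite sumrB (exchange_big_dep predT) //=.
under [X in _ - X + _]eq_bigr => i _ do rewrite sumr_const card_ord_lt.
rewrite /wpair !big_distrr -sumrB -big_split /=; apply: eq_bigr => i _.
rewrite /wrho; have := ltn_ord i; move: (la i) (nat_of_ord i) => x k kc.
rewrite -!(mulr_natr x) !natz.
have -> : (c.-1 - k)%N%:Z = c%:Z - 1 - k%:Z by lia.
ring.
Qed.

(** * Weight multiplicities of irreducible gl_c-modules *)

Section GlMult.
Variables (K : numFieldType) (c : nat) (V : vectType K) (E : 'I_c -> 'I_c -> 'End(V)).
Notation wt := {ffun 'I_c -> int}.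
Hypothesis comm : forall i j k l u,
  E i j (E k l u) - E k l (E i j u) = (j == k)%:R *: E i l u - (i == l)%:R *: E k j u.
Hypothesis irr : forall U : {vspace V}, (forall i j u, u \in U -> E i j u \in U) ->
  U = 0%VS \/ U = fullv.
Variables (la : seq nat) (v : V).
Hypotheses (hs : size la = c) (so : sorted geq la).
Hypothesis v0 : v != 0.
Hypothesis v_wt : weight_vec E (wt_of (lam_mnm c la)) v.
Hypothesis v_raise : forall i j : 'I_c, (i < j)%N -> E i j v = 0.

(** The formal character and the Schur polynomial both satisfy the hypotheses of [lap_unique], with
    coefficient 1 at [la]. *)
Lemma gl_weight_mult : exists d (b : d.-tuple V) (w : 'I_d -> wt),
  [/\ basis_of fullv b, forall k, weight_vec E (w k) b`_k &
      forall m, #|[set k | w k == wt_of m]|%:R =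
                (schur la (fun i => 'X_i) : {mpoly K[c]})@_m].
Proof.
have [d [b [w [bB bw wd w1]]]] := weight_basis comm irr v0 v_wt v_raise.
exists d, b, w; split=> // m.
have ge0 i : 0 <= wt_of (lam_mnm c la) i by rewrite ffunE.
rewrite -(mcoeff_formal_char comm bB bw wd ge0); congr (_@_m).
have cs := casimir_scalar comm irr v0 v_wt v_raise.
apply: (@lap_unique _ _ _ _ (lam_mnm c la)).
- rewrite (lap_vdmM (trace_shift comm bB bw wd ge0) (trace_comm comm bB bw wd ge0)
     (formal_char_hom comm bB bw wd ge0) (formal_char_casimir comm bB bw wd ge0 cs)).
  congr (_ *: _); rewrite -casimir_wnorm !rmorphD !rmorphM rmorphB /= rmorph_sum /=.
  congr (_ + _); rewrite rmorph_sum; apply: eq_bigr => i _.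
  by rewrite rmorphXn.
- exact: lap_vdm_schur.
- move=> k; rewrite (mcoeff_formal_char comm bB bw wd ge0) pnatr_eq0 -lt0n => /card_gt0P [x].
  rewrite inE => /eqP wx kl.
  apply: (@wnorm_max c _ (fun nu => exists x, w x = nu)).
  + by move=> i j ij; rewrite !ffunE !mnmE lez_nat; apply: nth_sorted_geq => //; apply: ltnW.
  + by move=> nu [y <-]; apply: wd.
  + by move=> nu i j [y <-] _ _; apply: (weight_swap comm bB bw).
  + by exists x.
  + by move=> /wt_of_inj.
- by move=> k; apply: schur_wnorm.
by rewrite schur_lam // (mcoeff_formal_char comm bB bw wd ge0) w1.
Qed.
End GlMult.

Lemma schur_kostka (F : numFieldType) c (la mu : seq nat) : size mu = c ->
  (schur la (fun i => 'X_i) : {mpoly F[c]})@_[multinom nth 0%N mu i | i < c] =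
    (kostka la mu)%:R.
Proof. by move=> <-; apply: mcoeff_schur_kostka. Qed.

(** * From sl_c to gl_c, and the zero weight space *)

Section SlModule.
Variables (K : numFieldType) (c' : nat) (n : nat).
Notation c := c'.+1.
Variables (L : sl_module K c) (a : weight c) (la : seq nat).
Hypotheses (hs : size la = c) (so : sorted geq la) (sm : sumn la = (n * c)%N).
Hypothesis ha : forall i : 'I_c', a 0 i = (nth 0%N la i)%:Z - (nth 0%N la i.+1)%:Z.
Hypothesis hL : is_irr_module L a.
Local Notation V := (sl_space L).

Lemma natrc_neq0 : c%:R != 0 :> K. Proof. by rewrite pnatr_eq0. Qed.

(** The projection of gl_c onto sl_c along the scalar matrices; it also keeps [sl_act] on the
    traceless matrices, where alone its axioms speak. *)
Definition traceless (X : 'M[K]_c) : 'M[K]_c := X - (\tr X / c%:R)%:M.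

Lemma tr_traceless X : \tr (traceless X) = 0.
Proof.
rewrite /traceless linearB /= mxtrace_scalar.
by rewrite -(mulr_natr (_ / _)) divfK ?natrc_neq0 ?subrr.
Qed.

Lemma traceless_id X : \tr X = 0 -> traceless X = X.
Proof. by move=> h; rewrite /traceless h mul0r raddf0 subr0. Qed.

Lemma traceless_linear : linear traceless.
Proof.
move=> k X Y; rewrite /traceless linearP; apply/matrixP => i j; rewrite !mxE.
by case: (i == j); rewrite ?mulr1n ?mulr0n; ring.
Qed.

Definition gl_act (X : 'M[K]_c) : 'End(V) := sl_act L (traceless X).

Lemma gl_act_linear : linear gl_act.
Proof.
move=> k X Y; rewrite /gl_act traceless_linear.
by apply: sl_act_linear; apply: tr_traceless.
Qed.
HB.instance Definition _ :=
  GRing.isLinear.Build K 'M[K]_c 'End(V) _ gl_act gl_act_linear.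

Lemma gl_act_bracket X Y :
  gl_act (X *m Y - Y *m X) = (gl_act X \o gl_act Y)%VF - (gl_act Y \o gl_act X)%VF.
Proof.
rewrite /gl_act -sl_act_bracket ?tr_traceless //; congr (sl_act L _).
rewrite traceless_id; last by rewrite linearB /= [\tr (X *m Y)]mxtrace_mulC subrr.
rewrite /traceless !(mulmxBl, mulmxBr) !(mul_scalar_mx, mul_mx_scalar).
rewrite !scale_scalar_mx [_ / _ * (\tr X / _)]mulrC !opprB.
by rewrite !addrA; apply/matrixP => i j; rewrite !mxE; ring.
Qed.

Lemma gl_act_delta i j k l u :
  gl_act (delta_mx i j) (gl_act (delta_mx k l) u) -
    gl_act (delta_mx k l) (gl_act (delta_mx i j) u) =
  (j == k)%:R *: gl_act (delta_mx i l) u - (i == l)%:R *: gl_act (delta_mx k j) u.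
Proof.
have := congr1 (fun f : 'End(V) => f u) (gl_act_bracket (delta_mx i j) (delta_mx k l)).
rewrite !mul_delta_mx_cond -!scaler_nat linearB /= !linearZ /= [l == i]eq_sym.
by rewrite !(add_lfunE, opp_lfunE, comp_lfunE, scale_lfunE) /= ?opp_lfunE ?scalerN => <-.
Qed.

(* The action extended to gl_c so that the identity matrix acts by [n * c], which turns weights
   into vectors of naturals with sum [n * c]. *)
Definition gl_gen (i j : 'I_c) : 'End(V) :=
  gl_act (delta_mx i j) + ((i == j)%:R * n%:R) *: \1%VF.

Lemma gl_genE i j u : gl_gen i j u = gl_act (delta_mx i j) u + ((i == j)%:R * n%:R) *: u.
Proof. by rewrite /gl_gen add_lfunE scale_lfunE id_lfunE. Qed.

Lemma gl_gen_comm i j k l u : gl_gen i j (gl_gen k l u) - gl_gen k l (gl_gen i j u) =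
  (j == k)%:R *: gl_gen i l u - (i == l)%:R *: gl_gen k j u.
Proof.
transitivity (gl_act (delta_mx i j) (gl_act (delta_mx k l) u) -
   gl_act (delta_mx k l) (gl_act (delta_mx i j) u)).
  rewrite !gl_genE !linearD !linearZ /= !scalerA !scalerN -!opprD.
  by rewrite addrACA opprD [LHS]addrACA subrr addr0 opprD [LHS]addrACA subrr addr0.
rewrite gl_act_delta !gl_genE !scalerDr !scalerA opprD addrACA -scalerBl.
suff -> : (j == k)%:R * ((i == l)%:R * n%:R) - (i == l)%:R * ((k == j)%:R * n%:R) = 0 :> K.
  by rewrite scale0r addr0.
by rewrite [k == j]eq_sym; ring.
Qed.

Lemma gl_gen_irr (U : {vspace V}) : (forall i j u, u \in U -> gl_gen i j u \in U) ->
  U = 0%VS \/ U = fullv.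
Proof.
move=> hU; apply: (proj2 (proj1 hL)) => X trX.
apply/subvP => _ /memv_imgP [u uU ->].
have -> : sl_act L X = gl_act X by rewrite /gl_act traceless_id.
rewrite {1}[X]matrix_sum_delta linear_sum sum_lfunE rpred_sum // => i _.
rewrite linear_sum sum_lfunE rpred_sum // => j _ /=; rewrite linearZ scale_lfunE rpredZ //.
have -> : gl_act (delta_mx i j) u = gl_gen i j u - ((i == j)%:R * n%:R) *: u.
  by rewrite gl_genE addrK.
by rewrite rpredB ?hU ?rpredZ.
Qed.

Lemma gl_act1 : gl_act 1%:M = 0.
Proof.
rewrite -(linear0 gl_act) /gl_act; congr (sl_act L _).
by rewrite /traceless mxtrace1 divff ?natrc_neq0 // linear0 mul0r raddf0 !subrr.
Qed.

Lemma eq_inord (x : 'I_c) k : (k < c)%N -> (x == inord k) = (x == k :> nat).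
Proof. by move=> kc; rewrite -val_eqE /= inordK. Qed.

Lemma mxtrace_delta (i j : 'I_c) : \tr (delta_mx i j : 'M[K]_c) = (i == j)%:R.
Proof.
rewrite /mxtrace (bigD1 i) //= mxE eqxx big1 ?addr0 // => k /negbTE ki.
by rewrite mxE ki.
Qed.

Lemma corootE (i : 'I_c') : coroot K (i : 'I_c.-1) =
  delta_mx (inord i) (inord i) - delta_mx (inord i.+1) (inord i.+1).
Proof.
have h1 : (i < c)%N by apply: leqW. have h2 : (i.+1 < c)%N by rewrite ltnS.
apply/matrixP => x y; rewrite !mxE !eq_inord //.
case: (eqVneq x y) => [->|xy]; first by rewrite !andbb mulr1n.
have e k : (x == k :> nat) && (y == k :> nat) = false.
  apply/negbTE/andP => -[/eqP xk /eqP yk]; case/eqP: xy; apply: val_inj.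
  by rewrite /= xk yk.
by rewrite !e subrr mulr0n.
Qed.

Lemma gl_act_coroot (i : 'I_c') u : sl_act L (coroot K (i : 'I_c.-1)) u =
  gl_act (delta_mx (inord i) (inord i)) u - gl_act (delta_mx (inord i.+1) (inord i.+1)) u.
Proof.
have -> : sl_act L (coroot K (i : 'I_c.-1)) = gl_act (coroot K (i : 'I_c.-1)).
  by rewrite /gl_act traceless_id // corootE linearB /= !mxtrace_delta !eqxx subrr.
by rewrite corootE linearB /= add_lfunE opp_lfunE.
Qed.

(* A vector on which the differences of the diagonal matrix units act by the differences of
   the numbers [x i], whose sum vanishes, is a weight vector since the identity acts by 0. *)
Lemma diag_act u (x : 'I_c -> K) : \sum_i x i = 0 ->
  (forall i : 'I_c', gl_act (delta_mx (inord i) (inord i)) u -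
     gl_act (delta_mx (inord i.+1) (inord i.+1)) u = (x (inord i) - x (inord i.+1)) *: u) ->
  forall i, gl_act (delta_mx i i) u = x i *: u.
Proof.
move=> x0 h.
have d (k : 'I_c) : gl_act (delta_mx ord0 ord0) u - gl_act (delta_mx k k) u = (x ord0 - x k) *: u.
  rewrite -(inord_val k); case: k => k /=; elim: k => [|k IH] kc.
    have -> : inord 0 = ord0 :> 'I_c by apply: val_inj; rewrite /= inordK.
    by rewrite !subrr scale0r.
  have := IH (ltnW kc); have := h (Ordinal (kc : (k < c')%N)); rewrite /= => h1 h2.
  rewrite -[LHS](subrKA (gl_act (delta_mx (inord k) (inord k)) u)) h2 h1 -scalerDl.
  by rewrite addrA subrK.
have s0 : \sum_k gl_act (delta_mx k k) u = 0.
  rewrite -sum_lfunE -linear_sum /=.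
  have -> : \sum_(k < c) delta_mx k k = 1%:M :> 'M[K]_c.
    apply/matrixP => i j; rewrite summxE mxE (bigD1 i) //= mxE eqxx /= big1 ?addr0.
      by rewrite eq_sym; case: eqP.
    by move=> k ki; rewrite mxE eq_sym (negbTE ki).
  by rewrite gl_act1 zero_lfunE.
have e0 : gl_act (delta_mx ord0 ord0) u = x ord0 *: u.
  have : \sum_k (gl_act (delta_mx ord0 ord0) u - gl_act (delta_mx k k) u) =
      \sum_k (x ord0 - x k) *: u.
    by apply: eq_bigr => k _; apply: d.
  rewrite sumrB s0 subr0 -scaler_suml sumrB x0 subr0 !sumr_const !card_ord.
  by move=> h3; apply: (scalerI natrc_neq0); rewrite scalerA mulr_natl scaler_nat h3.
move=> i; have := d i; rewrite e0 scalerBl => /(addrI) /oppr_inj.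
exact.
Qed.

Lemma dim_zero_weight : \dim (zero_weight_space L) = kostka la (nseq c n).
Proof.
have [[_ _] [v [v0 v_raise v_wt]]] := hL.
have sumla : \sum_(i < c) (nth 0%N la i)%:R = n%:R * c%:R :> K.
  by rewrite -natr_sum -natrM -sm sumnE (big_nth 0%N) big_mkord hs.
(* The diagonal weights of [v] when the identity acts by 0: the row lengths minus their mean [n]. *)
pose x (i : 'I_c) : K := (nth 0%N la i)%:R - n%:R.
have dv i : gl_act (delta_mx i i) v = x i *: v.
  move: i; apply: diag_act => [|i].
    by rewrite /x sumrB sumla sumr_const card_ord -[X in _ - X]mulr_natr subrr.
  rewrite -gl_act_coroot v_wt ha /x !inordK ?ltnS //; last exact: ltnW.
  by congr (_ *: _); rewrite rmorphB /=; ring.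
have wv : weight_vec gl_gen (wt_of (lam_mnm c la)) v.
  move=> i; rewrite gl_genE dv /x eqxx mul1r -scalerDl subrK; congr (_ *: _).
  by rewrite ffunE mnmE.
have rv (i j : 'I_c) : (i < j)%N -> gl_gen i j v = 0.
  move=> ij; rewrite gl_genE -val_eqE ltn_eqF // mul0r scale0r addr0.
  by rewrite /gl_act traceless_id ?v_raise // mxtrace_delta -val_eqE ltn_eqF.
have [d [b [w [bB bw hw]]]] := gl_weight_mult gl_gen_comm gl_gen_irr hs so (introN eqP v0) wv rv.
(* In the extended action, weight zero for sl_c becomes (n)^c. *)
pose nu : 'X_{1..c} := [multinom nth 0%N (nseq c n) i | i < c].
pose S := [set k | w k == wt_of nu].
have nuE i : (wt_of nu i)%:~R = n%:R :> K by rewrite ffunE mnmE nth_nseq ltn_ord.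
have zE u : (u \in zero_weight_space L) = [forall i, gl_gen i i u == (wt_of nu i)%:~R *: u].
  have -> : (u \in zero_weight_space L) = [forall i : 'I_c.-1, sl_act L (coroot K i) u == 0].
    rewrite memvE; apply/subv_bigcapP/forallP => h i.
      by have := h i isT; rewrite -memvE memv_ker.
    by move=> _; rewrite -memvE memv_ker.
  apply/forallP/forallP => h i.
    rewrite nuE gl_genE eqxx mul1r (@diag_act u (fun=> 0)) ?scale0r ?add0r // => [|j].
      by rewrite big1.
    by rewrite -gl_act_coroot (eqP (h j)) oppr0 scale0r.
  have g j : gl_act (delta_mx j j) u = 0.
    by have /eqP := h j; rewrite nuE gl_genE eqxx mul1r -[X in _ = X]add0r => /addIr.
  by rewrite gl_act_coroot !g subrr.
pose f (k : 'I_d) := b`_k.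
have -> : zero_weight_space L = <<[seq f k | k <- enum S]>>%VS.
  apply: subv_anti; apply/andP; split.
    apply/subvP => u; rewrite zE => /forallP h.
    rewrite (basis_sum bB u) rpred_sum // => k _.
    have [->|hk] := eqVneq (coord b k u) 0; first by rewrite scale0r mem0v.
    rewrite rpredZ // memv_span //; apply: (map_f f); rewrite mem_enum inE.
    by rewrite (weight_coord bB bw (fun i => eqP (h i)) hk).
  apply/span_subvP => u /mapP [k]; rewrite mem_enum inE => /eqP wk ->.
  by rewrite zE; apply/forallP => i; rewrite -wk; apply/eqP/bw.
have fS : free [seq f k | k <- enum S].
  suff /catl_free : free ([seq f k | k <- enum S] ++ [seq f k | k <- enum (~: S)]) by [].
  rewrite -map_cat; have eb : (b : seq V) = [seq f k | k <- enum 'I_d].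
    apply: (@eq_from_nth _ 0) => [|i]; first by rewrite size_map size_enum_ord size_tuple.
    rewrite size_tuple => hi; rewrite (nth_map (Ordinal hi)) ?size_enum_ord //.
    by rewrite /f nth_enum_ord.
  have /perm_map p : perm_eq (enum S ++ enum (~: S)) (enum 'I_d).
    apply: uniq_perm; rewrite ?enum_uniq //.
      rewrite cat_uniq !enum_uniq andbT /=; apply/hasPn => k.
      by rewrite !mem_enum !inE.
    by move=> k; rewrite mem_cat !mem_enum !inE orbN.
  by rewrite (perm_free (p _ f)) -eb (basis_free bB).
rewrite (eqnP fS) size_map -cardE; apply/eqP; rewrite -(eqr_nat K); apply/eqP.
by rewrite hw (schur_kostka _ _ (size_nseq c n)).
Qed.
End SlModule.

End WeightMultiplicity.
Import WeightMultiplicity.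

(** * Formal series in q *)

Lemma qcoefD (x y : qser) e : qcoef (x + y) e = qcoef x e + qcoef y e. Proof. by []. Qed.
Lemma qcoefN (x : qser) e : qcoef (- x) e = - qcoef x e. Proof. by []. Qed.
Lemma qcoefB (x y : qser) e : qcoef (x - y) e = qcoef x e - qcoef y e. Proof. by []. Qed.
Lemma qcoef_pow a e : qcoef (qpow a) e = (e == a)%:R. Proof. by []. Qed.

Lemma qcoef_sum (I : Type) (r : seq I) (P : pred I) (F : I -> qser) e :
  qcoef (\sum_(i <- r | P i) F i) e = \sum_(i <- r | P i) qcoef (F i) e.
Proof. by elim/big_rec2: _ => // i x y _ <-. Qed.

Lemma qcoef_powM a (x : qser) e : qcoef (qpow a * x) e = qcoef x (e - a).
Proof.
have [m hm] := lf_min (qser_lf x).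
rewrite [LHS](qconvE (A := [:: a]) hm) ?big_seq1 ?qcoef_pow ?eqxx ?mul1r //.
by move=> d _ /eqP; rewrite inE pnatr_eq0 eqb0 negbK.
Qed.

Lemma qpowD a b : qpow (a + b) = qpow a * qpow b.
Proof.
by apply: qserP => e; rewrite qcoef_powM !qcoef_pow subr_eq addrC.
Qed.

Lemma qpow_nat k : q ^+ k = qpow k%:R.
Proof. by elim: k => // k IH; rewrite exprS IH -qpowD nat1r. Qed.

Lemma qpowX a k : qpow a ^+ k = qpow (a * k%:R).
Proof.
by elim: k => [|k IH]; rewrite ?mulr0 // exprS IH -qpowD -nat1r mulrDr mulr1.
Qed.

Lemma qpow_sum (I : Type) (r : seq I) (P : pred I) (F : I -> rat) :
  \prod_(i <- r | P i) qpow (F i) = qpow (\sum_(i <- r | P i) F i).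
Proof. by elim/big_rec2: _ => // i x y _ ->; rewrite qpowD. Qed.

Lemma qpow_unit a : qpow a \is a GRing.unit.
Proof. by apply/unitrP; exists (qpow (- a)); rewrite -!qpowD addNr subrr. Qed.

(** The order in q is at least [m]; all convergence is measured by it. *)
Definition lowb (m : rat) (x : qser) := forall d, d < m -> qcoef x d = 0.

Lemma lowb_le (m n : rat) x : lowb m x -> n <= m -> lowb n x.
Proof. by move=> h nm d dn; apply: h; apply: lt_le_trans nm. Qed.

Lemma lowbD m x y : lowb m x -> lowb m y -> lowb m (x + y).
Proof. by move=> hx hy d dm; rewrite qcoefD hx ?hy ?addr0. Qed.

Lemma lowbN m x : lowb m x -> lowb m (- x).
Proof. by move=> hx d dm; rewrite qcoefN hx ?oppr0. Qed.

Lemma lowb_qpow a : lowb a (qpow a).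
Proof. by move=> d da; rewrite qcoef_pow lt_eqF. Qed.

Lemma lowbM m n x y : lowb m x -> lowb n y -> lowb (m + n) (x * y).
Proof.
move=> hx hy d dmn; apply: contrapT => /qconv_supp [a xa ya].
have ma : m <= a by rewrite leNgt; apply/negP => /hx.
have nb : n <= d - a by rewrite leNgt; apply/negP => /hy.
lra.
Qed.

Lemma lowb0M m x y : lowb 0 x -> lowb m y -> lowb m (x * y).
Proof. by move=> hx hy; rewrite -[m]add0r; apply: lowbM. Qed.

Lemma lowb1 : lowb 0 1. Proof. exact: lowb_qpow. Qed.

Lemma lowb_prod (I : Type) (r : seq I) (P : pred I) (F : I -> qser) :
  (forall i, P i -> lowb 0 (F i)) -> lowb 0 (\prod_(i <- r | P i) F i).
Proof. by move=> h; elim/big_rec: _ => [|i x Pi]; [apply: lowb1 | apply: lowb0M (h i Pi)]. Qed.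

Lemma lowb_nat k : lowb 0 (k%:R).
Proof. by elim: k => [|k IH]; rewrite -?nat1r //; apply: lowbD => //; apply: lowb1. Qed.

Lemma lowb_1subq k : lowb 0 (1 - q ^+ k).
Proof.
apply: lowbD; [exact: lowb1 | apply: lowbN; rewrite qpow_nat].
by apply: lowb_le (@lowb_qpow _) _; rewrite ler0n.
Qed.

Lemma ex_nat_gt (e : rat) : exists n : nat, e < n%:R.
Proof. by exists (Num.truncn `|e|).+1; apply: le_lt_trans (ler_norm e) _; rewrite truncnS_gt. Qed.

Lemma qser_eq x y : (forall n : nat, lowb n%:R (x - y)) -> x = y.
Proof.
move=> h; apply: qserP => e; have [n en] := ex_nat_gt e.
by apply/eqP; rewrite -subr_eq0 -qcoefB (h n).
Qed.

(** Completeness: the coefficient at [e] is final from stage [N e] on, since later differences have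
    order above [e]. *)
Lemma qcauchy (u : nat -> qser) : (forall n, lowb n%:R (u n.+1 - u n)) ->
  exists l, forall n, lowb n%:R (l - u n).
Proof.
move=> h; pose N (e : rat) := (Num.truncn `|e|).+1.
have eN e : e < (N e)%:R by apply: le_lt_trans (ler_norm e) _; rewrite truncnS_gt.
have st n m d : (n <= m)%N -> d < n%:R -> qcoef (u m) d = qcoef (u n) d.
  move=> /subnK <- dn; elim: (m - n)%N => // k <-.
  apply/eqP; rewrite addSn -subr_eq0 -qcoefB h //; apply: lt_le_trans dn _.
  by rewrite ler_nat leq_addl.
have st2 n d : d < n%:R -> qcoef (u (N d)) d = qcoef (u n) d.
  by move=> dn; case: (leqP (N d) n) => [l|/ltnW l]; [rewrite (st _ _ _ l) | rewrite (st _ _ _ l)].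
have lf : left_finite (fun e => qcoef (u (N e)) e).
  move=> e; apply: sub_finite_set (qser_lf (u (N e)) e) => d /= [de nz]; split => //.
  by rewrite -(st2 (N e)) //; apply: le_lt_trans (eN e).
by exists (QSer lf) => n d dn; rewrite qcoefB /= (st2 n) // subrr.
Qed.

(** The inverse is the geometric series in 1 - x. *)
Lemma qunit_lowb x : lowb 1 (1 - x) -> x \is a GRing.unit /\ lowb 0 x^-1.
Proof.
set y := 1 - x => hy; have xE : x = 1 - y by rewrite opprB addrC subrK.
have ypow n : lowb n%:R (y ^+ n).
  by elim: n => [|n IH]; [apply: lowb1 | rewrite exprS -nat1r; apply: lowbM].
pose u n := \sum_(i < n) y ^+ i.
have [|l hl] := @qcauchy u; first by move=> n; rewrite /u big_ord_recr /= addrAC subrr add0r.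
have lx : lowb 0 x by rewrite xE; apply: lowbD; [apply: lowb1 | apply/lowbN/(lowb_le hy)].
have e : l * x = 1.
  apply: qser_eq => n; have -> : l * x - 1 = x * (l - u n) + - y ^+ n.
    have -> : y ^+ n = 1 - x * u n.
      have := subrX1 y n; rewrite -/(u n) => h.
      by rewrite {1}xE -[y ^+ n](subrK 1) h; ring.
    ring.
  by apply: lowbD; [apply: lowb0M | apply: lowbN].
have ux : x \is a GRing.unit by apply/unitrP; exists l; rewrite e mulrC e.
split=> //; have -> : x^-1 = l by rewrite -[LHS]mul1r -e mulrK.
by have := hl 0%N; rewrite /u big_ord0 subr0.
Qed.

Lemma unit_1subq k : (0 < k)%N -> 1 - q ^+ k \is a GRing.unit /\ lowb 0 (1 - q ^+ k)^-1.
Proof.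
move=> k0; apply: qunit_lowb; rewrite opprB addrC subrK qpow_nat.
by apply: lowb_le (@lowb_qpow _) _; rewrite ler1n.
Qed.

Lemma qcvg_uniq u l l' : qcvg u l -> qcvg u l' -> l = l'.
Proof.
move=> h h'; apply: qserP => e; have [N hN] := h e; have [N' hN'] := h' e.
by rewrite -(hN (maxn N N')) ?leq_maxl // hN' // leq_maxr.
Qed.

(** A [qlim] without a limit would be 0, so the partial products are first shown to converge. *)
Lemma qinfty_unit : qinfty \is a GRing.unit.
Proof.
pose u N := \prod_(1 <= m < N.+1) (1 - q ^+ m).
have u0 N : lowb 0 (u N) by apply: lowb_prod => m _; apply: lowb_1subq.
have uS N : u N.+1 - u N = u N * - q ^+ N.+1.
  by rewrite /u big_nat_recr //=; ring.
have dS N : lowb N.+1%:R (u N.+1 - u N).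
  by rewrite uS; apply: lowb0M => //; apply: lowbN; rewrite qpow_nat; apply: lowb_qpow.
have [|l hl] := @qcauchy u.
  by move=> n; apply: lowb_le (dS n) _; rewrite ler_nat.
have cl : qcvg u l.
  move=> e; have [N eN] := ex_nat_gt e; exists N => n Nn; apply/esym/eqP.
  rewrite -subr_eq0 -qcoefB hl //; apply: lt_le_trans eN _; by rewrite ler_nat.
have -> : qinfty = l.
  have := @xgetPex _ 0 [set l | qcvg u l] (ex_intro _ l cl) => h.
  exact: qcvg_uniq h cl.
have u1 N : lowb 1 (1 - u N).
  elim: N => [|N IH]; first by rewrite /u big_geq // subrr.
  have -> : 1 - u N.+1 = (1 - u N) - (u N.+1 - u N) by ring.
  by apply: lowbD => //; apply/lowbN/(lowb_le (dS N)); rewrite ler1n.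
apply: (proj1 (qunit_lowb _)).
have -> : 1 - l = (1 - u 1%N) - (l - u 1%N) by ring.
by apply: lowbD => //; apply: lowbN (hl 1%N).
Qed.

(** The common lower bound [m] lets one finite list of exponents of [x] serve for all [n]. *)
Lemma qcvgM x u l m : (forall n, lowb m (u n)) -> qcvg u l -> qcvg (fun n => x * u n) (x * l).
Proof.
move=> hu hl e.
have ml : lowb m l by move=> d dm; have [N /(_ N (leqnn N)) <-] := hl d; apply: hu.
have [A uA hA] := lf_seq (e - m) (qser_lf x).
have hE y : lowb m y -> qcoef (x * y) e = \sum_(d <- A) qcoef x d * qcoef y (e - d).
  by move=> hy; apply: (qconvE hy uA).
have [N hN] : exists N, forall n d, (N <= n)%N -> d \in A -> qcoef (u n) (e - d) = qcoef l (e - d).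
  elim: (A) => [|d s [N IH]]; first by exists 0%N.
  have [N' hN'] := hl (e - d); exists (maxn N N') => n d'.
  rewrite geq_max => /andP [h1 h2]; rewrite inE => /orP [/eqP ->|]; first exact: hN'.
  exact: IH.
exists N => n Nn; rewrite !hE //.
by rewrite big_seq [RHS]big_seq; apply: eq_bigr => d dA; rewrite (hN n).
Qed.

(** * Principal specializations *)

(** The larger index is outermost, so that the product can be cut at a given number of rows. *)
Definition pair_prod (F : nat -> nat -> qser) (m : nat) : qser :=
  \prod_(0 <= j < m) \prod_(0 <= i < j) F i j.

Lemma pair_prodE F m :
  pair_prod F m = \prod_(i < m) \prod_(j < m | (i < j)%N) F i j.
Proof.
rewrite (exchange_big_dep predT) //= /pair_prod big_mkord; apply: eq_bigr => j _.
by rewrite big_mkord (big_ord_widen m (fun i => F i j)) // ltnW.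
Qed.

Lemma eq_pair_prod F G m : (forall i j, (i < j < m)%N -> F i j = G i j) ->
  pair_prod F m = pair_prod G m.
Proof.
move=> h; rewrite /pair_prod; apply: eq_big_nat => j /andP [_ jm].
by apply: eq_big_nat => i /andP [_ ij]; apply: h; rewrite ij.
Qed.

(** The exponent is la_i - la_j + j - i; adding first keeps the truncated subtraction exact on
    partitions. *)
Definition weyl_factor (la : seq nat) (i j : nat) : qser :=
  1 - q ^+ (nth 0%N la i + (j - i) - nth 0%N la j)%N.

(** Minus the pairing of [la] with the Weyl vector, the lowest exponent of the principal
    specialization. *)
Definition principal_exp (m : nat) (la : seq nat) : rat :=
  \sum_(i < m) (nth 0%N la i)%:R * (i%:R - (m%:R - 1) / 2).

Lemma pair_prod_unit F m : (forall i j, (i < j < m)%N -> F i j \is a GRing.unit) ->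
  pair_prod F m \is a GRing.unit.
Proof.
move=> h; rewrite /pair_prod big_nat; elim/big_ind: _ => [|x y hx hy|j /andP [_ jm]].
- exact: unitr1.
- by rewrite unitrM hx.
rewrite big_nat; elim/big_ind: _ => [|x y hx hy|i /andP [_ ij]].
- exact: unitr1.
- by rewrite unitrM hx.
by apply: h; rewrite ij.
Qed.

Lemma weyl_factor0_unit i j : (i < j)%N -> weyl_factor [::] i j \is a GRing.unit.
Proof.
move=> ij; rewrite /weyl_factor !nth_nil add0n subn0.
by apply: (proj1 (unit_1subq _)); rewrite subn_gt0.
Qed.

Section Principal.
Variables (m : nat).
Let x (i : 'I_m) : qser := qpow ((m%:R - 1 - 2 * i%:R) / 2).

(** The exponents of the variables form an arithmetic progression, so the matrix is a Vandermonde
    matrix in the q^(- l j) with rescaled columns. The sign depends only on [m] and cancels in the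
    quotient of two alternants. *)
Lemma alternant_principal (l : nat -> nat) : (forall i j, (i < j < m)%N -> (l j < l i)%N) ->
  alternant l x = (\prod_(i < m) \prod_(j < m | (i < j)%N) (-1)) *
    qpow (\sum_(i < m) (l i)%:R * (i%:R - (m%:R - 1) / 2)) *
    pair_prod (fun i j => 1 - q ^+ (l i - l j)) m.
Proof.
move=> hl; pose a : 'rV[qser]_m := \row_j qpow (- (l j)%:R).
pose b : 'rV[qser]_m := \row_j qpow ((m%:R - 1) / 2 * (l j)%:R).
have -> : alternant l x = \det (Vandermonde m a *m diag_mx b).
  congr (\det _); apply/matrixP => i j; rewrite mul_mx_diag !mxE !qpowX -qpowD.
  by congr qpow; field.
rewrite det_mulmx det_diag det_Vandermonde.
have -> : \prod_(i < m) \prod_(j < m | (i < j)%N) (a 0 j - a 0 i) =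
   (\prod_(i < m) \prod_(j < m | (i < j)%N) (-1)) *
   (\prod_(i < m) \prod_(j < m | (i < j)%N) qpow (- (l i)%:R)) *
   pair_prod (fun i j => 1 - q ^+ (l i - l j)) m.
  rewrite pair_prodE -!big_split; apply: eq_bigr => i _; rewrite -!big_split /=.
  apply: eq_bigr => j ij; rewrite !mxE.
  have -> : qpow (- (l j)%:R) = qpow (- (l i)%:R) * q ^+ (l i - l j).
    rewrite qpow_nat -qpowD natrB; last by apply: ltnW; apply: hl; rewrite ij ltn_ord.
    by rewrite addrA addNr add0r.
  ring.
suff <- : (\prod_(i < m) \prod_(j < m | (i < j)%N) qpow (- (l i)%:R)) * \prod_i b 0 i =
    qpow (\sum_(i < m) (l i)%:R * (i%:R - (m%:R - 1) / 2)) by ring.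
rewrite (eq_bigr (fun i : 'I_m => qpow ((m%:R - 1 - i%:R) * - (l i)%:R))); last first.
  move=> i _; rewrite prodr_const qpowX mulrC card_ord_gt; congr (qpow (_ * _)).
  by rewrite -subn1 -subnDA natrB ?add1n ?ltn_ord // -nat1r opprD addrA.
have -> : \prod_i b 0 i = qpow (\sum_(i < m) (m%:R - 1) / 2 * (l i)%:R).
  by rewrite -qpow_sum; apply: eq_bigr => i _; rewrite mxE.
rewrite qpow_sum -qpowD -big_split; congr qpow.
by apply: eq_bigr => i _ /=; field.
Qed.

Lemma schur_principalE (la : seq nat) : size la = m -> sorted geq la ->
  schur_principal la m * pair_prod (weyl_factor [::]) m =
    qpow (principal_exp m la) * pair_prod (weyl_factor la) m.
Proof.
move=> hs so.
have := schur_alternant x hs so; rewrite -/(schur_principal la m).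
rewrite !alternant_principal; last first.
- by move=> i j /andP [ij jm]; rewrite /shifted; have := nth_sorted_geq so (ltnW ij); lia.
- by move=> i j /andP [ij jm]; rewrite /shifted !nth_nil; lia.
have us : \prod_(i < m) \prod_(j < m | (i < j)%N) (-1) \is a @GRing.unit qser.
  apply: rpred_prod => i _; apply: rpred_prod => j _; exact: unitrN1.
rewrite -!mulrA => /(mulrI us).
have -> : pair_prod (fun i j => 1 - q ^+ (shifted m la i - shifted m la j)) m =
   pair_prod (weyl_factor la) m.
  apply: eq_pair_prod => i j /andP [ij jm]; rewrite /weyl_factor /shifted; congr (1 - q ^+ _).
  have := nth_sorted_geq so (ltnW ij); lia.
have -> : pair_prod (fun i j => 1 - q ^+ (shifted m [::] i - shifted m [::] j)) m =
   pair_prod (weyl_factor [::]) m.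
  apply: eq_pair_prod => i j /andP [ij jm].
  rewrite /weyl_factor /shifted !nth_nil; congr (1 - q ^+ _).
  lia.
set S0 := \sum_(i < m) _; set S1 := \sum_(i < m) _.
have -> : S0 = S1 + principal_exp m la.
  rewrite /S0 /S1 /principal_exp -big_split; apply: eq_bigr => i _ /=.
  by rewrite -mulrDl /shifted nth_nil add0n natrD addrC.
rewrite qpowD -mulrA => /(mulrI (qpow_unit _)) ->; exact: mulrC.
Qed.

End Principal.

(** Adding [s] full columns keeps the differences of the rows and moves the exponent by [s] times
    the sum of i - (m-1)/2, which is 0. *)
Lemma principal_shift m s (la mu : seq nat) : size la = m -> size mu = m ->
  sorted geq la -> sorted geq mu ->
  (forall i, (i < m)%N -> nth 0%N la i = (nth 0%N mu i + s)%N) ->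
  schur_principal la m = schur_principal mu m.
Proof.
move=> h1 h2 s1 s2 h.
have u : pair_prod (weyl_factor [::]) m \is a GRing.unit.
  by apply: pair_prod_unit => i j /andP [ij _]; apply: weyl_factor0_unit.
have eP : principal_exp m la = principal_exp m mu.
  rewrite /principal_exp (eq_bigr (fun i : 'I_m => (nth 0%N mu i)%:R * (i%:R - (m%:R - 1) / 2)
     + s%:R * (i%:R - (m%:R - 1) / 2))); last by move=> i _; rewrite h // natrD mulrDl.
  rewrite big_split /= -[RHS]addr0; congr (_ + _).
  rewrite -big_distrr /=.
  suff -> : \sum_(i < m) (i%:R - (m%:R - 1) / 2) = 0 :> rat by rewrite mulr0.
  have e k : \sum_(i < k) i%:R = k%:R * (k%:R - 1) / 2 :> rat.
    by elim: k => [|k IH]; rewrite ?big_ord0 ?mul0r // big_ord_recr /= IH -natr1; field.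
  by rewrite sumrB sumr_const card_ord e -(mulr_natl (_ / _)); field.
have eF : pair_prod (weyl_factor la) m = pair_prod (weyl_factor mu) m.
  apply: eq_pair_prod => i j /andP [ij jm]; rewrite /weyl_factor !h ?(ltn_trans ij) //.
  by congr (1 - q ^+ _); lia.
have := schur_principalE h1 s1; rewrite eP eF -(schur_principalE h2 s2).
by move/(mulIr u).
Qed.

(** The factors of the pairs i < c <= j when row [j] is empty; at [[::]] they are the
    denominators. *)
Definition mixed_prod (la : seq nat) (c r : nat) : qser :=
  \prod_(0 <= i < c) \prod_(c <= j < r) (1 - q ^+ (nth 0%N la i + (j - i))%N).

(* The factors of the pairs of rows split into those among the first [c], which do not depend
   on [r], those among the last [r - c], which do not depend on [la], and the mixed ones. *)
Lemma principal_truncate (la : seq nat) (c r : nat) : (c <= r)%N -> size la = r ->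
  sorted geq la -> (forall i, (c <= i)%N -> nth 0%N la i = 0%N) ->
  qpow ((sumn la)%:R * (r%:R - c%:R) / 2) * schur_principal la r * mixed_prod [::] c r =
    schur_principal (take c la) c * mixed_prod la c r.
Proof.
move=> cr hs so h0.
have split mu : (forall i, (c <= i)%N -> nth 0%N mu i = 0%N) -> pair_prod (weyl_factor mu) r =
    pair_prod (weyl_factor mu) c * (mixed_prod mu c r *
      \prod_(c <= j < r) \prod_(c <= i < j) (1 - q ^+ (j - i))).
  move=> hmu; rewrite /pair_prod (big_cat_nat (leq0n c) cr); congr (_ * _).
  rewrite /mixed_prod exchange_big -big_split /=; apply: eq_big_nat => j /andP [cj jr].
  rewrite (big_cat_nat (n := c)) //=; congr (_ * _); apply: eq_big_nat => i /andP [ci ij].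
    by rewrite /weyl_factor [nth _ _ j]hmu // subn0.
  by rewrite /weyl_factor !hmu // add0n subn0.
have hs' : size (take c la) = c by rewrite size_take hs; case: ltngtP cr.
have so' : sorted geq (take c la) by apply: take_sorted.
set B := \prod_(c <= j < r) _ in split.
have uB : pair_prod (weyl_factor [::]) c * B \is a GRing.unit.
  have : pair_prod (weyl_factor [::]) r \is a GRing.unit.
    by apply: pair_prod_unit => i j /andP [ij _]; apply: weyl_factor0_unit.
  by rewrite split ?unitrM // => [|i _]; [case/and3P => -> _ -> | rewrite nth_nil].
have e1 := schur_principalE hs so; have e2 := schur_principalE hs' so'.
apply: (mulIr uB).
have -> : qpow ((sumn la)%:R * (r%:R - c%:R) / 2) * schur_principal la r * mixed_prod [::] c r *
   (pair_prod (weyl_factor [::]) c * B) =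
   qpow ((sumn la)%:R * (r%:R - c%:R) / 2) *
     (schur_principal la r * pair_prod (weyl_factor [::]) r).
  by rewrite [in RHS]split => [|i _]; [ring | rewrite nth_nil].
rewrite e1 split // mulrA -qpowD.
(* Centring the exponents at (r-1)/2 instead of (c-1)/2 costs (r-c)/2 for each box. *)
have -> : (sumn la)%:R * (r%:R - c%:R) / 2 + principal_exp r la = principal_exp c (take c la).
  have -> : sumn la = (\sum_(i < c) nth 0%N la i)%N.
    rewrite sumnE (big_nth 0%N) hs (big_cat_nat (n := c)) //= big_mkord.
    rewrite [X in (_ + X)%N]big_nat_cond [X in (_ + X)%N]big1 ?addn0 //.
    by move=> i /andP [/andP [ci _] _]; rewrite h0.
  rewrite natr_sum -mulrA big_distrl /principal_exp.
  have -> : \sum_(i < r) (nth 0%N la i)%:R * (i%:R - (r%:R - 1) / 2) =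
     \sum_(i < c) (nth 0%N la i)%:R * (i%:R - (r%:R - 1) / 2) :> rat.
    rewrite -!(big_mkord predT (fun i => (nth 0%N la i)%:R * (i%:R - (r%:R - 1) / 2))).
    rewrite (big_cat_nat (n := c)) //= [X in _ + X]big_nat_cond [X in _ + X]big1 ?addr0 //.
    by move=> i /andP [/andP [ci _] _]; rewrite h0 // mul0r.
  by rewrite -big_split; apply: eq_bigr => i _ /=; rewrite nth_take //; field.
have -> : pair_prod (weyl_factor la) c = pair_prod (weyl_factor (take c la)) c.
  apply: eq_pair_prod => i j /andP [ij jc]; rewrite /weyl_factor !nth_take //.
  exact: ltn_trans ij jc.
rewrite mulrA -e2; ring.
Qed.

Lemma lowb_schur_principal m (la : seq nat) : size la = m -> sorted geq la ->
  lowb (principal_exp m la) (schur_principal la m).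
Proof.
move=> hs so.
have lw (mu : seq nat) : lowb 0 (pair_prod (weyl_factor mu) m).
  by apply: lowb_prod => j _; apply: lowb_prod => i _; apply: lowb_1subq.
have [u lu] : pair_prod (weyl_factor [::]) m \is a GRing.unit /\
    lowb 0 (pair_prod (weyl_factor [::]) m)^-1.
  rewrite /pair_prod; elim: (m) => [|k [IH1 IH2]].
    by rewrite big_geq // unitr1 invr1; split=> //; apply: lowb1.
  rewrite big_nat_recr //=.
  have [v lv] : \prod_(0 <= i < k) weyl_factor [::] i k \is a GRing.unit /\
     lowb 0 (\prod_(0 <= i < k) weyl_factor [::] i k)^-1.
    rewrite big_nat; elim/big_ind: _ => [|x y [hx lx] [hy ly]|i /andP [_ ik]].
    - by rewrite unitr1 invr1; split=> //; apply: lowb1.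
    - by rewrite unitrM hx hy invrM //; split=> //; apply: lowb0M.
    by rewrite /weyl_factor !nth_nil add0n subn0; apply: unit_1subq; rewrite subn_gt0.
  by rewrite unitrM IH1 v invrM //; split=> //; apply: lowb0M.
have -> : schur_principal la m = (pair_prod (weyl_factor [::]) m)^-1 *
    (pair_prod (weyl_factor la) m * qpow (principal_exp m la)).
  by rewrite [pair_prod (weyl_factor la) m * _]mulrC -schur_principalE // [X in _ * X]mulrC mulKr.
by apply: lowb0M => //; apply: lowb0M => //; apply: lowb_qpow.
Qed.

(** * Termwise limits *)

Section Tannery.
Variables (I : choiceType) (D : set I) (F : I -> qser) (low : I -> rat).
Hypothesis Flow : forall i, D i -> lowb (low i) (F i).
Hypothesis low_fin : forall e, finite_set [set i | D i /\ low i <= e].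

Lemma low_seq e : exists2 A : seq I, uniq A & forall i, (i \in A) <-> (D i /\ low i <= e).
Proof.
have /finite_seqP [s hs] := low_fin e; exists (undup s); first exact: undup_uniq.
move=> i; rewrite mem_undup.
have h : (D i /\ low i <= e) = (i \in s) := congr1 (fun X : set I => X i) hs.
by rewrite h.
Qed.

Lemma fsum_low (A : seq I) d e : uniq A -> (forall i, (i \in A) <-> (D i /\ low i <= e)) ->
  d <= e -> \sum_(i \in D) qcoef (F i) d = \sum_(i <- A) qcoef (F i) d.
Proof.
move=> uA hA de; rewrite (fsbigE A) //; last first.
  move=> i Di iA; rewrite Flow //; apply: le_lt_trans de _; rewrite ltNge.
  by apply/negP => h; move/negP: iA; apply; apply/hA.
by move=> i /hA [].
rewrite big_seq_cond [RHS]big_seq; apply: eq_bigl => i.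
by apply: andb_idr => /hA [Di _]; apply: mem_set.
Qed.

Lemma left_finite_fsum : left_finite (fun e => \sum_(i \in D) qcoef (F i) e).
Proof.
move=> e; have [A uA hA] := low_seq e.
apply: sub_finite_set (qser_lf (\sum_(i <- A) F i) e) => d /= [de nz]; split=> //.
by rewrite qcoef_sum -(fsum_low uA hA de).
Qed.

(** Left finiteness keeps [qsum] from its default value 0. *)
Lemma qcoef_qsum e : qcoef (qsum D F) e = \sum_(i \in D) qcoef (F i) e.
Proof. by rewrite /qsum; case: pselect => // h; case: h; apply: left_finite_fsum. Qed.

Variables (J : nat -> finType) (P : forall n, pred (J n)) (phi : forall n, J n -> I).
Variable (G : forall n, J n -> qser).
Hypothesis phiD : forall n (j : J n), P j -> D (phi j).
Hypothesis phi_inj : forall n (j k : J n), P j -> P k -> phi j = phi k -> j = k.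
Hypothesis G0 : forall n (j : J n), P j -> lowb 0 (G j).
Hypothesis phi_surj : forall i e, D i -> exists N, forall n, (N <= n)%N ->
  exists j : J n, [/\ P j, phi j = i & lowb e (1 - G j)].

(** Up to the exponent [e] only the finitely many [i] with low i <= e contribute. For large [n] all
    of these are indexed by [J n], with a factor [G] close enough to 1. *)
Lemma qcvg_qsum : qcvg (fun n => \sum_(j : J n | P j) F (phi j) * G j) (qsum D F).
Proof.
move=> e; have [A uA hA] := low_seq e.
(* As [F i] has order at least [low i], the precision e - low i + 1 pushes F i (1 - G j) beyond
   [e]. *)
have [N hN] : exists N, forall n i, (N <= n)%N -> i \in A ->
    exists j : J n, [/\ P j, phi j = i & lowb (e - low i + 1) (1 - G j)].
  have : forall i, i \in A -> D i by move=> i /hA [].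
  elim: (A) => [|i s IH] Ds; first by exists 0%N.
  have [|N1 h1] := IH; first by move=> k ks; apply: Ds; rewrite inE ks orbT.
  have [|N2 h2] := @phi_surj i (e - low i + 1); first by apply: Ds; rewrite mem_head.
  exists (maxn N1 N2) => n k; rewrite geq_max => /andP [n1 n2].
  by rewrite inE => /orP [/eqP -> |]; [apply: h2 | apply: h1].
exists N => n Nn; rewrite qcoef_qsum (fsum_low uA hA (lexx e)) qcoef_sum.
transitivity (\sum_(j : J n | P j) \sum_(i <- A | phi j == i) qcoef (F (phi j) * G j) e).
  apply: eq_bigr => j Pj; have [iA|iA] := boolP (phi j \in A).
    rewrite -big_filter (_ : [seq i <- A | phi j == i] = [:: phi j]) ?big_seq1 //.
    rewrite (eq_filter (a2 := pred1 (phi j))) => [|i]; last by rewrite /= eq_sym.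
    by rewrite filter_pred1_uniq.
  rewrite [RHS]big1_seq => [|i /andP [/eqP <- ]]; last by rewrite (negbTE iA).
  have := lowbM (Flow (phiD Pj)) (G0 Pj); apply; rewrite addr0 ltNge.
  by apply/negP => h; move/negP: iA; apply; apply/hA; split=> //; apply: phiD Pj.
rewrite (exchange_big_dep predT) //= big_seq [RHS]big_seq; apply: eq_bigr => i iA.
have [j [Pj pj gj]] := hN n i Nn iA.
rewrite (big_pred1 j); last first.
  move=> k /=; apply/andP/eqP => [[Pk /eqP pk]|->]; last by rewrite pj eqxx.
  by apply: phi_inj => //; rewrite pj.
have [Di _] := (hA i).1 iA.
rewrite pj; suff : qcoef (F i * G j - F i) e = 0.
  by rewrite qcoefB => /eqP; rewrite subr_eq0 => /eqP.
have -> : F i * G j - F i = - (F i * (1 - G j)) by ring.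
by apply: (lowbN (lowbM (Flow Di) gj)); lra.
Qed.

End Tannery.

(** * Partitions and weights of sl_c *)

(** Only trailing zeros can differ, but the cell types are then distinct and tableaux must be
    carried along an embedding. *)
Lemma kostka_le (la la' mu : seq nat) : (forall i, nth 0%N la i = nth 0%N la' i) ->
  (kostka la mu <= kostka la' mu)%N.
Proof.
move=> h.
have h' (y : cell la') : (ccol y < nth 0 la (crow y))%N by rewrite h (ccol_lt y).
pose emb (y : cell la') : cell la := cell_at (h' y).
have emb_inj : injective emb.
  by move=> y z e; apply: cell_inj; [apply: (congr1 (@crow la) e)|apply: (congr1 (@ccol la) e)].
have emb_surj (x : cell la) : exists y, x = emb y.
  have hx : (ccol x < nth 0 la' (crow x))%N by rewrite -h (ccol_lt x).
  by have [y [h1 h2]] := ex_cell hx; exists y; apply: cell_inj.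
pose pull (T : {ffun cell la -> 'I_(size mu)}) := [ffun y => T (emb y)].
have pull_inj : injective pull.
  move=> T T' e; apply/ffunP => x; have [y ->] := emb_surj x.
  by have /ffunP /(_ y) := e; rewrite !ffunE.
rewrite /kostka -(card_imset _ pull_inj).
apply: subset_leq_card; apply/subsetP => _ /imsetP [T + ->].
rewrite !inE => /andP [/ssytP [hr hc] /forallP hm]; apply/andP; split.
  apply/ssytP; split=> x y e l; rewrite !ffunE.
    exact: (hr (emb x) (emb y)).
  exact: (hc (emb x) (emb y)).
apply/forallP => i; rewrite -(eqP (hm i)); apply/eqP.
rewrite -(card_imset _ emb_inj); apply: eq_card => x; rewrite inE.
apply/imsetP/idP => [[y + ->]|hx]; first by rewrite inE ffunE.
by have [y e] := emb_surj x; exists y; rewrite // inE ffunE -e.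
Qed.

Lemma eq_kostka (la la' mu : seq nat) : (forall i, nth 0%N la i = nth 0%N la' i) ->
  kostka la mu = kostka la' mu.
Proof. by move=> h; apply/eqP; rewrite eqn_leq !kostka_le. Qed.

(** An entry in the row of index [size mu] would have to be at least [size mu]. *)
Lemma kostka_rows (la mu : seq nat) : sorted geq la -> (0 < nth 0 la (size mu))%N ->
  kostka la mu = 0%N.
Proof.
move=> so h; apply/eqP; rewrite cards_eq0; apply/eqP/setP => T; rewrite !inE.
apply/negbTE/andP => -[sT _]; have [x [rx _]] := ex_cell h.
by have := ssyt_row_le x so sT; rewrite rx leqNgt ltn_ord.
Qed.

Lemma kappaE (la : seq nat) :
  (kappa la)%:~R = \sum_(i < size la) (nth 0%N la i)%:R * ((nth 0%N la i)%:R - 1 - 2 * i%:R) :> rat.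
Proof.
rewrite /kappa rmorphM rmorph_sum big_distrr /=; apply: eq_bigr => i _.
elim: (nth 0%N la i) => [|k IH]; first by rewrite big_ord0 mulr0 mul0r.
move: IH; rewrite big_ord_recr /=; set S := \sum_(j < k) _; move=> IH.
by rewrite [(S + _)%:~R]intrD intrB (mulrDr 2%:~R) IH -natr1; ring.
Qed.

(** * Weights of sl_c in orthogonal coordinates *)

Section WeightPartition.
Variable c' : nat.
Notation c := c'.+1.

(** Coordinates of a weight in the standard basis, normalized by a zero in the last place. *)
Definition tail_sum (x : 'I_c' -> rat) (i : nat) : rat := \sum_(k < c' | (i <= k)%N) x k.

Lemma sum_tail_sum x : \sum_(i < c) tail_sum x i = \sum_k x k * k.+1%:R.
Proof.
rewrite /tail_sum (exchange_big_dep predT) //=; apply: eq_bigr => k _.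
rewrite sumr_const -(mulr_natr (x k)); congr (_ * _%:R).
have h : (k.+1 <= c)%N by rewrite ltnS ltnW.
by rewrite -[RHS](card_ord_lt_le h).
Qed.

Lemma sum_tail_sumM x y : \sum_(i < c) tail_sum x i * tail_sum y i =
  \sum_k \sum_l x k * y l * (minn k.+1 l.+1)%:R.
Proof.
transitivity (\sum_(i < c) \sum_(k < c' | (i <= k)%N) \sum_(l < c' | (i <= l)%N) x k * y l).
  by apply: eq_bigr => i _; rewrite /tail_sum big_distrl; apply: eq_bigr => k _; rewrite big_distrr.
rewrite (exchange_big_dep predT) //=; apply: eq_bigr => k _.
rewrite (exchange_big_dep predT) //=; apply: eq_bigr => l _.
rewrite sumr_const -(mulr_natr (x k * y l)); congr (_ * _%:R).
have h : (minn k.+1 l.+1 <= c)%N by rewrite geq_min ltnS ltnW.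
by rewrite -[RHS](card_ord_lt_le h); apply: eq_card => i; rewrite !inE leq_min.
Qed.

(** The form is the standard inner product after projection along (1, ..., 1): min(k, l) counts the
    rows that two fundamental weights share, and kl/c is the correction. *)
Lemma weight_formE (a b : weight c) :
  let X := tail_sum (fun k => (a 0 k)%:~R) in let Y := tail_sum (fun k => (b 0 k)%:~R) in
  weight_form a b = \sum_(i < c) X i * Y i - (\sum_(i < c) X i) * (\sum_(i < c) Y i) / c%:R.
Proof.
move=> X Y; rewrite sum_tail_sumM !sum_tail_sum /weight_form.
rewrite -mulrA big_distrl -sumrB; apply: eq_bigr => k _ /=.
rewrite mulr_suml mulr_sumr -sumrB; apply: eq_bigr => l _ /=; ring.
Qed.

Variable a : weight c.
Hypothesis da : dominant a.

Lemma size_wp : size (weight_partition a) = c.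
Proof. by rewrite size_mkseq. Qed.

Lemma nth_wp i : nth 0%N (weight_partition a) i = (\sum_(k < c' | (i <= k)%N) `|a 0%R k|)%N.
Proof.
have [h|h] := ltnP i c; first by rewrite nth_mkseq.
rewrite nth_default ?size_wp // big1 // => k ik.
by have := ltn_ord k; rewrite ltnNge (leq_trans (ltnW h) ik).
Qed.

Lemma wp_tail i : (nth 0%N (weight_partition a) i)%:R = tail_sum (fun k => (a 0 k)%:~R) i.
Proof.
rewrite nth_wp natr_sum; apply: eq_bigr => k _.
by rewrite -[in RHS](gez0_abs (da k)).
Qed.

Lemma wp_last i : (c' <= i)%N -> nth 0%N (weight_partition a) i = 0%N.
Proof.
by move=> h; rewrite nth_wp big1 // => k ik; have := ltn_ord k; rewrite ltnNge (leq_trans h ik).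
Qed.

Lemma wp_diff (k : 'I_c') :
  (nth 0%N (weight_partition a) k = nth 0%N (weight_partition a) k.+1 + `|a 0%R k|)%N.
Proof.
rewrite !nth_wp (bigD1 k) //= addnC; congr (_ + _)%N; apply: eq_bigl => j.
by rewrite ltn_neqAle andbC eq_sym.
Qed.

Lemma sorted_wp : sorted geq (weight_partition a).
Proof.
apply/(sortedP 0%N) => i; rewrite size_wp ltnS => h /=.
by rewrite (wp_diff (Ordinal h)) leq_addr.
Qed.

Lemma wp_shift (la : seq nat) : sorted geq la ->
  (forall k : 'I_c', a 0 k = (nth 0%N la k)%:Z - (nth 0%N la k.+1)%:Z) ->
  forall i, (i < c)%N -> nth 0%N la i = (nth 0%N (weight_partition a) i + nth 0%N la c')%N.
Proof.
move=> so h i; rewrite ltnS => hi; rewrite -(subKn hi).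
elim: (c' - i)%N (leq_subr i c') => [|j IH] hj; first by rewrite subn0 wp_last.
have jc : (c' - j.+1 < c')%N by rewrite ltn_subrL /=; apply: leq_trans hj.
have := IH (ltnW hj); have -> : (c' - j = (c' - j.+1).+1)%N by rewrite subnSK.
have := wp_diff (Ordinal jc); have := h (Ordinal jc); have /= := da (Ordinal jc).
by move=> h0 h1 /= -> h2; move: h0; rewrite h1; lia.
Qed.

Lemma delta_tail i : (i <= c')%N ->
  tail_sum (fun k => ((a + 2 *: weyl_vector c) 0 k)%:~R) i =
  (nth 0%N (weight_partition a) i)%:R + 2 * (c'%:R - i%:R).
Proof.
move=> ic; rewrite wp_tail /tail_sum.
under eq_bigr => k _ do rewrite !mxE rmorphD /=.
rewrite big_split /=; congr (_ + _).
rewrite sumr_const -(mulr_natr (2 * 1)%:~R) -natrB //; congr (_ * _%:R).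
have := cardC [pred k : 'I_c' | (k < i)%N]; rewrite (card_ord_lt_le ic) card_ord.
rewrite (eq_card (A := [predC _]) (B := [pred k : 'I_c' | (i <= k)%N])) => [|k].
  have e X Y Z : (Z + X)%N = Y -> X = (Y - Z)%N by lia.
  exact: e.
by rewrite !inE -leqNgt.
Qed.

Lemma weight_form_delta (A := fun i => (nth 0%N (weight_partition a) i)%:R : rat) :
  weight_form a (a + 2 *: weyl_vector c) =
  \sum_(i < c) A i ^+ 2 - (\sum_(i < c) A i) ^+ 2 / c%:R + c'%:R * (\sum_(i < c) A i)
    - 2 * \sum_(i < c) A i * i%:R.
Proof.
rewrite weight_formE /=.
have e i : (i < c)%N -> tail_sum (fun k => ((a + 2 *: weyl_vector c) 0 k)%:~R) i =
   A i + 2 * (c'%:R - i%:R) by rewrite ltnS; apply: delta_tail.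
under eq_bigr => i _ do rewrite -wp_tail e // -/(A i) mulrDr.
under [X in _ - X * _ / _]eq_bigr => i _ do rewrite -wp_tail -/(A i).
under [X in _ - _ * X / _]eq_bigr => i _ do rewrite e //.
rewrite !big_split /= -big_distrr /= sumrB sumr_const card_ord.
have -> : \sum_(i < c) i%:R = c%:R * c'%:R / 2 :> rat.
  elim: (c') => [|k IH]; first by rewrite big_ord_recr big_ord0 /= mulr0 mul0r.
  by rewrite big_ord_recr IH /= -!natr1; field.
have -> : \sum_(i < c) A i * (2 * (c'%:R - i%:R)) =
   2 * c'%:R * (\sum_(i < c) A i) - 2 * \sum_(i < c) A i * i%:R.
  by rewrite !big_distrr -sumrB; apply: eq_bigr => i _ /=; ring.
have -> : \sum_(i < c) A i * A i = \sum_(i < c) A i ^+ 2.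
  by apply: eq_bigr => i _; rewrite expr2.
rewrite -(mulr_natr c'%:R) -!natr1.
have c0 : c'%:R + 1 != 0 :> rat by rewrite natr1 pnatr_eq0.
by field; rewrite natr1 pnatr_eq0.
Qed.

End WeightPartition.

Lemma sum_pick (R : pzRingType) n (F : nat -> R) m :
  \sum_(j < n) F j * (j == m :> nat)%:R = if (m < n)%N then F m else 0.
Proof.
case: ltnP => h; last first.
  rewrite big1 // => j _; rewrite (_ : (j == m :> nat) = false) ?mulr0 //.
  by apply/eqP => e; have := ltn_ord j; rewrite e ltnNge h.
rewrite (bigD1 (Ordinal h)) //= eqxx mulr1 big1 ?addr0 // => j.
by rewrite -val_eqE /= => /negbTE ->; rewrite mulr0.
Qed.

(** * The root lattice as a condition on the size of the partition *)

Section RootLattice.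
Variable c' : nat.
Notation c := c'.+1.

(** Extended by 0 at both ends, the coefficients on the simple roots see the Cartan matrix as minus
    a discrete second difference, with no boundary cases. *)
Lemma cartan_mul (f : nat -> int) (k : 'I_c') : f 0%N = 0 -> f c = 0 ->
  \sum_(j < c') f j.+1 * cartan c j k = 2 * f k.+1 - f k - f k.+2.
Proof.
move=> f0 fc.
transitivity (\sum_(j < c') (2 * (f j.+1 * (j == k :> nat)%:R) -
   (f j.+1 * (j.+1 == k :> nat)%:R) - (f j.+1 * (j == k.+1 :> nat)%:R))).
  apply: eq_bigr => j _; rewrite mxE -val_eqE /= [k.+1 == j :> nat]eq_sym.
  have [->|jk] := eqVneq (j : nat) (k : nat).
    by rewrite (gtn_eqF (ltnSn k)) (ltn_eqF (ltnSn k)) mulr1 !mulr0 !subr0 mulrC.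
  have [<-|jk1] := eqVneq j.+1 (k : nat).
    by rewrite (ltn_eqF (ltnW (ltnSn j.+1))) /= !mulr0 mulr1 subr0 sub0r mulrN1.
  have [_|_] := eqVneq (j : nat) k.+1; rewrite /= !mulr0 !subr0 ?mulr1 ?mulr0 ?subr0 //.
  by rewrite sub0r mulrN1.
rewrite !sumrB -mulr_sumr (sum_pick c' (fun j => f j.+1) k) ltn_ord.
rewrite (sum_pick c' (fun j => f j.+1) k.+1).
have -> : \sum_(j < c') f j.+1 * (j.+1 == k :> nat)%:R = f k.
  case: k => [[|k] hk] /=.
    by rewrite f0 big1 // => j _; rewrite mulr0.
  have := sum_pick c' (fun j => f j.+1) k; rewrite (ltnW hk) => <-.
  by apply: eq_bigr => j _; rewrite eqSS.
case: ltnP => // hk; have -> : k.+2 = c by have := ltn_ord k; lia.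
by rewrite fc.
Qed.

(** The coefficients are the partial sums of la_i - n, which return to 0 at [c] because the size is
    n c. *)
Lemma diff_in_root_lattice (la : nat -> nat) n (a : weight c) :
  (\sum_(i < c) la i = n * c)%N ->
  (forall k : 'I_c', a 0 k = (la k)%:Z - (la k.+1)%:Z) -> in_root_lattice a.
Proof.
move=> hsum ha; pose f t : int := \sum_(i < t) ((la i)%:Z - n%:Z).
exists (\row_k f k.+1); apply/rowP => k; rewrite mxE; under eq_bigr => j _ do rewrite mxE.
have f0 : f 0%N = 0 by rewrite /f big_ord0.
have fc : f c = 0.
  have e : \sum_(i < c) (la i)%:Z = (n * c)%N%:Z.
    by rewrite -hsum -[RHS]natz natr_sum; apply: eq_bigr => i _; rewrite natz.
  by rewrite /f sumrB sumr_const card_ord e -(mulr_natr n%:Z) natz PoszM subrr.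
rewrite (cartan_mul (f := f)) //; first by rewrite ha /f !big_ord_recr /=; ring.
Qed.

(** The size is the sum of (k+1) a_k, and summing the second differences by parts leaves [c] times
    the last coefficient. *)
Lemma root_lattice_sum (a : weight c) : dominant a -> in_root_lattice a ->
  exists m, (\sum_(i < c) nth 0%N (weight_partition a) i = m * c)%N.
Proof.
move=> da [b hb].
pose f t : int := if t is s.+1 then (if insub s is Some j then b 0 j else 0) else 0.
have fE (j : 'I_c') : f j.+1 = b 0 j by rewrite /f valK.
have fc : f c = 0 by rewrite /f insubF // ltnn.
have ak (k : 'I_c') : a 0 k = 2 * f k.+1 - f k - f k.+2.
  rewrite -cartan_mul // hb mxE; apply: eq_bigr => j _; by rewrite fE.
have tel n : \sum_(k < n) k.+1%:Z * (2 * f k.+1 - f k - f k.+2) =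
    n.+1%:Z * f n - n%:Z * f n.+1.
  elim: n => [|n IH]; first by rewrite big_ord0 /= mul0r mulr0.
  by rewrite big_ord_recr IH /= -!natz -!natr1; ring.
have e : (\sum_(i < c) nth 0%N (weight_partition a) i)%N%:Z = c%:Z * f c'.
  apply: (@intr_inj rat); rewrite -[LHS]/((_)%:R) natr_sum.
  rewrite (eq_bigr (fun i : 'I_c => tail_sum (fun k => (a 0 k)%:~R) i)); last first.
    by move=> i _; rewrite wp_tail.
  rewrite sum_tail_sum; have := tel c'; rewrite fc mulr0 subr0 => <-.
  rewrite rmorph_sum; apply: eq_bigr => k _ /=.
  by rewrite ak intrM mulrC.
have fge : 0 <= f c'.
  by rewrite -(@pmulr_rge0 _ c%:Z) // -e.
by exists `|f c'|%N; apply/eqP; rewrite -eqz_nat e PoszM gez0_abs // mulrC.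
Qed.

End RootLattice.

(** * Lower bound for the exponents of the singlet summands *)

Section LowExponent.
Variable c' : nat.
Notation c := c'.+1.

Lemma sum_ord_half n : \sum_(i < n.+1) i%:R = n.+1%:R * n%:R / 2 :> rat.
Proof.
elim: n => [|k IH]; first by rewrite big_ord_recr big_ord0 /= mulr0 mul0r.
by rewrite big_ord_recr IH /= -!natr1; field.
Qed.

Lemma principal_expE (la : seq nat) : principal_exp c la =
  \sum_(i < c) (nth 0%N la i)%:R * i%:R - (\sum_(i < c) (nth 0%N la i)%:R) * (c'%:R / 2).
Proof.
rewrite /principal_exp big_distrl -sumrB; apply: eq_bigr => i _ /=.
by rewrite -(natr1 c') addrK mulrBr.
Qed.

(** Chebyshev's sum inequality: the rows decrease while their indices increase, so every term of the
    double sum is nonnegative. *)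
Lemma principal_exp_le0 (la : seq nat) : sorted geq la -> principal_exp c la <= 0.
Proof.
move=> so; pose A i : rat := (nth 0%N la i)%:R.
have e : \sum_(i < c) \sum_(j < c) (A i - A j) * (j%:R - i%:R) = - (2 * c%:R) * principal_exp c la.
  transitivity (\sum_(i < c) (A i * (c%:R * c'%:R / 2) - c%:R * (A i * i%:R) -
      (\sum_(j < c) A j * j%:R) + (\sum_(j < c) A j) * i%:R)).
    apply: eq_bigr => i _.
    have -> : A i * (c%:R * c'%:R / 2) = \sum_(j < c) A i * j%:R.
      by rewrite -sum_ord_half big_distrr.
    have -> : (\sum_(j < c) A j) * i%:R = \sum_(j < c) A j * i%:R by rewrite big_distrl.
    have -> : c%:R * (A i * i%:R) = \sum_(j < c) A i * i%:R.
      by rewrite sumr_const card_ord mulr_natl.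
    by rewrite -!sumrB -big_split; apply: eq_bigr => j _ /=; ring.
  rewrite big_split /= !sumrB -!big_distrl -!big_distrr /= sum_ord_half sumr_const card_ord.
  by rewrite -(mulr_natr (\sum_(j < c) A j * j%:R)) principal_expE -!/(A _); field.
have : 0 <= - (2 * c%:R) * principal_exp c la.
  rewrite -e; apply: sumr_ge0 => i _; apply: sumr_ge0 => j _.
  case: (leqP i j) => ij.
    by rewrite mulr_ge0 // subr_ge0 ?ler_nat // nth_sorted_geq.
  by rewrite mulr_le0 // subr_le0 ler_nat ?nth_sorted_geq // ltnW.
by rewrite mulNr oppr_ge0 pmulr_rle0 // mulr_gt0 // ltr0n.
Qed.

(** The squared norm (a, a), computed from the partition centred at its mean. *)
Definition low_exp (a : weight c) : rat :=
  let A i := (nth 0%N (weight_partition a) i)%:R in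
  \sum_(i < c) (A i - (\sum_(j < c) A j) / c%:R) ^+ 2.

Lemma weight_form_low (a : weight c) : dominant a ->
  weight_form a (a + 2 *: weyl_vector c) =
  low_exp a - 2 * principal_exp c (weight_partition a).
Proof.
move=> da; rewrite weight_form_delta // /low_exp principal_expE.
set A := fun i => (nth 0%N (weight_partition a) i)%:R : rat.
set S := \sum_(j < c) (nth 0%N (weight_partition a) j)%:R.
have -> : \sum_(i < c) ((nth 0%N (weight_partition a) i)%:R - S / c%:R) ^+ 2 =
    \sum_(i < c) A i ^+ 2 - S ^+ 2 / c%:R.
  transitivity (\sum_(i < c) (A i ^+ 2 - A i * (2 * (S / c%:R)) + (S / c%:R) ^+ 2)).
    by apply: eq_bigr => i _; rewrite -/(A i); ring.
  rewrite big_split sumrB -big_distrl /= sumr_const card_ord -/S -(mulr_natr ((S / c%:R) ^+ 2)).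
  by field; rewrite nat1r pnatr_eq0.
by rewrite -/S; field; rewrite nat1r pnatr_eq0.
Qed.

Lemma low_exp_ge0 a : 0 <= low_exp a.
Proof. by apply: sumr_ge0 => i _; apply: sqr_ge0. Qed.

Lemma low_exp_bound a : (nth 0%N (weight_partition a) 0)%:R <= low_exp a + 1.
Proof.
rewrite /low_exp; set m := _ / c%:R.
case: (posnP c') => [c0|c0].
  rewrite wp_last ?c0 // addr_ge0 // sumr_ge0 // => i _; exact: sqr_ge0.
rewrite (bigD1 ord0) //= (bigD1 ord_max) /=; last by rewrite -val_eqE /= -lt0n.
rewrite (wp_last a (leqnn c')).
set R := \sum_(i < c | _) _; have hR : 0 <= R by apply: sumr_ge0 => i _; apply: sqr_ge0.
set x := (nth 0%N (weight_partition a) (@ord0 c'))%:R; rewrite -[X in X <= _]/x sub0r sqrrN.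
(* The inequality t^2 >= t - 1/4 at t = x - m and at t = m bounds the first row [x]; the last row is
   0. *)
have := sqr_ge0 (x - m - 2^-1); have := sqr_ge0 (m - 2^-1); rewrite !expr2.
clearbody R x m; nra.
Qed.

Lemma low_exp_finite (D : set (weight c)) e : (forall a, D a -> dominant a) ->
  finite_set [set a | D a /\ low_exp a <= e].
Proof.
move=> hD; have [B hB] := ex_nat_gt (e + 1).
pose g (f : {ffun 'I_c' -> 'I_B.+1}) : weight c := \row_k (f k)%:Z.
apply: (@sub_finite_set _ _ (g @` [set: {ffun 'I_c' -> 'I_B.+1}])) => [a [/hD da le]|]; last first.
  by apply: finite_image; apply: finite_finset.
have h (k : 'I_c') : (`|a 0%R k| <= B)%N.
  have h1 : (`|a 0%R k| <= nth 0 (weight_partition a) 0)%N.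
    by rewrite nth_wp (bigD1 k) //= leq_addr.
  apply: leq_trans h1 _; rewrite -(ler_nat rat); apply: le_trans (low_exp_bound a) _.
  by apply: le_trans (ltW hB); rewrite lerD2r.
exists [ffun k => inord `|a 0%R k|%N] => //.
apply/rowP => k; rewrite mxE ffunE inordK ?ltnS // gez0_abs //; exact: da.
Qed.

End LowExponent.

(** * The limit of the torus link invariants *)

Lemma lowb_1subprod (I : Type) (s : seq I) (P : pred I) (F : I -> qser) e : 0 <= e ->
  (forall i, P i -> lowb e (1 - F i)) -> lowb e (1 - \prod_(i <- s | P i) F i).
Proof.
move=> e0 h; elim/big_rec: _ => [|i x Pi hx]; first by rewrite subrr.
have -> : 1 - F i * x = (1 - F i) + F i * (1 - x) by ring.
apply: lowbD; first exact: h.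
apply: lowb0M => //; have -> : F i = 1 - (1 - F i) by ring.
by apply: lowbD; [apply: lowb1 | apply/lowbN/(lowb_le (h i Pi))].
Qed.

(** * A single summand: partitions of n c with at most c rows *)

Section TruncatedPartition.
Variables (r c' n : nat) (la : seq nat).
Notation c := c'.+1.
Hypotheses (hrc : (c <= r)%N) (hs : size la = r) (so : sorted geq la).
Hypotheses (sm : sumn la = (n * c)%N) (hc0 : nth 0%N la c = 0%N).

Lemma nth_ge_eq0 i : (c <= i)%N -> nth 0%N la i = 0%N.
Proof. by move=> ci; have := nth_sorted_geq so ci; rewrite hc0 leqn0 => /eqP. Qed.

Lemma sum_first : (\sum_(i < c) nth 0%N la i)%N = (n * c)%N.
Proof.
rewrite -sm sumnE (big_nth 0%N) hs (big_cat_nat (leq0n c) hrc) /= big_mkord.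
rewrite [X in (_ + X)%N]big_nat [X in (_ + X)%N]big1 ?addn0 // => i /andP [ci _].
exact: nth_ge_eq0.
Qed.

Definition row_diff : weight c := \row_(k < c') ((nth 0%N la k)%:Z - (nth 0%N la k.+1)%:Z).

Lemma row_diffE (k : 'I_c') : row_diff 0 k = (nth 0%N la k)%:Z - (nth 0%N la k.+1)%:Z.
Proof. by rewrite mxE. Qed.

Lemma row_diff_dominant : dominant row_diff.
Proof. by move=> k; rewrite row_diffE subr_ge0 lez_nat nth_sorted_geq. Qed.

Lemma row_diff_root_lattice : in_root_lattice row_diff.
Proof. exact: diff_in_root_lattice sum_first row_diffE. Qed.

Lemma row_diff_shift i : (i < c)%N ->
  nth 0%N la i = (nth 0%N (weight_partition row_diff) i + nth 0%N la c')%N.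
Proof. exact: wp_shift row_diff_dominant _ so row_diffE i. Qed.

(** Everything is expressed through the rows [A] with last row 0 and the number [s] of full columns;
    [n] is the mean of the [c] rows. *)
Lemma kappa_weight_form : (kappa la)%:~R =
  n%:R ^+ 2 * c%:R - n%:R * c%:R ^+ 2 + weight_form row_diff (row_diff + 2 *: weyl_vector c).
Proof.
rewrite kappaE hs weight_form_delta; last exact: row_diff_dominant.
set A := fun i : nat => (nth 0%N (weight_partition row_diff) i)%:R : rat.
pose s : rat := (nth 0%N la c')%:R.
have laE i : (i < c)%N -> (nth 0%N la i)%:R = A i + s by move=> ic; rewrite row_diff_shift // natrD.
have -> : \sum_(i < r) (nth 0%N la i)%:R * ((nth 0%N la i)%:R - 1 - 2 * i%:R) =
    \sum_(i < c) (A i + s) * (A i + s - 1 - 2 * i%:R).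
  rewrite -(big_mkord predT (fun i => (nth 0%N la i)%:R * ((nth 0%N la i)%:R - 1 - 2 * i%:R))).
  rewrite (big_cat_nat (leq0n c) hrc) /= big_mkord [X in _ + X]big_nat [X in _ + X]big1 ?addr0.
    by apply: eq_bigr => i _; rewrite laE.
  by move=> i /andP [ci _]; rewrite nth_ge_eq0 // mul0r.
have e1 : n%:R * c%:R = \sum_(i < c) A i + c%:R * s.
  rewrite -natrM -sum_first natr_sum.
  rewrite (eq_bigr (fun i : 'I_c => A i + s)) => [|i _]; last by rewrite laE.
  by rewrite big_split sumr_const card_ord mulr_natl.
have c0 : c%:R != 0 :> rat by rewrite pnatr_eq0.
have -> : n%:R = (\sum_(i < c) A i) / c%:R + s.
  by apply: (mulIf c0); rewrite e1 mulrDl divfK // [s * _]mulrC.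
have -> : \sum_(i < c) (A i + s) * (A i + s - 1 - 2 * i%:R) =
   \sum_(i < c) A i ^+ 2 + (2 * s - 1) * (\sum_(i < c) A i) - 2 * (\sum_(i < c) A i * i%:R) +
   c%:R * (s ^+ 2 - s) - 2 * s * \sum_(i < c) i%:R.
  have -> : c%:R * (s ^+ 2 - s) = \sum_(i < c) (s ^+ 2 - s).
    by rewrite sumr_const card_ord mulr_natl.
  rewrite !big_distrr -big_split -sumrB -big_split -sumrB.
  by apply: eq_bigr => i _ /=; ring.
by rewrite sum_ord_half -(natr1 c'); field; rewrite natr1 pnatr_eq0.
Qed.

Lemma take_facts : [/\ size (take c la) = c, sorted geq (take c la), sumn (take c la) = (n * c)%N &
  forall i, nth 0%N (take c la) i = nth 0%N la i].
Proof.
have e i : nth 0%N (take c la) i = nth 0%N la i.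
  have [h|h] := ltnP i c; first by rewrite nth_take.
  by rewrite nth_ge_eq0 // nth_default // size_take_min hs; apply: leq_trans h; apply: geq_minl.
have sz : size (take c la) = c by rewrite size_take_min hs; apply/minn_idPl.
split=> //; first exact: take_sorted.
rewrite -sum_first sumnE (big_nth 0%N) sz big_mkord; apply: eq_bigr => i _; exact: e.
Qed.

Lemma kostka_dim (K : numFieldType) (L : sl_module K c) : is_irr_module L row_diff ->
  kostka la (nseq c n) = \dim (zero_weight_space L).
Proof.
move=> hL; have [h1 h2 h3 h4] := take_facts.
rewrite (dim_zero_weight h1 h2 h3 _ hL) => [|k]; last by rewrite row_diffE !h4.
by apply: eq_kostka => i; rewrite h4.
Qed.

Lemma principal_row_diff :
  qpow ((n * c)%N%:R * (r%:R - c%:R) / 2) * schur_principal la r * mixed_prod [::] c r =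
    schur_principal (weight_partition row_diff) c * mixed_prod la c r.
Proof.
have [h1 h2 h3 h4] := take_facts.
rewrite -sm principal_truncate //; last exact: nth_ge_eq0.
congr (_ * _); apply: (@principal_shift c (nth 0%N la c')) => //.
- exact: size_wp.
- exact: sorted_wp.
- by move=> i ic; rewrite h4 row_diff_shift.
Qed.

End TruncatedPartition.

(** * Passage to the limit *)

Section Limit.
Variables (K : numClosedFieldType) (r c' p : nat).
Notation c := c'.+1.
Hypotheses (hrc : (c <= r)%N) (hp : (2 <= p)%N).
Variable L : weight c -> sl_module K c.
Hypothesis hL : forall la : weight c, dominant la -> is_irr_module (L la) la.

Let D : set (weight c) := [set la : weight c | in_root_lattice la /\ dominant la].

Let F (la : weight c) : qser := (\dim (zero_weight_space (L la)))%:R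
  * qpow (p%:R / 2 * weight_form la (la + 2 *: weyl_vector c))
  * schur_principal (weight_partition la) c.

Let norm n : rat := p%:R / 2 * (- (n%:R ^+ 2 * c%:R) + n%:R * c%:R ^+ 2)
             + n%:R * c%:R * (r%:R - c%:R) / 2.

Let J n : finType := r.-tuple 'I_(n * c).+1.
Let rows n (t : J n) : seq nat := map val t.
(** Adds to the partition condition that there are at most [c] rows; for r = c the default value of
    [nth] makes this automatic. *)
Let P n (t : J n) : bool := is_partition (rows t) (n * c) && (nth 0%N (rows t) c == 0%N).

Lemma size_rows n (t : J n) : size (rows t) = r.
Proof. by rewrite size_map size_tuple. Qed.

Lemma rowsP n (t : J n) : P t ->
  [/\ sorted geq (rows t), sumn (rows t) = (n * c)%N & nth 0%N (rows t) c = 0%N].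
Proof. by move=> /andP [/andP [h1 /eqP h2] /eqP h3]. Qed.

Let phi n (t : J n) : weight c := row_diff c' (rows t).

Lemma low_F a : D a -> lowb (low_exp a) (F a).
Proof.
move=> [_ da]; have pe := principal_exp_le0 c' (sorted_wp a); have l0 := low_exp_ge0 a.
have p2 : 2 <= p%:R :> rat by rewrite ler_nat.
apply: (@lowb_le (0 + p%:R / 2 * weight_form a (a + 2 *: weyl_vector c) +
    principal_exp c (weight_partition a))).
  apply: lowbM; [apply: lowbM; [exact: lowb_nat | exact: lowb_qpow] |].
  by apply: lowb_schur_principal; [exact: size_wp | exact: sorted_wp].
rewrite weight_form_low // add0r.
(* With y <= 0 for [principal_exp] and z for [p], the claim x <= (z/2) (x - 2 y) + y follows from z
   >= 2. *)
move: (low_exp a) (principal_exp _ _) p%:R l0 pe p2 => x y z x0 y0 z2.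
have := mulr_ge0 x0 (_ : 0 <= z - 2); rewrite subr_ge0 => /(_ z2).
have := mulr_le0_ge0 y0 (_ : 0 <= z - 2); rewrite subr_ge0 => /(_ z2).
by lra.
Qed.

Lemma torus_summand n (t : J n) : P t ->
  mixed_prod [::] c r * (qpow (norm n) * ((kostka (rows t) (nseq c n))%:R *
    qpow (p%:R / 2 * (kappa (rows t))%:~R) * schur_principal (rows t) r)) =
  F (phi t) * mixed_prod (rows t) c r.
Proof.
move=> /rowsP [so sm h0]; have hs := size_rows t.
rewrite (kostka_dim hrc hs so sm h0 (hL (@row_diff_dominant c' _ so))).
have := principal_row_diff hrc hs so sm h0 => e.
rewrite /F -[RHS]mulrA -e /norm (kappa_weight_form hrc hs so sm h0) -/(phi t) natrM.
set W := weight_form _ _; set d := (\dim _)%:R.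
have -> : qpow (p%:R / 2 * W) = qpow (p%:R / 2 * (- (n%:R ^+ 2 * c%:R) + n%:R * c%:R ^+ 2)) *
    qpow (p%:R / 2 * (n%:R ^+ 2 * c%:R - n%:R * c%:R ^+ 2 + W)).
  by rewrite -qpowD; congr qpow; ring.
rewrite qpowD; ring.
Qed.

Lemma torus_sum n : mixed_prod [::] c r * (qpow (norm n) * torus_link_inv r c p n) =
  \sum_(t : J n | P t) F (phi t) * mixed_prod (rows t) c r.
Proof.
rewrite /torus_link_inv !big_distrr /= (bigID (fun t : J n => nth 0%N (rows t) c == 0%N)) /=.
rewrite [X in _ + X]big1 ?addr0; first by apply: eq_bigr => t /torus_summand.
move=> t /andP [/andP [so _] h]; rewrite kostka_rows ?size_nseq ?lt0n //.
  by rewrite mulr0n !mul0r !mulr0.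
by rewrite /= size_nseq.
Qed.

Lemma phi_in_D n (t : J n) : P t -> D (phi t).
Proof.
move=> /rowsP [so sm h0]; split; last exact: row_diff_dominant.
exact: row_diff_root_lattice hrc (size_rows t) so sm h0.
Qed.

(** The differences fix the rows up to full columns, whose number is fixed by the total size. *)
Lemma phi_inj n (t u : J n) : P t -> P u -> phi t = phi u -> t = u.
Proof.
move=> /rowsP [so sm h0] /rowsP [so' sm' h0'] e.
have s1 := sum_first hrc (size_rows t) so sm h0.
have s2 := sum_first hrc (size_rows u) so' sm' h0'.
have e1 i : (i < c)%N -> nth 0%N (rows t) i =
    (nth 0%N (weight_partition (phi t)) i + nth 0%N (rows t) c')%N.
  exact: row_diff_shift.
have e2 i : (i < c)%N -> nth 0%N (rows u) i =
    (nth 0%N (weight_partition (phi t)) i + nth 0%N (rows u) c')%N.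
  by rewrite e; apply: row_diff_shift.
have el : nth 0%N (rows t) c' = nth 0%N (rows u) c'.
  have : (\sum_(i < c) (nth 0%N (weight_partition (phi t)) i + nth 0%N (rows t) c') =
      \sum_(i < c) (nth 0%N (weight_partition (phi t)) i + nth 0%N (rows u) c'))%N.
    rewrite -(eq_bigr _ (fun (i : 'I_c) _ => e1 i (ltn_ord i))).
    by rewrite -(eq_bigr _ (fun (i : 'I_c) _ => e2 i (ltn_ord i))) s1 s2.
  rewrite !big_split /= !sum_nat_const card_ord => /addnI /eqP.
  by rewrite eqn_pmul2l // => /eqP.
apply/val_inj/(inj_map val_inj); apply: (@eq_from_nth _ 0%N (rows t) (rows u)) => [|i _].
  by rewrite !size_rows.
have [ic|ic] := ltnP i c; first by rewrite (e1 i ic) (e2 i ic) el.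
by rewrite (nth_ge_eq0 so h0 ic) (nth_ge_eq0 so' h0' ic).
Qed.

Lemma phi_surj a e : D a -> exists N, forall n, (N <= n)%N ->
  exists t : J n, [/\ P t, phi t = a & lowb e (1 - mixed_prod (rows t) c r)].
Proof.
move=> [ra da]; have [m hm] := root_lattice_sum da ra; have [B hB] := ex_nat_gt e.
(* [m] makes room for the n - m full columns to be added, and [B] brings the exponents in
   [mixed_prod] above [e]. *)
exists (m + B)%N => n hn.
pose w i := nth 0%N (weight_partition a) i.
pose l i := if (i < c)%N then (w i + (n - m))%N else 0%N.
have suml : (\sum_(i < c) l i = n * c)%N.
  rewrite (eq_bigr (fun i : 'I_c => w i + (n - m))%N) => [|i _]; last by rewrite /l ltn_ord.
  rewrite big_split /= hm sum_nat_const card_ord; have : (m <= n)%N by lia.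
  by move=> mn; rewrite mulnC -mulnDr subnKC // mulnC.
have lb i : (l i < (n * c).+1)%N.
  rewrite ltnS; have [ic|ic] := ltnP i c; last by rewrite /l ltnNge ic.
  by rewrite -suml (bigD1 (Ordinal ic)) //= leq_addr.
pose t : J n := [tuple Ordinal (lb i) | i < r].
have nt i : nth 0%N (rows t) i = l i.
  have [ir|ir] := ltnP i r; last first.
    by rewrite nth_default ?size_rows // /l ltnNge (leq_trans hrc ir).
  rewrite /rows (nth_map (Ordinal (lb 0%N))) ?size_tuple //.
  by rewrite -[i]/(nat_of_ord (Ordinal ir)) -tnth_nth tnth_mktuple.
have sl : sorted geq (rows t).
  apply/(sortedP 0%N) => i _ /=; rewrite !nt /l; case: ltnP => // ic.
  by rewrite (ltnW ic) leq_add2r; apply: nth_sorted_geq (leqnSn i); apply: sorted_wp.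
have sn : sumn (rows t) = (n * c)%N.
  rewrite sumnE (big_nth 0%N) size_rows (big_cat_nat (leq0n c) hrc) /= big_mkord.
  rewrite [X in (_ + X)%N]big_nat [X in (_ + X)%N]big1 ?addn0 => [|i /andP [ci _]].
    by rewrite -suml; apply: eq_bigr => i _; rewrite nt.
  by rewrite nt /l ltnNge ci.
exists t; split.
- by rewrite /P /is_partition sl sn eqxx nt /l ltnn eqxx.
- apply/rowP => k; rewrite row_diffE !nt /l ltnS (ltnW (ltn_ord k)) ltnS ltn_ord.
  rewrite /w (wp_diff a k); have := da k; move: (a 0 k) => x; lia.
apply: (@lowb_le B%:R); last exact: ltW.
rewrite /mixed_prod big_nat; apply: lowb_1subprod => // i /andP [_ ic].
rewrite big_nat; apply: lowb_1subprod => // j _.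
rewrite opprB addrC subrK qpow_nat nt /l ic; apply: lowb_le (@lowb_qpow _) _.
by rewrite ler_nat; lia.
Qed.

Theorem torus_limit :
  qcvg (fun n => qpow (norm n) * torus_link_inv r c p n) ((mixed_prod [::] c r)^-1 * qsum D F).
Proof.
have uM : mixed_prod [::] c r \is a GRing.unit.
  rewrite /mixed_prod big_nat; apply: rpred_prod => i /andP [_ ic].
  rewrite big_nat; apply: rpred_prod => j /andP [cj _].
  by apply: (proj1 (unit_1subq _)); rewrite nth_nil add0n subn_gt0 (leq_trans ic).
have G0 n (t : J n) : P t -> lowb 0 (mixed_prod (rows t) c r).
  by move=> _; apply: lowb_prod => i _; apply: lowb_prod => j _; apply: lowb_1subq.
have h := qcvg_qsum low_F (fun e => low_exp_finite e (D := D) (fun a ha => proj2 ha))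
  phi_in_D phi_inj G0 phi_surj.
have -> : (fun n => qpow (norm n) * torus_link_inv r c p n) =
    (fun n => (mixed_prod [::] c r)^-1 *
      \sum_(t : J n | P t) F (phi t) * mixed_prod (rows t) c r).
  by apply: funext => n; rewrite -torus_sum mulKr.
apply: (@qcvgM _ _ _ 0 _ h) => n d d0.
rewrite qcoef_sum big1 // => t Pt.
have := lowbM (low_F (phi_in_D Pt)) (G0 n t Pt); apply; rewrite addr0.
exact: lt_le_trans d0 (low_exp_ge0 _).
Qed.
End Limit.

Theorem theorem4 (K : numClosedFieldType) (r c p : nat)
  (hrc : (c <= r)%N) (hc : (2 <= c)%N) (hp : (2 <= p)%N)
  (L : weight c -> sl_module K c)
  (hL : forall la : weight c, dominant la -> is_irr_module (L la) la) :
  qcvg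
    (fun n : nat =>
       qpow (p%:R / 2 * (- (n%:R ^+ 2 * c%:R) + n%:R * c%:R ^+ 2)
             + n%:R * c%:R * (r%:R - c%:R) / 2)
       * torus_link_inv r c p n)
    ((\prod_(1 <= i < c.+1) \prod_(c.+1 <= j < r.+1) (1 - q ^+ (j - i)))^-1
     * (qinfty ^+ c.-1
        / \prod_(1 <= i < c.+1) \prod_(i.+1 <= j < c.+1) (1 - q ^+ (j - i)))
     * singlet_char p L).
Proof.
case: c hrc hc L hL => [//|c'] hrc hc L hL.
have -> : \prod_(1 <= i < c'.+2) \prod_(c'.+2 <= j < r.+1) (1 - q ^+ (j - i)) =
    mixed_prod [::] c'.+1 r.
  rewrite big_add1 /mixed_prod; apply: eq_bigr => i _.
  rewrite big_add1; apply: eq_bigr => j _.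
  by rewrite nth_nil add0n subSS.
rewrite /singlet_char; set Delta := \prod_(1 <= i < _) _.
have uD : Delta \is a GRing.unit.
  apply: rpred_prod => i _; rewrite big_nat; apply: rpred_prod => j /andP [ij _].
  by apply: (proj1 (unit_1subq _)); rewrite subn_gt0.
have uq : qinfty ^+ c' \is a GRing.unit by rewrite unitrX // qinfty_unit.
(* The prefactor of [singlet_char] cancels against the second factor of the limit. *)
rewrite -mulrA [(_ / Delta) * _]mulrA [(_ / Delta) * (Delta / _)]mulrA.
rewrite divrK // divrr // mul1r.
exact: torus_limit.
Qed.
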